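(* Let $m\ge n\ge 1$, let $-\infty<a<b<\infty$ and $-\infty<c<d<\infty$ with either $b<c$ or $d<a$, let $x_1<\cdots<x_m$ be points in $[a,b]$ and $y_1<\cdots<y_n$ points in $[c,d]$, let $\underline{s}\in\mathbb{C}^{m}$, $\underline{t}\in\mathbb{C}^{n}$, and let $C_{m,n}$ be the $m\times n$ (generalized) Cauchy matrix with entries \[ (C_{m,n})_{jk}=\frac{s_jt_k}{x_j-y_k},\qquad 1\le j\le m,\ 1\le k\le n. \] Let \[ \gamma=\frac{|c-a|\,|d-b|}{|c-b|\,|d-a|} \] be the absolute value of the cross-ratio of $a,b,c,d$. Then, for all integers $j\ge 1$ and $k\ge 0$ with $1\le j+k\le n$, \[ \sigma_{j+k}(C_{m,n})\le 4\left[\exp\left(\frac{\pi^2}{4\mu(1/\sqrt{\gamma})}\right)\right]^{-2k}\sigma_j(C_{m,n}), \] where $\mu$ is the Gr\''otzsch ring function. If $0<a<b$, $c=-b$ and $d=-a$, then $2\mu(1/\sqrt{\gamma})=\mu(a/b)$. The bound remains valid if $4\mu(1/\sqrt{\gamma})$ is replaced by $2\log(16\gamma)$.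
   Context: $\sigma_1(C)\ge\cdots\ge\sigma_n(C)\ge 0$ denote the singular values of an $m\times n$ matrix $C$ with $m\ge n$. The Gr\''otzsch ring function is $\mu(\lambda)=\frac{\pi}{2}\,K(\sqrt{1-\lambda^2})/K(\lambda)$ for $0<\lambda<1$, where $K(\lambda)=\int_0^1 \frac{dt}{\sqrt{(1-t^2)(1-\lambda^2t^2)}}$ is the complete elliptic integral of the first kind. *)

(* Defs.v *)
From HB Require Import structures.
From mathcomp Require Import all_boot all_order all_algebra.
From mathcomp Require Export sesquilinear spectral.
From mathcomp Require Export complex.
From mathcomp Require Import all_classical all_reals all_analysis.

Set Implicit Arguments.
Unset Strict Implicit.
Unset Printing Implicit Defensive.

Import Order.TTheory GRing.Theory Num.Theory.
Import numFieldNormedType.Exports.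

Local Open Scope ring_scope.
Local Open Scope sesquilinear_scope.
Local Open Scope complex_scope.

Section SingularValues.
Variables (R : realType) (m n : nat).
Implicit Type C : 'M[R[i]]_(m, n).

(* The square roots of the n eigenvalues, with multiplicity, of the Hermitian
   positive semidefinite matrix C^* C, in nonincreasing order. The eigenvalues
   are real, so taking the real part only changes their type. *)
Definition singular_values C : seq R :=
  sort >=%R [seq Num.sqrt (complex.Re (spectral_diag (C ^t* *m C) 0 i))
            | i <- enum 'I_n].

(* Numbered from 1; by convention 0 if k = 0 or k > n. *)
Definition sigma (k : nat) C : R :=
  if k is k'.+1 then nth 0 (singular_values C) k' else 0.

Lemma size_singular_values C : size (singular_values C) = n.
Proof. by rewrite size_sort size_map size_enum_ord. Qed.

Lemma sorted_singular_values C : sorted >=%R (singular_values C).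
Proof. by apply: sort_sorted => x y; exact: ge_total. Qed.

Lemma gram_normal C : C ^t* *m C \is normalmx.
Proof. by apply/normalmxP; rewrite trmx_mul map_mxM trmxCK. Qed.

Lemma gram_spectral_diag_ge0 C i : 0 <= spectral_diag (C ^t* *m C) 0 i.
Proof.
have /orthomx_spectralP := gram_normal C.
set P := spectralmx _; set D := spectral_diag _ => eqG.
have uP : P \is unitarymx := spectral_unitarymx _.
have PP : P *m P ^t* = 1%:M by apply/unitarymxP.
have : (C *m P ^t*) ^t* *m (C *m P ^t*) = diag_mx D.
  rewrite trmx_mul map_mxM trmxCK mulmxA -(mulmxA P) eqG invmx_unitary //.
  rewrite !mulmxA PP mul1mx -mulmxA PP.
  by rewrite mulmx1.
move/matrixP/(_ i i); rewrite [in X in _ = X -> _]mxE eqxx mulr1n => <-.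
rewrite mxE sumr_ge0 // => k _.
by rewrite [(_ ^t*) i k]mxE [_^T i k]mxE mulrC mul_conjC_ge0.
Qed.

(* Singular values as usually described: their squares are the roots, with
   multiplicity, of the characteristic polynomial of C^* C. *)
Lemma char_poly_gram C :
  char_poly (C ^t* *m C) =
  \prod_(s <- singular_values C) ('X - ((s ^+ 2)%:C)%:P).
Proof.
have /orthomx_spectralP := gram_normal C.
set P := spectralmx _; set D := spectral_diag _ => eqG.
have Pu : P \in unitmx := spectral_unit _.
have -> : char_poly (C ^t* *m C) = char_poly (diag_mx D).
  rewrite eqG /char_poly /char_poly_mx !map_mxM.
  have PiP : map_mx polyC (invmx P) *m map_mx polyC P = 1%:M.
    by rewrite -map_mxM mulVmx // map_mx1.
  have {1}-> : 'X%:M = map_mx polyC (invmx P) *m 'X%:M *m map_mx polyC P.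
    by rewrite mul_mx_scalar -scalemxAl PiP scalemx1.
  rewrite -mulmxBl -mulmxBr !det_mulmx mulrAC -det_mulmx PiP det1 mul1r.
  by [].
rewrite char_poly_trig ?diag_mx_is_trig //.
rewrite (perm_big _ (permEl (perm_sort _ _))) big_map big_enum /=.
apply: eq_bigr => i _; rewrite mxE eqxx mulr1n.
have D_ge0 : 0 <= D 0 i := gram_spectral_diag_ge0 C i.
have ReD : (complex.Re (D 0 i))%:C = D 0 i by rewrite RRe_real ?ger0_real.
by rewrite sqr_sqrtr ?ReD // -lecR ReD.
Qed.

End SingularValues.

Section EllipticIntegral.
Variable R : realType.

(* Meaningful for 0 <= l < 1. The integrand takes the junk value 0^-1 = 0 at the
   singular endpoint t = 1, which is Lebesgue-negligible. *)
Definition elliptic_K (l : R) : R :=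
  \int[@lebesgue_measure R]_(t in `[0, 1])
    (Num.sqrt ((1 - t ^+ 2) * (1 - l ^+ 2 * t ^+ 2)))^-1.

(* Meaningful for 0 < l < 1. *)
Definition grotzsch_mu (l : R) : R :=
  pi / 2 * (elliptic_K (Num.sqrt (1 - l ^+ 2)) / elliptic_K l).

End EllipticIntegral.

Definition abs_cross_ratio (R : realType) (a b c d : R) : R :=
  (`|c - a| * `|d - b|) / (`|c - b| * `|d - a|).

Definition cauchy_mx (R : realType) (m n : nat)
    (s : 'I_m -> R[i]) (t : 'I_n -> R[i]) (x : 'I_m -> R) (y : 'I_n -> R) :
    'M[R[i]]_(m, n) :=
  \matrix_(j, k) (s j * t k / (x j - y k)%:C).

(* Main.v *)
Require Import Defs.
From mathcomp Require Import all_boot all_order all_algebra.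
From mathcomp Require Import all_classical all_reals all_analysis.
From mathcomp Require Import measurable_realfun.
From mathcomp Require Import ring lra zify.

(** The generalized Cauchy matrix C satisfies X C - C Y = s t^T with
    X = diag(x), Y = diag(y), and it is this rank-one displacement that forces
    the decay of its singular values.  For a rational function r of degree at
    most k the matrix C - r(X) C r(Y)^-1 has rank at most k, because its entries
    are Bezoutians; Weyl's inequality then gives
      sigma_(j+k)(C) <= sup_E |r| * sup_F |1/r| * sigma_j(C)
    for any sets E and F containing the nodes x and y
    (sigma_two_sided_low_rank, sigma_cauchy_rational).  What remains is
    Zolotarev's problem for E = [a, b] and F = [c, d]: to find r of degree k for
    which that product of suprema is at most 4 exp(- 2 k pi^2 / (4 mu)), where mu
    is the value of the ring function at 1 / sqrt gamma.

    The function r comes from theta series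
    theta(w) = sum_s g^(s^2) w^s with w > 0.  Let theta_ratio g be the odd part
    of the series divided by its even part.  It maps the half-line w > 0 onto
    [m, 1/m], with m = root_modulus g (theta_ratio_ge, theta_ratio_onto).  Write
    g = h^k.  Grouping the factors of the triple product modulo k shows that
    theta_ratio h is related to theta_ratio g by a rational map of degree k
    (theta_ratio_transform):
      prod_i (1 - c_i y) / (1 + c_i y) = (1 - y' m') / (1 + y' m'),
      y = theta_ratio g w, y' = theta_ratio h w, m' = root_modulus h.
    The right-hand side stays between 0 and 2 e / (1 + e^2), where
    e = (1 - m') / (1 + m').  So the product on the left is small on [m, 1/m], it
    is inverted by y -> -y, and after a Moebius change of its values it lies in
    [-e, e] (recenter_bound).  The cross-ratio determines m such that a Moebius
    map sends [a, b] to [m, 1/m] and [c, d] to [-1/m, -m]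
    (cross_ratio_parameter; moebius_bounds uses the coordinate
    (1 - m y) / (1 + m y) in place of y); this proves the estimate with the
    factor e^2 (sigma_cauchy_transform).

    The value of e is expressed through the ring function.  Landen's
    transformation of the elliptic integral (elliptic_K_landen) gives
    mu(2 sqrt k / (1 + k)) = mu(k) / 2 and mu(k) mu((1 - k) / (1 + k)) = pi^2/2.
    The first identity is matched by the doubling formula for m
    (root_modulus_double), so that mu(m(g)^2) = mu(m(g^(2^n))^2) / 2^n, and the
    logarithmic growth of mu at 0 yields mu(m(g)^2) = - 2 ln g
    (grotzsch_mu_root_modulus).  Since m(g) <= 2 g, this contains the inequality
    mu(x) <= ln (4 / x) (grotzsch_mu_le_log).  Applied to x = e^2, for which
    mu(e^2) = pi^2 / mu(m'^2), it bounds e^2 by 4 exp(- pi^2 / mu(m'^2))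
    (sqr_dual_le).  Finally mu(m^2) = k mu(m'^2) because g = h^k, and mu(m^2) is
    twice the value at 1 / sqrt gamma, again by Landen.  The inequality
    mu(x) <= ln (4 / x) at x = 1 / sqrt gamma also gives the bound with
    2 ln (16 gamma). *)

Set Implicit Arguments.
Unset Strict Implicit.
Unset Printing Implicit Defensive.

Import Order.TTheory GRing.Theory Num.Theory.
Import numFieldNormedType.Exports.

Local Open Scope classical_set_scope.
Local Open Scope ring_scope.

(** * Singular values and perturbations of low rank *)

Section SortedCounting.
Variable R : realType.
Implicit Type s : seq R.

Lemma count_gt_nth_sorted s i : sorted >=%R s -> (i < size s)%N ->
  (count (fun x => (nth 0%R s i < x)%R) s <= i)%N.
Proof.
move=> ss lis; set v := nth 0 s i; rewrite -{1}(cat_take_drop i s) count_cat.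
rewrite [X in (_ + X)%N](_ : _ = 0%N) ?addn0; last first.
  apply/eqP; rewrite -leqn0 leqNgt -has_count; apply/hasPn => x.
  case/(nthP 0) => j; rewrite size_drop => lj <-; rewrite nth_drop -leNgt.
  have ge_trans : transitive (>=%R : rel R) by move=> a b c /[swap]; apply: le_trans.
  by apply: (sorted_leq_nth ge_trans (fun x => lexx x) 0 ss); rewrite ?inE /= ?leq_addr // -ltn_subRL.
by rewrite (leq_trans (count_size _ _)) // size_take; case: ltnP; lia.
Qed.

Lemma count_ge_nth_sorted s i : sorted >=%R s -> (i < size s)%N ->
  (i < count (fun x => (nth 0%R s i <= x)%R) s)%N.
Proof.
move=> ss lis; set v := nth 0 s i; rewrite -{1}(cat_take_drop i.+1 s) count_cat.
suff : all (fun x => v <= x) (take i.+1 s).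
  by rewrite all_count => /eqP ->; rewrite size_takel // leq_addr.
apply/(all_nthP 0) => j; rewrite size_takel // => lj.
rewrite nth_take //.
have ge_trans : transitive (>=%R : rel R) by move=> a b c /[swap]; apply: le_trans.
by apply: (sorted_leq_nth ge_trans (fun x => lexx x) 0 ss); rewrite ?inE //= (leq_trans lj).
Qed.

End SortedCounting.

Section LowRank.
Local Open Scope sesquilinear_scope.
Local Open Scope complex_scope.
Variable R : realType.
Local Notation F := R[i].

Definition normsq n (z : 'cV[F]_n) : F := \sum_i `|z i 0| ^+ 2.

Lemma normsqE n (z : 'cV[F]_n) : normsq z = (z ^t* *m z) 0 0.
Proof.
by rewrite mxE; apply: eq_bigr => i _; rewrite !mxE normCKC.
Qed.

Lemma normsq_ge0 n (z : 'cV[F]_n) : 0 <= normsq z.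
Proof. by apply: sumr_ge0 => i _; rewrite exprn_ge0. Qed.

Lemma normsq_gt0 n (z : 'cV[F]_n) : z != 0 -> 0 < normsq z.
Proof.
move=> z0; rewrite lt_neqAle normsq_ge0 andbT eq_sym.
apply: contra z0 => /eqP/psumr_eq0P h; apply/eqP/matrixP => i j.
rewrite ord1 mxE; apply/eqP; rewrite -normr_eq0 -sqrf_eq0; apply/eqP.
by apply: h => // k _; rewrite exprn_ge0.
Qed.

Lemma normsq_unitary n (P : 'M[F]_n) (z : 'cV[F]_n) :
  P \is unitarymx -> normsq (P *m z) = normsq z.
Proof.
move=> uP; rewrite !normsqE trmx_mul map_mxM mulmxA -(mulmxA (z ^t*)).
by rewrite -invmx_unitary // mulVmx ?mulmx1 // unitarymx_unit.
Qed.

Section Singular.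
Variables (m n : nat) (C : 'M[F]_(m, n)).
Let P := spectralmx (C ^t* *m C).
Definition unsorted_sv i := Num.sqrt (complex.Re (spectral_diag (C ^t* *m C) 0 i)).

Lemma unsorted_svE i : spectral_diag (C ^t* *m C) 0 i = ((unsorted_sv i) ^+ 2)%:C.
Proof.
have D0 := gram_spectral_diag_ge0 C i.
by rewrite sqr_sqrtr ?RRe_real ?ger0_real // -lecR RRe_real ?ger0_real.
Qed.

Lemma normsq_mul (z : 'cV[F]_n) :
  normsq (C *m z) = \sum_i ((unsorted_sv i) ^+ 2)%:C * `|(P *m z) i 0| ^+ 2.
Proof.
have /orthomx_spectralP eqG := gram_normal C.
have uP : P \is unitarymx := spectral_unitarymx _.
have -> : normsq (C *m z) =
    ((P *m z) ^t* *m (diag_mx (spectral_diag (C ^t* *m C)) *m (P *m z))) 0 0.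
  rewrite normsqE trmx_mul map_mxM mulmxA -(mulmxA (z ^t*)) [in LHS]eqG.
  by rewrite invmx_unitary // trmx_mul map_mxM !mulmxA.
rewrite mxE; apply: eq_bigr => i _; rewrite mul_diag_mx.
move: (P *m z) => v; rewrite !mxE unsorted_svE normCKC; ring.
Qed.

Lemma count_unsorted_sv p : count p (singular_values C) = #|[pred i | p (unsorted_sv i)]|.
Proof.
rewrite (permP (permEl (perm_sort _ _))) count_map -sum1_count big_enum_cond /=.
by rewrite sum1_card; apply: eq_card => i; rewrite !inE.
Qed.

Lemma sigma_ge0 k : 0 <= sigma k C.
Proof.
case: k => //= k; have [lk|lk] := ltnP k (size (singular_values C)); last first.
  by rewrite nth_default.
have := mem_nth 0 lk; rewrite mem_sort => /mapP[i _ ->]; exact: sqrtr_ge0.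
Qed.

Lemma card_unsorted_sv_gt j : (1 <= j <= n)%N ->
  (#|[pred i | (sigma j C < unsorted_sv i)%R]| <= j.-1)%N.
Proof.
case: j => // j /= ljn; rewrite -(count_unsorted_sv (fun x => _ < x)).
by apply: count_gt_nth_sorted; rewrite ?sorted_singular_values ?size_singular_values.
Qed.

Lemma card_unsorted_sv_ge j : (1 <= j <= n)%N ->
  (j <= #|[pred i | (sigma j C <= unsorted_sv i)%R]|)%N.
Proof.
case: j => // j /= ljn; rewrite -(count_unsorted_sv (fun x => (_ <= x)%R)).
by apply: count_ge_nth_sorted; rewrite ?sorted_singular_values ?size_singular_values.
Qed.

(** In the basis of right singular vectors C acts by scaling with the
    singular values, so killing the coordinates with a large scaling factor
    bounds the norm. *)
Lemma normsq_mul_le (s : R) (z : 'cV[F]_n) : 0 <= s ->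
  (forall i, s < unsorted_sv i -> (P *m z) i 0 = 0) ->
  normsq (C *m z) <= (s ^+ 2)%:C * normsq z.
Proof.
move=> s0 h; rewrite normsq_mul -(@normsq_unitary n P z (spectral_unitarymx _)).
rewrite /normsq mulr_sumr; apply: ler_sum => i _.
have [lt_s|ge_s] := ltP s (unsorted_sv i); first by rewrite h // normr0 expr0n !mulr0.
by rewrite ler_wpM2r ?exprn_ge0 // lecR ler_pXn2r // nnegrE sqrtr_ge0.
Qed.

Lemma normsq_mul_ge (s : R) (z : 'cV[F]_n) : 0 <= s ->
  (forall i, unsorted_sv i < s -> (P *m z) i 0 = 0) ->
  (s ^+ 2)%:C * normsq z <= normsq (C *m z).
Proof.
move=> s0 h; rewrite normsq_mul -(@normsq_unitary n P z (spectral_unitarymx _)).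
rewrite /normsq mulr_sumr; apply: ler_sum => i _.
have [lt_s|ge_s] := ltP (unsorted_sv i) s; first by rewrite h // normr0 expr0n !mulr0.
by rewrite ler_wpM2r ?exprn_ge0 // lecR ler_pXn2r // nnegrE sqrtr_ge0.
Qed.

End Singular.

Definition coord_mask n (p : pred 'I_n) : 'M[F]_n := diag_mx (\row_i (p i)%:R).

Lemma coord_mask_mul n (p : pred 'I_n) k (A : 'M[F]_(n, k)) i j :
  (coord_mask p *m A) i j = (p i)%:R * A i j.
Proof. by rewrite mul_diag_mx !mxE. Qed.

Lemma rank_coord_mask n (p : pred 'I_n) : (\rank (coord_mask p) <= #|p|)%N.
Proof.
have -> : coord_mask p = \sum_(i | p i) delta_mx i i.
  apply/matrixP => i j; rewrite summxE !mxE.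
  rewrite big_mkcond (bigD1 i) //= big1 => [|k /negPf ki]; last first.
    by case: ifP => // _; rewrite mxE eq_sym ki.
  by rewrite addr0; case: (p i); rewrite ?mul0rn // !mxE eqxx /= [j == i]eq_sym.
apply: leq_trans (_ : \sum_(i | p i) 1 <= _)%N; last by rewrite sum1_card.
elim/big_ind2: _ => [|A1 n1 A2 n2 h1 h2|i _]; rewrite ?mxrank0 ?mxrank_delta //.
by rewrite (leq_trans (mxrank_add _ _)) // leq_add.
Qed.

Lemma exists_ker n k1 k2 k3 (A1 : 'M[F]_(k1, n)) (A2 : 'M[F]_(k2, n))
    (A3 : 'M[F]_(k3, n)) : (\rank A1 + \rank A2 + \rank A3 < n)%N ->
  exists z : 'cV[F]_n, [/\ z != 0, A1 *m z = 0, A2 *m z = 0 & A3 *m z = 0].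
Proof.
move=> lt_n; pose A := col_mx A1 (col_mx A2 A3).
have rA : (\rank A < n)%N.
  apply: leq_ltn_trans lt_n; rewrite -addsmxE.
  apply: leq_trans (mxrank_adds_leqif _ _) _; rewrite -addnA leq_add2l.
  by rewrite -addsmxE; apply: (mxrank_adds_leqif _ _).
have : kermx A^T != 0 by rewrite -mxrank_eq0 mxrank_ker mxrank_tr -lt0n subn_gt0.
case/rowV0Pn => v /sub_kermxP vA v0; exists v^T.
have : A *m v^T = 0 by rewrite -[A]trmxK -trmx_mul vA trmx0.
rewrite !mul_col_mx => /eqP; rewrite !col_mx_eq0 => /and3P[/eqP ? /eqP ? /eqP ?].
split=> //; apply: contra v0 => /eqP/(congr1 trmx); rewrite trmxK trmx0 => ->.
exact: eqxx.
Qed.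

(** Weyl's inequality for a perturbation of rank k, combined with the
    multiplicative bound for D1 and D2.  A nonzero vector z is chosen in the
    kernel of V, with D2 z orthogonal to the right singular vectors above
    sigma_j and z orthogonal to those below sigma_(j+k). *)
Lemma sigma_two_sided_low_rank m n k (C : 'M[F]_(m, n)) (D1 : 'M[F]_m)
    (D2 : 'M[F]_n) (U : 'M[F]_(m, k)) (V : 'M[F]_(k, n)) (d1 d2 : R) (j : nat) :
  C = D1 *m C *m D2 + U *m V -> 0 <= d1 -> 0 <= d2 ->
  (forall z, normsq (D1 *m z) <= (d1 ^+ 2)%:C * normsq z) ->
  (forall z, normsq (D2 *m z) <= (d2 ^+ 2)%:C * normsq z) ->
  (1 <= j)%N -> (1 <= j + k <= n)%N ->
  sigma (j + k) C <= d1 * d2 * sigma j C.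
Proof.
move=> eqC d1_ge0 d2_ge0 hD1 hD2 j1 jkn.
pose P := spectralmx (C ^t* *m C).
pose pgt := [pred i : 'I_n | sigma j C < unsorted_sv C i].
pose plt := [pred i : 'I_n | unsorted_sv C i < sigma (j + k) C].
have r1 : (\rank (coord_mask pgt *m P *m D2) <= j.-1)%N.
  rewrite -mulmxA; apply: leq_trans (mxrankM_maxl _ _) _.
  apply: leq_trans (rank_coord_mask _) _.
  by apply: (@card_unsorted_sv_gt _ _ C j); lia.
have r2 : (\rank (coord_mask plt *m P) <= n - (j + k))%N.
  apply: leq_trans (mxrankM_maxl _ _) _; apply: leq_trans (rank_coord_mask _) _.
  have := card_unsorted_sv_ge C jkn; set p := [pred i | _] => cp.
  have e : (#|p| + #|plt| = n)%N.
    by rewrite -[RHS]card_ord -(cardC p); congr addn; apply: eq_card => i; rewrite !inE ltNge.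
  case/andP: jkn => _ jkn; rewrite leq_subRL //.
  by rewrite -[leqRHS]e leq_add2r.
have r3 := rank_leq_row V.
have [|z [z0 e1 e2 e3]] := @exists_ker _ _ _ _ (coord_mask pgt *m P *m D2) (coord_mask plt *m P) V.
  by lia.
have sj0 := sigma_ge0 C j.
have : ((sigma (j + k) C) ^+ 2)%:C * normsq z <=
       ((d1 * d2 * sigma j C) ^+ 2)%:C * normsq z.
  apply: le_trans (@normsq_mul_ge _ _ C _ z (sigma_ge0 C _) _) _.
    move=> i lti; move/matrixP/(_ i 0): e2.
    by rewrite -mulmxA coord_mask_mul /= lti mul1r [in X in _ = X -> _]mxE.
  have -> : C *m z = D1 *m (C *m (D2 *m z)).
    by rewrite [in LHS]eqC mulmxDl -(mulmxA U) e3 mulmx0 addr0 -!mulmxA.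
  apply: le_trans (hD1 _) _.
  have -> : ((d1 * d2 * sigma j C) ^+ 2)%:C =
      (d1 ^+ 2)%:C * ((d2 ^+ 2)%:C * (sigma j C ^+ 2)%:C).
    by rewrite -!rmorphM /= !exprMn mulrA.
  rewrite -mulrA; apply: ler_wpM2l.
    by rewrite ler0c exprn_ge0.
  apply: le_trans (@normsq_mul_le _ _ C _ (D2 *m z) sj0 _) _.
    move=> i lti; move/matrixP/(_ i 0): e1.
    by rewrite -!mulmxA coord_mask_mul /= lti mul1r [in X in _ = X -> _]mxE.
  rewrite -mulrA mulrCA; apply: ler_wpM2l; first by rewrite ler0c exprn_ge0.
  exact: hD2.
rewrite ler_pM2r ?normsq_gt0 // lecR ler_pXn2r ?nnegrE ?sigma_ge0 //.
by rewrite !mulr_ge0.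
Qed.

Lemma normsq_diag n (d : R) (v : 'I_n -> F) : 0 <= d ->
  (forall i, `|v i| <= d%:C) ->
  forall z, normsq (diag_mx (\row_i v i) *m z) <= (d ^+ 2)%:C * normsq z.
Proof.
move=> d0 vd z; rewrite /normsq mulr_sumr; apply: ler_sum => i _.
rewrite mul_diag_mx !mxE normrM exprMn ler_wpM2r ?exprn_ge0 //.
rewrite rmorphXn /= ler_pXn2r ?nnegrE //; last by rewrite lecR.
Qed.

(** For r = p / q the matrix C - r(X) C r(Y)^-1 has rank at most k: up to
    factors depending on x or on y only, its entries are the Bezoutians
    (q(x) p(y) - p(x) q(y)) / (x - y), polynomials of degree less than k
    in x. *)
Lemma sigma_cauchy_rational m n k (s : 'I_m -> F) (t : 'I_n -> F)
    (x : 'I_m -> R) (y : 'I_n -> R) (p q : {poly R}) (d1 d2 : R) (j : nat) :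
  (size p <= k.+1)%N -> (size q <= k.+1)%N -> 0 <= d1 -> 0 <= d2 ->
  (forall i l, x i != y l) ->
  (forall i, q.[x i] != 0) -> (forall i, p.[y i] != 0) ->
  (forall i, `|p.[x i] / q.[x i]| <= d1) ->
  (forall i, `|q.[y i] / p.[y i]| <= d2) ->
  (1 <= j)%N -> (1 <= j + k <= n)%N ->
  sigma (j + k) (cauchy_mx s t x y) <= d1 * d2 * sigma j (cauchy_mx s t x y).
Proof.
move=> sp sq d1_0 d2_0 xy qx py hp hq j1 jkn.
pose D1 : 'M[F]_m := diag_mx (\row_i (p.[x i] / q.[x i])%:C).
pose D2 : 'M[F]_n := diag_mx (\row_i (q.[y i] / p.[y i])%:C).
pose B l : {poly R} := (p.[y l] *: q - q.[y l] *: p) %/ ('X - (y l)%:P).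
(* The Bezoutian is expanded in powers of x, so U V has inner dimension k. *)
pose U : 'M[F]_(m, k) := \matrix_(i, l) (s i / q.[x i]%:C * (x i ^+ l)%:C).
pose V : 'M[F]_(k, n) := \matrix_(l, i) (t i / p.[y i]%:C * ((B i)`_l)%:C).
have normCr (r : R) : `|r%:C| = `|r|%:C :> F.
  by rewrite normc_def /= expr0n addr0 sqrtr_sqr.
apply: (@sigma_two_sided_low_rank m n k _ D1 D2 U V) => //; last first.
- by apply: normsq_diag => // i; rewrite normCr lecR.
- by apply: normsq_diag => // i; rewrite normCr lecR.
apply/matrixP => i l; rewrite [RHS]mxE.
have -> : (D1 *m cauchy_mx s t x y *m D2) i l =
   (p.[x i] / q.[x i])%:C * (s i * t l / (x i - y l)%:C) * (q.[y l] / p.[y l])%:C.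
  by rewrite mul_mx_diag mxE mul_diag_mx !mxE.
have -> : (U *m V) i l =
    s i * t l / q.[x i]%:C / p.[y l]%:C * ((B l).[x i])%:C.
  have sB : (size (B l) <= k)%N.
    rewrite size_divp ?polyXsubC_eq0 // size_XsubC /= leq_subLR add1n.
    rewrite (leq_trans (size_polyD _ _)) // geq_max size_polyN.
    by rewrite !(leq_trans (size_scale_leq _ _)).
  rewrite mxE (horner_coef_wide _ sB) rmorph_sum mulr_sumr; apply: eq_bigr => l' _.
  rewrite !mxE rmorphM /=; ring.
have eB : (B l).[x i] * (x i - y l) = p.[y l] * q.[x i] - q.[y l] * p.[x i].
  have dv : 'X - (y l)%:P %| p.[y l] *: q - q.[y l] *: p.
    by rewrite dvdp_XsubCl rootE !hornerE mulrC subrr.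
  have := divpK dv; rewrite -/(B l) => /(congr1 (fun r => r.[x i])).
  by rewrite !hornerE.
have xy0 : x i - y l != 0 by rewrite subr_eq0.
have -> : (B l).[x i] = (p.[y l] * q.[x i] - q.[y l] * p.[x i]) / (x i - y l).
  by rewrite -eB mulfK.
have nz r : r != 0 -> r%:C != 0 :> F by move=> ?; rewrite fmorph_eq0.
rewrite mxE; have := nz _ xy0; have := nz _ (qx i); have := nz _ (py l).
rewrite !rmorphM !rmorphB !fmorphV !rmorphM !rmorphB /= => ? ? ?; field.
by apply/and3P.
Qed.

End LowRank.

(** * Improper integrals on the unit interval *)

Section Integrals.
Variable R : realType.
Local Notation mu := (@lebesgue_measure R).
Implicit Types (f g F : R -> R) (a b r : R).

Lemma continuous_within_itv f a b : (forall x, a <= x <= b -> {for x, continuous f}) ->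
  {within `[a, b], continuous f}.
Proof.
move=> h; apply: continuous_in_subspaceT => x; rewrite inE /= in_itv /= => xab.
exact: h.
Qed.

Lemma integral_derive F g a b : a < b ->
  (forall x, a <= x <= b -> is_derive x 1 F (g x)) ->
  (forall x, a <= x <= b -> {for x, continuous g}) ->
  (\int[mu]_(x in `[a, b]) (g x)%:E = (F b - F a)%:E)%E.
Proof.
move=> ab dF cg.
have cF x : a <= x <= b -> {for x, continuous F}.
  move=> xab; have [dFx _] := dF x xab.
  exact/differentiable_continuous/derivable1_diffP.
rewrite (@continuous_FTC2 _ g F a b ab) //.
- exact: continuous_within_itv.
- split.
  + by move=> x; rewrite in_itv /= => /andP[ax xb]; have [] := dF x; rewrite ?ltW.
  + by apply: cvg_at_right_filter; apply: cF; rewrite lexx ltW.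
  + by apply: cvg_at_left_filter; apply: cF; rewrite lexx ltW.
- move=> x; rewrite in_itv /= => /andP[ax xb].
  by rewrite derive1E; have [] := dF x; rewrite ?ltW.
Qed.

Lemma measurable_continuous_itv f a b : (forall x, a <= x <= b -> {for x, continuous f}) ->
  measurable_fun `[a, b] f.
Proof.
by move=> h; apply: subspace_continuous_measurable_fun => //; exact: continuous_within_itv.
Qed.

Lemma integral_le_derive f F g a b : a < b ->
  (forall x, a <= x <= b -> {for x, continuous f}) ->
  (forall x, a <= x <= b -> is_derive x 1 F (g x)) ->
  (forall x, a <= x <= b -> {for x, continuous g}) ->
  (forall x, a <= x <= b -> 0 <= f x <= g x) ->
  (\int[mu]_(x in `[a, b]) (f x)%:E <= (F b - F a)%:E)%E.
Proof.
move=> ab cf dF cg fg; rewrite -(integral_derive ab dF cg).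
apply: ge0_le_integral => //.
- by move=> x /=; rewrite in_itv /= => /fg /andP[? _]; rewrite lee_fin.
- by apply/measurable_EFinP; apply: measurable_continuous_itv => x xab; exact: cf.
- by apply/measurable_EFinP; apply: measurable_continuous_itv => x xab; exact: cg.
- by move=> x /=; rewrite in_itv /= => /fg /andP[_ ?]; rewrite lee_fin.
Qed.

Lemma derive_le_integral f F g a b : a < b ->
  (forall x, a <= x <= b -> {for x, continuous f}) ->
  (forall x, a <= x <= b -> is_derive x 1 F (g x)) ->
  (forall x, a <= x <= b -> {for x, continuous g}) ->
  (forall x, a <= x <= b -> 0 <= g x <= f x) ->
  ((F b - F a)%:E <= \int[mu]_(x in `[a, b]) (f x)%:E)%E.
Proof.
move=> ab cf dF cg fg; rewrite -(integral_derive ab dF cg).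
apply: ge0_le_integral => //.
- by move=> x /=; rewrite in_itv /= => /fg /andP[? _]; rewrite lee_fin.
- by apply/measurable_EFinP; apply: measurable_continuous_itv => x xab; exact: cg.
- by apply/measurable_EFinP; apply: measurable_continuous_itv => x xab; exact: cf.
- by move=> x /=; rewrite in_itv /= => /fg /andP[_ ?]; rewrite lee_fin.
Qed.

Section Improper.
Variable f : R -> R.
Hypothesis f0 : forall x, 0 <= f x.
Hypothesis cf : forall x : R, -1 < x < 1 -> {for x, continuous f}.

Lemma measurable_continuous_oo : measurable_fun (`](-1 : R), 1[%classic : set R) f.
Proof.
apply: open_continuous_measurable_fun => //.
by move=> x; rewrite inE /= in_itv /=; exact: cf.
Qed.

Lemma measurable_continuous_sub (D : set R) : measurable D -> D `<=` (`](-1 : R), 1[%classic : set R) ->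
  measurable_fun D (EFin \o f).
Proof.
move=> mD sub; apply/measurable_EFinP.
exact: (measurable_funS _ sub measurable_continuous_oo).
Qed.

Lemma integral_half_open : (\int[mu]_(x in `[0%R, 1%R]) (f x)%:E =
  \int[mu]_(x in `[0%R, 1%R[) (f x)%:E)%E.
Proof.
rewrite integral_itv_bndo_bndc //; apply: measurable_continuous_sub => //.
by move=> x /=; rewrite !in_itv /= => /andP[? ->]; rewrite andbT; lra.
Qed.

Lemma integral_sub_le r : r < 1 ->
  (\int[mu]_(x in `[0%R, r]) (f x)%:E <= \int[mu]_(x in `[0%R, 1%R]) (f x)%:E)%E.
Proof.
move=> r1; rewrite integral_half_open; apply: ge0_subset_integral => //.
- apply: measurable_continuous_sub => //.
  by move=> x /=; rewrite !in_itv /= => /andP[? ->]; rewrite andbT; lra.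
- by move=> x _; rewrite lee_fin.
- by move=> x /=; rewrite !in_itv /= => /andP[-> xr] /=; lra.
Qed.

(** Monotone convergence along the intervals [0, 1 - e_n] with e_n -> 0. *)
Lemma integral_le_limit (C : \bar R) :
  (forall r, (0 < r < 1)%R -> \int[mu]_(x in `[0%R, r]) (f x)%:E <= C)%E ->
  (\int[mu]_(x in `[0%R, 1%R]) (f x)%:E <= C)%E.
Proof.
move=> h.
have [e [n0 n1 ne e_lim]] : exists e : nat -> R, [/\ forall n, 0 < e n,
    forall n, e n < 1, forall i j, (i <= j)%N -> e j <= e i &
    forall x, 0 < x -> exists n, e n < x].
  exists (fun n => n.+2%:R^-1); split=> [n|n|i j ij|x x0].
  - by rewrite invr_gt0 ltr0n.
  - by rewrite invf_lt1 ?ltr1n ?ltr0n.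
  - by rewrite lef_pV2 ?posrE ?ltr0n // ler_nat.
  - have [n] := @ltr_add_invr R 0 x x0; rewrite add0r => hn; exists n.
    by apply: le_lt_trans hn; rewrite lef_pV2 ?posrE ?ltr0n // ler_nat.
pose D n := `[0%R, (1 - e n)]%classic.
have UD : `[0%R, 1%R[%classic = \bigcup_n D n :> set R.
  apply/seteqP; split => [x|x [n _]]; rewrite /D /= !in_itv /=; last first.
    by move=> /andP[-> xn] /=; have := n0 n; lra.
  move=> /andP[x0 x1]; have x1' : 0 < 1 - x by rewrite subr_gt0.
  have [n hn] := e_lim _ x1'.
  by exists n => //=; rewrite in_itv /= x0 /=; lra.
rewrite integral_half_open UD.
have : (\int[mu]_(x in D n) (f x)%:E @[n --> \oo] -->
   \int[mu]_(x in \bigcup_n D n) (f x)%:E)%E.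
  apply: (@ge0_nondecreasing_set_cvg_integral _ (measurableTypeR R) R D (EFin \o f) lebesgue_measure).
  - move=> i j ij; rewrite subsetEset => x; rewrite /D /= !in_itv /= => /andP[-> /=].
    by have := ne _ _ ij; lra.
  - by move=> i; exact: measurable_itv.
  - move=> i; apply: measurable_continuous_sub; first exact: measurable_itv.
    by move=> x; rewrite /D /= !in_itv /= => /andP[x0 xn]; have := n0 i; lra.
  - by move=> i x _; rewrite lee_fin.
move=> cv; rewrite -(cvg_lim _ cv) //; apply: lime_le; first by apply/cvg_ex; eexists; exact: cv.
near=> n; apply: h; have := n0 n; have := n1 n; lra.
Unshelve. all: by end_near. Qed.

Lemma integral_split a r : 0 < a < r -> r < 1 ->
  (\int[mu]_(x in `[0%R, r]) (f x)%:E =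
   \int[mu]_(x in `[0%R, a]) (f x)%:E + \int[mu]_(x in `[a, r]) (f x)%:E)%E.
Proof.
move=> /andP[a0 ar] r1.
rewrite -(@integral_itv_obnd_cbnd _ a (BRight r)); last first.
  apply: measurable_continuous_sub => //.
  by move=> x /=; rewrite !in_itv /=; lra.
rewrite -ge0_integral_setU //=.
- congr integral; apply/seteqP; split => x /=; rewrite !in_itv /=.
    by case: (leP x a) => ? /andP[-> ->]; [left|right].
  by case; lra.
- apply: measurable_continuous_sub => //; first exact: measurableU.
  by move=> x /=; rewrite !in_itv /=; case; lra.
- by move=> x _; rewrite lee_fin.
- by rewrite disj_set2E; apply/eqP/seteqP; split => x //=; rewrite !in_itv /=; lra.
Qed.

End Improper.
End Integrals.

(** * Complete elliptic integrals and Landen's transformation *)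

Section EllipticK.
Variable R : realType.
Local Notation mu := (@lebesgue_measure R).

Definition K_integrand (l t : R) : R :=
  (Num.sqrt ((1 - t ^+ 2) * (1 - l ^+ 2 * t ^+ 2)))^-1.

(** The integral before projection to the reals, where a divergent value would
    be sent to 0: inequalities are proved here and transferred once the value
    is known to be finite. *)
Definition elliptic_Ke (l : R) : \bar R := (\int[mu]_(t in `[0%R, 1%R]) (K_integrand l t)%:E)%E.

Lemma elliptic_KE l : elliptic_K l = fine (elliptic_Ke l).
Proof. by []. Qed.

Lemma K_integrand_ge0 l t : 0 <= K_integrand l t.
Proof. by rewrite invr_ge0 sqrtr_ge0. Qed.

Lemma continuous_sqrtV (p : R -> R) t : 0 < p t -> {for t, continuous p} ->
  {for t, continuous (fun x => (Num.sqrt (p x))^-1)}.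
Proof.
move=> pt cp; apply: cvgV; first by rewrite gt_eqF // sqrtr_gt0.
exact: (continuous_comp cp (@sqrt_continuous R _)).
Qed.

Section Modulus.
Variable l : R.
Hypothesis l01 : 0 <= l < 1.

Lemma sqr_lt1 t : -1 < t < 1 -> 0 < 1 - t ^+ 2 :> R.
Proof. by move=> t1; nra. Qed.

Lemma one_sub_modulus_gt0 t : -1 < t < 1 -> 0 < 1 - l ^+ 2 * t ^+ 2.
Proof.
move=> t1; have := sqr_lt1 t1; rewrite !subr_gt0; apply: le_lt_trans.
case/andP: l01 => l0 l1; rewrite ler_piMl ?sqr_ge0 // exprn_ile1 // ltW //.
Qed.

Lemma K_integrand_cont t : -1 < t < 1 -> {for t, continuous (K_integrand l)}.
Proof.
move=> t1; apply: continuous_sqrtV.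
  by rewrite mulr_gt0 ?sqr_lt1 ?one_sub_modulus_gt0.
apply: cvgM.
  by apply: cvgB; [exact: cvg_cst|exact: exprn_continuous].
apply: cvgB; [exact: cvg_cst|apply: cvgM; [exact: cvg_cst|exact: exprn_continuous]].
Qed.

Lemma elliptic_Ke_ge r : r < 1 ->
  (\int[mu]_(t in `[0%R, r]) (K_integrand l t)%:E <= elliptic_Ke l)%E.
Proof.
by apply: integral_sub_le; [exact: K_integrand_ge0|exact: K_integrand_cont].
Qed.

Lemma elliptic_Ke_le (C : \bar R) :
  (forall r, (0 < r < 1)%R -> \int[mu]_(t in `[0%R, r]) (K_integrand l t)%:E <= C)%E ->
  (elliptic_Ke l <= C)%E.
Proof.
by apply: integral_le_limit; [exact: K_integrand_ge0|exact: K_integrand_cont].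
Qed.

Lemma asin_integrand_cont (t : R) : -1 < t < 1 ->
  {for t, continuous (fun t : R => (Num.sqrt (1 - t ^+ 2))^-1)}.
Proof.
move=> t1; apply: continuous_sqrtV; first by rewrite sqr_lt1.
by apply: cvgB; [exact: cvg_cst|exact: exprn_continuous].
Qed.

Lemma asin0 : asin 0 = 0 :> R.
Proof. by rewrite -[X in asin X]sin0 sinK // in_itv /= oppr_le0 divr_ge0 ?pi_ge0. Qed.

(** Comparison with the derivative of the arcsine, integrated up to
    sin th for th just below pi / 2. *)
Lemma elliptic_Ke_lb : ((pi / 2)%:E <= elliptic_Ke l)%E.
Proof.
apply/lee_subgt0Pr => e e0; rewrite -EFinB.
have [e1|e1] := ltP e (pi / 2); last first.
  apply: le_trans (_ : 0 <= _)%E; first by rewrite lee_fin subr_le0.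
  by apply: integral_ge0 => t _; rewrite lee_fin K_integrand_ge0.
have p2 : 0 < pi / 2 :> R by rewrite divr_gt0 ?pi_gt0.
set th := pi / 2 - e.
have th0 : 0 < th by rewrite subr_gt0.
have th_itv : th \in `[(- (pi / 2)), pi / 2] by rewrite in_itv /= /th; lra.
have s1 : sin th < 1.
  by rewrite -(sin_pihalf R) ltr_sin ?in_itv /= ?lexx ?andbT; rewrite /th; lra.
have s0 : 0 < sin th.
  by rewrite sin_gt0_pi // th0 /= /th; have := @pi_gt0 R; lra.
apply: le_trans (elliptic_Ke_ge s1).
have -> : th%:E = (asin (sin th) - asin 0)%:E by rewrite asin0 subr0 sinK.
apply: (@derive_le_integral _ _ (@asin R) (fun t => (Num.sqrt (1 - t ^+ 2))^-1) _ _ s0) => t /andP[t0 ts].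
- by apply: K_integrand_cont; lra.
- by apply: is_derive1_asin; lra.
- by apply: asin_integrand_cont; lra.
- have t1 : -1 < t < 1 by lra.
  rewrite invr_ge0 sqrtr_ge0 /= lef_pV2 ?posrE ?sqrtr_gt0 ?mulr_gt0 ?sqr_lt1 ?one_sub_modulus_gt0 //.
  rewrite ler_sqrt ?(ltW (sqr_lt1 t1)) // ler_piMr ?(ltW (sqr_lt1 t1)) //.
  by rewrite gerBl mulr_ge0 ?sqr_ge0.
Qed.

Lemma elliptic_Ke_ub : (elliptic_Ke l <= (pi / 2 / Num.sqrt (1 - l ^+ 2))%:E)%E.
Proof.
have l2 : 0 < 1 - l ^+ 2 by apply: sqr_lt1; case/andP: l01; lra.
set c := (Num.sqrt (1 - l ^+ 2))^-1.
have c0 : 0 < c by rewrite invr_gt0 sqrtr_gt0.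
apply: elliptic_Ke_le => r /andP[r0 r1].
apply: le_trans (_ : (c * asin r - c * asin 0)%:E <= _)%E; last first.
  rewrite asin0 mulr0 subr0 lee_fin [leRHS]mulrC ler_pM2l // asin_lepi2 //; lra.
apply: (@integral_le_derive _ _ (fun t => c * asin t) (fun t => c * (Num.sqrt (1 - t ^+ 2))^-1) _ _ r0) => t /andP[t0 ts].
- by apply: K_integrand_cont; lra.
- have t1 : -1 < t < 1 by lra.
  have := is_derive1_asin t1 => d.
  by apply: is_deriveZ.
- by apply: cvgM; [exact: cvg_cst|apply: asin_integrand_cont; lra].
- have t1 : -1 < t < 1 by lra.
  rewrite K_integrand_ge0 /= /c -invfM -sqrtrM ?(ltW l2) //.
  rewrite lef_pV2 ?posrE ?sqrtr_gt0 ?mulr_gt0 ?l2 ?sqr_lt1 ?one_sub_modulus_gt0 //.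
  have h1 := sqr_lt1 t1; have h2 := one_sub_modulus_gt0 t1.
  rewrite ler_sqrt; last by rewrite mulr_ge0 ?ltW.
  rewrite mulrC ler_pM2l // lerD2l lerN2 ler_piMr ?sqr_ge0 //; lra.
Qed.

Lemma elliptic_Ke_fin : elliptic_Ke l \is a fin_num.
Proof.
rewrite ge0_fin_numE; first by rewrite (le_lt_trans elliptic_Ke_ub) // ltry.
by apply: le_trans elliptic_Ke_lb; rewrite lee_fin divr_ge0 ?pi_ge0.
Qed.

Lemma EFin_elliptic_K : (elliptic_K l)%:E = elliptic_Ke l.
Proof. by rewrite elliptic_KE fineK // elliptic_Ke_fin. Qed.

Lemma elliptic_K_ge : pi / 2 <= elliptic_K l.
Proof. by rewrite -lee_fin EFin_elliptic_K elliptic_Ke_lb. Qed.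

Lemma elliptic_K_le : elliptic_K l <= pi / 2 / Num.sqrt (1 - l ^+ 2).
Proof. by rewrite -lee_fin EFin_elliptic_K elliptic_Ke_ub. Qed.

Lemma elliptic_K_gt0 : 0 < elliptic_K l.
Proof. by apply: lt_le_trans elliptic_K_ge; rewrite divr_gt0 ?pi_gt0. Qed.

End Modulus.
End EllipticK.

Section Landen.
Variable R : realType.
Local Notation mu := (@lebesgue_measure R).

Section Transformation.
Variable k : R.
Hypothesis k01 : 0 < k < 1.

(** The Gauss substitution; it fixes 0 and 1 and is increasing between them. *)
Definition landen (s : R) : R := (1 + k) * s * (1 + k * s ^+ 2)^-1.
Definition landen' (s : R) : R := (1 + k) * (1 - k * s ^+ 2) * (1 + k * s ^+ 2) ^- 2.

Lemma landen_den (s : R) : 0 < 1 + k * s ^+ 2.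
Proof. by rewrite ltr_pwDl // mulr_ge0 ?sqr_ge0 // ltW //; case/andP: k01. Qed.

Lemma is_derive_landen (s : R) : is_derive s 1 landen (landen' s).
Proof.
have d0 := landen_den s; rewrite /landen.
have h : is_derive s 1 (fun s : R => (1 + k * s ^+ 2)^-1) (- (1 + k * s ^+ 2) ^- 2 * (2 * k * s)).
  have hd : is_derive s 1 (fun s : R => 1 + k * s ^+ 2) (2 * k * s).
    apply: is_derive_eq; rewrite /GRing.scale /=; ring.
  have := @is_deriveV R (fun s : R => 1 + k * s ^+ 2) s _ 1 (lt0r_neq0 d0) hd.
  by move=> h; apply: (is_derive_eq h); rewrite /GRing.scale /=.
apply: is_derive_eq; rewrite /GRing.scale /= /landen'; field.
by rewrite lt0r_neq0.
Qed.

Lemma landen'_cont (s : R) : {for s, continuous landen'}.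
Proof.
apply: cvgM.
  apply: cvgM; first exact: cvg_cst.
  by apply: cvgB; [exact: cvg_cst|apply: cvgM; [exact: cvg_cst|exact: exprn_continuous]].
apply: cvgV; first by rewrite expf_neq0 // lt0r_neq0 // landen_den.
have c : {for s, continuous (fun s : R => 1 + k * s ^+ 2)}.
  by apply: cvgD; [exact: cvg_cst|apply: cvgM; [exact: cvg_cst|exact: exprn_continuous]].
exact: (continuous_comp c (@exprn_continuous R 2 _)).
Qed.

Lemma landen_incr (r : R) : r < 1 -> {in `[0, r] &, {homo landen : x y / x < y}}.
Proof.
case/andP: k01 => k0 k1 r1 x y; rewrite !in_itv /= => /andP[x0 xr] /andP[y0 yr] xy.
rewrite /landen -subr_gt0.
have -> : (1 + k) * y / (1 + k * y ^+ 2) - (1 + k) * x / (1 + k * x ^+ 2) =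
   (1 + k) * (y - x) * (1 - k * (x * y)) / ((1 + k * y ^+ 2) * (1 + k * x ^+ 2)).
  by field; rewrite !lt0r_neq0 // landen_den.
rewrite divr_gt0 ?mulr_gt0 ?landen_den ?subr_gt0 //; first by lra.
have : x * y < 1 by nra.
by nra.
Qed.

Lemma landen0 : landen 0 = 0. Proof. by rewrite /landen mulr0 mul0r. Qed.

Lemma landen_lt1 (r : R) : 0 <= r < 1 -> r <= landen r < 1.
Proof.
case/andP: k01 => k0 k1 /andP[r0 r1].
rewrite /landen ler_pdivlMr ?landen_den // ltr_pdivrMr ?landen_den //.
have r2 : r ^+ 2 <= 1 by rewrite exprn_ile1 // ltW.
apply/andP; split.
  by rewrite mulrC ler_wpM2r // lerD2l ler_piMr // ltW.
rewrite -subr_gt0 (_ : _ - _ = (1 - r) * (1 - k * r)); last by ring.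
by rewrite mulr_gt0 //; nra.
Qed.

Let l := 2 * Num.sqrt k / (1 + k).

Lemma landen_modulus : l ^+ 2 = 4 * k / (1 + k) ^+ 2.
Proof.
case/andP: k01 => k0 k1.
by rewrite /l expr_div_n exprMn sqr_sqrtr ?ltW //; congr (_ * _ / _); ring.
Qed.

Lemma landen_modulus01 : 0 < l < 1.
Proof.
case/andP: k01 => k0 k1; have l0 : 0 < l.
  by rewrite /l divr_gt0 ?mulr_gt0 ?sqrtr_gt0 //; lra.
rewrite l0 /= -(@expr_lt1 _ 2) // ?ltW // landen_modulus.
rewrite ltr_pdivrMr ?exprn_gt0 //; last by lra.
rewrite mul1r -subr_gt0 (_ : _ - _ = (1 - k) ^+ 2); last by ring.
by rewrite exprn_gt0 // subr_gt0.
Qed.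

(** The two factors under the square root become
    (1 - s^2) (1 - k^2 s^2) / (1 + k s^2)^2 and (1 - k s^2)^2 / (1 + k s^2)^2,
    and the second one cancels against the derivative of the substitution. *)
Lemma K_integrand_landen (s : R) : 0 <= s < 1 ->
  K_integrand l (landen s) * landen' s = (1 + k) * K_integrand k s.
Proof.
case/andP: k01 => k0 k1 /andP[s0 s1]; have d0 := landen_den s.
have s2 : 0 <= s ^+ 2 <= 1 by rewrite sqr_ge0 exprn_ile1 // ltW.
have n0 : 0 < 1 - k * s ^+ 2 by nra.
rewrite /K_integrand landen_modulus.
have -> : (1 - landen s ^+ 2) * (1 - 4 * k / (1 + k) ^+ 2 * landen s ^+ 2) =
   ((1 - k * s ^+ 2) / (1 + k * s ^+ 2) ^+ 2) ^+ 2 * ((1 - s ^+ 2) * (1 - k ^+ 2 * s ^+ 2)).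
  by rewrite /landen; field; rewrite !lt0r_neq0 //; lra.
rewrite sqrtrM ?sqr_ge0 // sqrtr_sqr ger0_norm ?divr_ge0 ?exprn_ge0 ?ltW //.
have nz : Num.sqrt ((1 - s ^+ 2) * (1 - k ^+ 2 * s ^+ 2)) != 0.
  by rewrite lt0r_neq0 // sqrtr_gt0 mulr_gt0 ?sqr_lt1 ?one_sub_modulus_gt0 //; lra.
by rewrite /landen'; field; rewrite nz !lt0r_neq0.
Qed.

Lemma integral_landen (r : R) : 0 < r < 1 ->
  (\int[mu]_(t in `[0%R, landen r]) (K_integrand l t)%:E =
   (1 + k)%:E * \int[mu]_(s in `[0%R, r]) (K_integrand k s)%:E)%E.
Proof.
move=> /andP[r0 r1]; have /andP[l0 l1] := landen_modulus01.
case/andP: k01 => k0 k1.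
have D1 : derive1 landen = landen'.
  by apply/funext => s; rewrite derive1E; have [_ ->] := is_derive_landen s.
have cL s : {for s, continuous landen}.
  have [dF _] := is_derive_landen s.
  exact/differentiable_continuous/derivable1_diffP.
have r0' : 0 <= r by exact: ltW.
have lr : landen r < 1 by have /andP[] : r <= landen r < 1 by apply: landen_lt1; rewrite r1 ltW.
rewrite -{1}landen0 integration_by_substitution_increasing ?D1 //; last 6 first.
- exact: landen_incr.
- by move=> x _; exact: landen'_cont.
- by apply/cvg_ex; eexists; apply: cvg_at_right_filter; exact: landen'_cont.
- by apply/cvg_ex; eexists; apply: cvg_at_left_filter; exact: landen'_cont.
- split.
  + by move=> x _; have [] := is_derive_landen x.
  + by apply: cvg_at_right_filter; exact: cL.
  + by apply: cvg_at_left_filter; exact: cL.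
- apply: continuous_within_itv => x; rewrite landen0 => /andP[x0 xr].
  by apply: K_integrand_cont; lra.
rewrite -ge0_integralZl_EFin //=.
- apply: eq_integral => x; rewrite inE /= in_itv /= => /andP[x0 xr].
  by rewrite -EFinM; congr EFin; apply: K_integrand_landen; rewrite x0; lra.
- by move=> x _; rewrite lee_fin K_integrand_ge0.
- apply/measurable_EFinP; apply: measurable_continuous_itv => x /andP[x0 xr].
  by apply: K_integrand_cont; lra.
- by lra.
Qed.

(** The substitution is applied on [0, r] with r < 1, where the integrands are
    continuous; since r <= landen r < 1, both sides exhaust [0, 1] as r tends
    to 1. *)
Lemma elliptic_K_landen : elliptic_K l = (1 + k) * elliptic_K k.
Proof.
have /andP[l0 l1] := landen_modulus01; case/andP: (k01) => k0 k1.
apply/eqP; rewrite -eqe EFinM !EFin_elliptic_K; try lra.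
rewrite eq_le; apply/andP; split.
  apply: elliptic_Ke_le => [|r /andP[r0 r1]]; first by lra.
  have /andP[rl lr] : r <= landen r < 1 by apply: landen_lt1; lra.
  apply: (@le_trans _ _ (\int[mu]_(t in `[0%R, landen r]) (K_integrand l t)%:E)%E).
    apply: ge0_subset_integral => //.
    - apply/measurable_EFinP; apply: measurable_continuous_itv => x /andP[x0 xr].
      by apply: K_integrand_cont; lra.
    - by move=> x _; rewrite lee_fin K_integrand_ge0.
    - by move=> x /=; rewrite !in_itv /= => /andP[-> /=]; lra.
  rewrite integral_landen; last by lra.
  by rewrite lee_wpmul2l ?lee_fin ?elliptic_Ke_ge //; lra.
have lk0 : (0 < (1 + k))%R by lra.
rewrite -lee_pdivlMl //.
apply: elliptic_Ke_le => [|r /andP[r0 r1]]; first by lra.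
rewrite lee_pdivlMl // -integral_landen; last by lra.
have /andP[rl lr] : r <= landen r < 1 by apply: landen_lt1; lra.
by apply: elliptic_Ke_ge => //; lra.
Qed.

End Transformation.
End Landen.

(** * Logarithmic singularity and the ring function *)

Section LogAsymptotics.
Variable R : realType.
Local Notation mu := (@lebesgue_measure R).

Lemma elliptic_Ke_le_from (l a : R) (C : \bar R) : 0 <= l < 1 -> a < 1 ->
  (forall r, (a < r)%R -> (0 < r < 1)%R ->
    \int[mu]_(t in `[0%R, r]) (K_integrand l t)%:E <= C)%E ->
  (elliptic_Ke l <= C)%E.
Proof.
move=> l01 a1 h; apply: elliptic_Ke_le => // r /andP[r0 r1].
(* A point of (a, 1) to the right of r. *)
pose r' := (1 + Num.max r a) / 2.
have [m1 m2 m3] : [/\ r <= Num.max r a, a <= Num.max r a & Num.max r a < 1].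
  by rewrite !le_max !lexx orbT gt_max r1 a1.
have r'1 : r' < 1 by rewrite /r'; lra.
apply: le_trans (h r' _ _); last 2 first.
- by rewrite /r'; lra.
- by rewrite r'1 andbT /r'; lra.
apply: ge0_subset_integral => //.
- apply/measurable_EFinP; apply: measurable_continuous_itv => x /andP[x0 xr].
  by apply: K_integrand_cont => //; lra.
- by move=> x _; rewrite lee_fin K_integrand_ge0.
- by move=> x /=; rewrite !in_itv /= => /andP[-> /=]; rewrite /r'; lra.
Qed.

Variable k : R.
Hypothesis k01 : 0 < k < 1.

Definition compl_modulus := Num.sqrt (1 - k ^+ 2).
Local Notation l := compl_modulus.

Lemma compl_modulus_sqr : l ^+ 2 = 1 - k ^+ 2.
Proof. by case/andP: k01 => k0 k1; rewrite sqr_sqrtr // subr_ge0 exprn_ile1 // ltW. Qed.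

Lemma compl_modulus01 : 0 < l < 1.
Proof.
case/andP: k01 => k0 k1.
have k2 : 0 < 1 - k ^+ 2 by apply: sqr_lt1; lra.
rewrite sqrtr_gt0 k2 /= -(@expr_lt1 _ 2) ?sqrtr_ge0 // compl_modulus_sqr.
by rewrite ltrBlDr ltrDl exprn_gt0.
Qed.

(** The integrand is at least 1 / (2 (1 - t) + k^2), since both factors under
    the root are at most 2 (1 - t) + k^2. *)
Lemma elliptic_K_compl_ge : - ln k <= elliptic_K l.
Proof.
case/andP: (k01) => k0 k1; have /andP[l0 l1] := compl_modulus01.
have l01 : 0 <= l < 1 by lra.
have k2 : 0 < k ^+ 2 by rewrite exprn_gt0.
have k21 : k ^+ 2 < 1 by rewrite expr_lt1 // ltW.
rewrite -lee_fin EFin_elliptic_K //.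
(* Up to r the antiderivative F has already gained at least - ln k, so
   the remaining interval can be dropped. *)
set r := 1 - k ^+ 2 / 2.
have r0 : 0 < r by rewrite /r; lra.
have r1 : r < 1 by rewrite /r; lra.
apply: le_trans (elliptic_Ke_ge l01 r1).
pose p (t : R) : R := 2 * (1 - t) + k ^+ 2.
pose F (t : R) : R := - 2^-1 * ln (p t).
have p0 t : t <= r -> 0 < p t by rewrite /p /r; lra.
have dp (t : R) : is_derive t 1 p (- 2).
  by apply: is_derive_eq; rewrite /GRing.scale /=; ring.
have cp (t : R) : {for t, continuous p}.
  have [dF _] := dp t; exact/differentiable_continuous/derivable1_diffP.
apply: (@le_trans _ _ (F r - F 0)%:E).
  rewrite lee_fin /F /p subr0 mulr1.
  have -> : 2 * (1 - r) + k ^+ 2 = 2 * k ^+ 2 by rewrite /r; field.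
  rewrite lnM ?posrE // lnXn // [ln k *+ 2]mulr2n.
  have : ln 2 <= ln (2 + k ^+ 2) by rewrite ler_ln ?posrE; lra.
  lra.
apply: (@derive_le_integral _ _ F (fun t => (p t)^-1) _ _ r0) => t /andP[t0 tr].
- by apply: K_integrand_cont => //; lra.
- have pt := p0 _ tr.
  have := @is_derive1_comp R (@ln R) p t _ _ (is_derive1_ln pt) (dp t) => d.
  have := is_deriveZ (- 2^-1) d => d'; apply: (is_derive_eq d').
  by rewrite /GRing.scale /=; field; rewrite lt0r_neq0.
- by apply: cvgV; [rewrite lt0r_neq0 // p0|exact: cp].
- have t1 : -1 < t < 1 by lra.
  have pt := p0 _ tr; rewrite invr_ge0 (ltW pt) /= /K_integrand compl_modulus_sqr.
  have h1 := sqr_lt1 t1; have := one_sub_modulus_gt0 l01 t1.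
  rewrite compl_modulus_sqr => h2.
  rewrite lef_pV2 ?posrE ?sqrtr_gt0 ?mulr_gt0 //.
  rewrite -[leRHS]ger0_norm ?(ltW pt) // -sqrtr_sqr ler_sqrt ?sqr_ge0 //.
  have : (1 - t ^+ 2) <= p t by rewrite /p; nra.
  have : 1 - (1 - k ^+ 2) * t ^+ 2 <= p t by rewrite /p; nra.
  by move=> *; rewrite expr2 ler_pM // ltW.
Qed.

(** Up to 1 - k^2 the integrand is at most 1 / (1 - t^2), whose integral carries
    the logarithm with its exact coefficient; on the remaining interval it is at
    most 2 / (k sqrt (1 - t)), whose integral is bounded by 4. *)
Lemma elliptic_K_compl_le : k ^+ 2 <= 2^-1 -> elliptic_K l <= 5 - ln k.
Proof.
move=> k2h; case/andP: (k01) => k0 k1; have /andP[l0 l1] := compl_modulus01.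
have l01 : 0 <= l < 1 by lra.
have k2 : 0 < k ^+ 2 by rewrite exprn_gt0.
rewrite -lee_fin EFin_elliptic_K //.
pose a := 1 - k ^+ 2.
have a0 : 0 < a by rewrite /a; lra.
have a1 : a < 1 by rewrite /a; lra.
apply: (@elliptic_Ke_le_from _ a) => // r ar /andP[r0 r1].
rewrite (@integral_split _ (K_integrand l) _ _ a) ?a0 //; last 2 first.
- exact: K_integrand_ge0.
- by move=> x; exact: K_integrand_cont.
have -> : 5 - ln k = (1 - ln k) + 4 by ring.
rewrite EFinD; apply: leeD.
- pose F (t : R) : R := 2^-1 * (ln (1 + t) - ln (1 - t)).
  apply: (@le_trans _ _ (F a - F 0)%:E); last first.
    have -> : F 0 = 0 by rewrite /F subr0 addr0 subrr mulr0.
    have -> : F a = 2^-1 * (ln (1 + (1 - k ^+ 2)) - ln (k ^+ 2)).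
      by rewrite /F /a; congr (_ * (_ - ln _)); ring.
    rewrite lee_fin lnXn // [ln k *+ 2]mulr2n.
    have : ln (1 + (1 - k ^+ 2)) <= (1 - k ^+ 2) by apply: le_ln1Dx; lra.
    lra.
  apply: (@integral_le_derive _ _ F (fun t => (1 - t ^+ 2)^-1) _ _ a0) => t /andP[t0 ta].
  + by apply: K_integrand_cont => //; lra.
  + have t1 : 0 < 1 + t by lra.
    have t2 : 0 < 1 - t by lra.
    have d1 : is_derive t 1 (fun t : R => 1 + t) 1.
      by apply: is_derive_eq; rewrite /=; ring.
    have d2 : is_derive t 1 (fun t : R => 1 - t) (-1).
      by apply: is_derive_eq; rewrite /=; ring.
    have e1 := @is_derive1_comp R (@ln R) _ t _ _ (is_derive1_ln t1) d1.
    have e2 := @is_derive1_comp R (@ln R) _ t _ _ (is_derive1_ln t2) d2.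
    have := is_deriveZ (2^-1) (is_deriveB e1 e2) => d'; apply: (is_derive_eq d').
    rewrite /GRing.scale /=; field; rewrite !lt0r_neq0 //.
    by apply: sqr_lt1; lra.
  + apply: cvgV; first by rewrite lt0r_neq0 // sqr_lt1 //; lra.
    by apply: cvgB; [exact: cvg_cst|exact: exprn_continuous].
  + have t1 : -1 < t < 1 by lra.
    have h1 := sqr_lt1 t1; have := one_sub_modulus_gt0 l01 t1.
    rewrite K_integrand_ge0 /= /K_integrand compl_modulus_sqr => h2.
    rewrite lef_pV2 ?posrE ?sqrtr_gt0 ?mulr_gt0 //.
    rewrite -[leLHS]ger0_norm ?(ltW h1) // -sqrtr_sqr ler_sqrt; last by rewrite mulr_ge0 // ltW.
    by rewrite expr2 ler_pM2l // lerD2l lerN2 mulrBl mul1r gerBl mulr_ge0 ?sqr_ge0.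
- pose F (t : R) : R := - (4 / k) * Num.sqrt (1 - t).
  apply: (@le_trans _ _ (F r - F a)%:E); last first.
    have -> : F a = - (4 / k) * k.
      rewrite /F /a (_ : 1 - (1 - k ^+ 2) = k ^+ 2); last by ring.
      by rewrite sqrtr_sqr ger0_norm // ltW.
    rewrite lee_fin /F.
    have : 0 <= 4 / k * Num.sqrt (1 - r) by rewrite mulr_ge0 ?sqrtr_ge0 // divr_ge0 ?(ltW k0).
    have : 4 / k * k = 4 by rewrite divfK // lt0r_neq0.
    lra.
  apply: (@integral_le_derive _ _ F (fun t => 2 / k * (Num.sqrt (1 - t))^-1) _ _ ar) => t /andP[ta tr].
  + by apply: K_integrand_cont => //; lra.
  + have t2 : 0 < 1 - t by lra.
    have d2 : is_derive t 1 (fun t : R => 1 - t) (-1).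
      by apply: is_derive_eq; rewrite /=; ring.
    have e2 := @is_derive1_comp R (@Num.sqrt R) _ t _ _ (is_derive1_sqrt t2) d2.
    have := is_deriveZ (- (4 / k)) e2 => d'; apply: (is_derive_eq d').
    rewrite /GRing.scale /=; field; rewrite !lt0r_neq0 //.
    by rewrite sqrtr_gt0.
  + have c : {for t, continuous (fun x : R => (Num.sqrt (1 - x))^-1)}.
      apply: (@continuous_sqrtV R (fun x => 1 - x)); first by lra.
      by apply: cvgB; [exact: cvg_cst|exact: cvg_id].
    by apply: cvgM; [exact: cvg_cst|exact: c].
  + have t1 : -1 < t < 1 by lra.
    have h1 := sqr_lt1 t1; have := one_sub_modulus_gt0 l01 t1.
    rewrite K_integrand_ge0 /= /K_integrand compl_modulus_sqr => h2.
    have t2 : 0 < 1 - t by lra.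
    have s0 : 0 < Num.sqrt (1 - t) by rewrite sqrtr_gt0.
    have -> : 2 / k * (Num.sqrt (1 - t))^-1 = (k / 2 * Num.sqrt (1 - t))^-1.
      by field; rewrite !lt0r_neq0.
    have p0 : 0 < k / 2 * Num.sqrt (1 - t) by rewrite mulr_gt0 // divr_gt0.
    rewrite lef_pV2 ?posrE ?sqrtr_gt0 ?mulr_gt0 //.
    rewrite -[leLHS]ger0_norm ?(ltW p0) // -sqrtr_sqr ler_sqrt; last by rewrite mulr_ge0 // ltW.
    rewrite exprMn sqr_sqrtr ?(ltW t2) // mulrC ler_pM // ?sqr_ge0 ?(ltW t2) //.
      by nra.
    have t4 : 4^-1 <= t ^+ 2.
      have : 2^-1 <= t by move: ta; rewrite /a; lra.
      by nra.
    have : 0 <= k ^+ 2 * (t ^+ 2 - 4^-1) by rewrite mulr_ge0 ?subr_ge0 // ltW.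
    rewrite expr_div_n; nra.
Qed.

End LogAsymptotics.

Section GrotzschMu.
Variable R : realType.
Local Notation gmu := (@grotzsch_mu R).
Implicit Type k : R.

Lemma grotzsch_mu_gt0 k : 0 < k < 1 -> 0 < gmu k.
Proof.
move=> k01; have := compl_modulus01 k01 => l01.
rewrite /grotzsch_mu mulr_gt0 ?divr_gt0 ?pi_gt0 // elliptic_K_gt0 //; first by move: l01; rewrite /compl_modulus; lra.
by lra.
Qed.

Lemma landen_compl k : 0 < k < 1 ->
  Num.sqrt (1 - (2 * Num.sqrt k / (1 + k)) ^+ 2) = (1 - k) / (1 + k).
Proof.
move=> k01; rewrite landen_modulus //; case/andP: k01 => k0 k1.
have -> : 1 - 4 * k / (1 + k) ^+ 2 = ((1 - k) / (1 + k)) ^+ 2 by field; lra.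
by rewrite sqrtr_sqr ger0_norm // divr_ge0 //; lra.
Qed.

Lemma dual_modulus01 k : 0 < k < 1 -> 0 < (1 - k) / (1 + k) < 1.
Proof.
move=> /andP[k0 k1]; rewrite divr_gt0 ?ltr_pdivrMr; lra.
Qed.

Lemma dual_modulus_landen k : 0 < k < 1 ->
  2 * Num.sqrt ((1 - k) / (1 + k)) / (1 + (1 - k) / (1 + k)) = Num.sqrt (1 - k ^+ 2).
Proof.
move=> k01; have /andP[d0 d1] := dual_modulus01 k01; case/andP: k01 => k0 k1.
apply/eqP; rewrite -(@eqrXn2 _ 2) ?sqrtr_ge0 //; last first.
  by rewrite divr_ge0 ?mulr_ge0 ?sqrtr_ge0 //; lra.
rewrite expr_div_n exprMn sqr_sqrtr ?(ltW d0) // sqr_sqrtr; last first.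
  by rewrite subr_ge0 exprn_ile1 // ltW.
by apply/eqP; field; lra.
Qed.

(** Landen's transformation with (1 - k) / (1 + k) in the role of k, which it
    sends to the complementary modulus of k. *)
Lemma elliptic_K_dual k : 0 < k < 1 ->
  elliptic_K ((1 - k) / (1 + k)) = (1 + k) / 2 * elliptic_K (Num.sqrt (1 - k ^+ 2)).
Proof.
move=> k01; have d01 := dual_modulus01 k01.
have := elliptic_K_landen d01; rewrite dual_modulus_landen // => ->.
by case/andP: k01 => k0 k1; field; lra.
Qed.

(** Landen's transformation multiplies K(k) by 1 + k and the complementary
    integral by (1 + k) / 2. *)
Lemma grotzsch_mu_landen k : 0 < k < 1 ->
  gmu (2 * Num.sqrt k / (1 + k)) = gmu k / 2.
Proof.
move=> k01; rewrite /grotzsch_mu landen_compl // elliptic_K_landen // elliptic_K_dual //.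
have k0 : elliptic_K k != 0 by rewrite lt0r_neq0 // elliptic_K_gt0 //; lra.
by case/andP: k01 => ? ?; field; rewrite k0 /=; lra.
Qed.

Lemma grotzsch_mu_dual k : 0 < k < 1 ->
  gmu ((1 - k) / (1 + k)) = pi ^+ 2 / (2 * gmu k).
Proof.
move=> k01; rewrite /grotzsch_mu.
have -> : Num.sqrt (1 - ((1 - k) / (1 + k)) ^+ 2) = 2 * Num.sqrt k / (1 + k).
  case/andP: k01 => k0 k1.
  have -> : 1 - ((1 - k) / (1 + k)) ^+ 2 = (2 / (1 + k)) ^+ 2 * k by field; lra.
  rewrite sqrtrM ?sqr_ge0 // sqrtr_sqr ger0_norm; last by rewrite divr_ge0 //; lra.
  by ring.
rewrite elliptic_K_landen // elliptic_K_dual //.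
have k0 : elliptic_K k != 0 by rewrite lt0r_neq0 // elliptic_K_gt0 //; lra.
have /andP[c0 c1] := compl_modulus01 k01; rewrite /compl_modulus in c0 c1.
have l0 : elliptic_K (Num.sqrt (1 - k ^+ 2)) != 0.
  by rewrite lt0r_neq0 // elliptic_K_gt0 //; lra.
have pi0 : pi != 0 :> R by rewrite lt0r_neq0 // pi_gt0.
move: (@pi R) pi0 => p p0; case/andP: k01 => ? ?; field; rewrite k0 l0 p0 /=; lra.
Qed.

Lemma grotzsch_mu_ge k : 0 < k < 1 -> Num.sqrt (1 - k ^+ 2) * (- ln k) <= gmu k.
Proof.
move=> k01; have := elliptic_K_compl_ge k01; rewrite /compl_modulus => h.
have /andP[c0 c1] := compl_modulus01 k01; rewrite /compl_modulus in c0 c1.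
have k01' : 0 <= k < 1 by lra.
have Kk0 := elliptic_K_gt0 k01'.
have Kk := elliptic_K_le k01'.
have p2 : 0 < pi / 2 :> R by rewrite divr_gt0 ?pi_gt0.
have ln0 : 0 <= - ln k by rewrite oppr_ge0 ln_le0 // ltW //; case/andP: k01.
rewrite /grotzsch_mu mulrA ler_pdivlMr //.
apply: le_trans (_ : pi / 2 * (- ln k) <= _); last by rewrite ler_pM2l.
rewrite mulrAC ler_wpM2r //.
by move: Kk; rewrite ler_pdivlMr // mulrC.
Qed.

Lemma grotzsch_mu_le k : 0 < k < 1 -> k ^+ 2 <= 2^-1 -> gmu k <= 5 - ln k.
Proof.
move=> k01 k2; have := elliptic_K_compl_le k01 k2; rewrite /compl_modulus => h.
have /andP[c0 c1] := compl_modulus01 k01; rewrite /compl_modulus in c0 c1.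
have k01' : 0 <= k < 1 by lra.
have Kk0 := elliptic_K_gt0 k01'.
have Kk := elliptic_K_ge k01'.
apply: le_trans h; rewrite /grotzsch_mu mulrA ler_pdivrMr // mulrC.
by rewrite ler_wpM2l // ltW // elliptic_K_gt0 //; lra.
Qed.

End GrotzschMu.

(** * Sums over the integers *)

Section IntegerSums.
Variable R : realType.
Implicit Types (u v f h : int -> R) (C : R).

(** The terms of index n and -(n+1): the two constructors of int split a sum over
    the integers into two sums over nat. *)
Definition zblock u (n : nat) : R := u (Posz n) + u (Negz n).
Definition zpart u (N : nat) : R := \sum_(0 <= n < N) zblock u n.
Definition zesum u : \bar R := (\esum_(n in [set: int]) (u n)%:E)%E.
Definition zsum u : R := fine (zesum u).
(** A domination with a fixed ratio that serves all theta series at once,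
    because a Gaussian decays faster than any geometric sequence. *)
Definition geom_dominated C u := forall n, 0 <= u n <= C * 2^-1 ^+ `|n|%N.

Lemma zpart_recr u N : zpart u N.+1 = zpart u N + zblock u N.
Proof. by rewrite /zpart big_nat_recr. Qed.

Lemma zesumE u : (forall n, 0 <= u n) ->
  (zesum u = \sum_(n <oo) (zblock u n)%:E)%E.
Proof.
move=> u0; rewrite /zesum (@esumID _ _ (range Posz)) //; last by move=> n _; rewrite lee_fin.
rewrite !setTI.
have -> : ~` range Posz = range Negz.
  apply/seteqP; split => [[n|n] /= h|x [n _ <-] [m _]] //.
    by case: h; exists n.
  by exists n.
have bij (e : nat -> int) : injective e -> set_bij [set: nat] (range e) e.
  by move=> inj; split=> [x _|x y _ _ /inj|x [y _ <-]] //; exists y.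
have b1 : injective Posz by move=> x y [].
have b2 : injective Negz by move=> x y [].
rewrite (@reindex_esum _ _ _ _ _ _ _ (bij _ b1)) (@reindex_esum _ _ _ _ _ _ _ (bij _ b2)).
rewrite -!nneseries_esumT; try by move=> n; rewrite lee_fin.
rewrite -nneseriesD; last 2 first.
- by move=> n _ _; rewrite lee_fin.
- by move=> n _ _; rewrite lee_fin.
by apply: eq_eseriesr => n _; rewrite EFinD.
Qed.

Section Dominated.
Variables (C : R) (u : int -> R).
Hypothesis du : geom_dominated C u.

Lemma geom_dominated_ge0 : 0 <= C.
Proof. by have /andP[] := du 0; rewrite expr0 mulr1; exact: le_trans. Qed.

Lemma zblock_ge0 n : 0 <= zblock u n.
Proof.
have /andP[h1 _] := du (Posz n); have /andP[h2 _] := du (Negz n).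
exact: addr_ge0.
Qed.

Lemma zblock_le n : zblock u n <= 2 * C * 2^-1 ^+ n.
Proof.
have /andP[_ h1] := du (Posz n); have /andP[_ h2] := du (Negz n).
apply: le_trans (lerD h1 h2) _; rewrite /= exprS.
have h : 0 <= C * 2^-1 ^+ n by rewrite mulr_ge0 ?geom_dominated_ge0 ?exprn_ge0.
by rewrite mulrCA -mulrA; move: (C * _) h => x; lra.
Qed.

Lemma zpart_tail N k : zpart u (N + k) - zpart u N <= 4 * C * 2^-1 ^+ N * (1 - 2^-1 ^+ k).
Proof.
elim: k => [|k IH]; first by rewrite addn0 expr0 !subrr mulr0.
rewrite addnS zpart_recr; have := zblock_le (N + k).
rewrite exprD exprS => h.
rewrite addrAC; apply: le_trans (lerD IH h) _.
by rewrite le_eqVlt; apply/orP; left; apply/eqP; field.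
Qed.

Lemma zesum_bounds N : ((zpart u N)%:E <= zesum u <= (zpart u N + 4 * C * 2^-1 ^+ N)%:E)%E.
Proof.
have u0 n : 0 <= u n by have /andP[] := du n.
have b0 n : (0 <= (zblock u n)%:E)%E by rewrite lee_fin zblock_ge0.
rewrite zesumE //; apply/andP; split.
  by rewrite /zpart -sumEFin; apply: nneseries_lim_ge.
apply: lime_le; first by apply: is_cvg_nneseries => n _ _; exact: b0.
near=> M; rewrite sumEFin lee_fin -/(zpart u M).
have NM : (N <= M)%N by near: M; exact: nbhs_infty_ge.
have := zpart_tail N (M - N); rewrite subnKC // => h.
rewrite -lerBlDl; apply: le_trans h _; rewrite ler_piMr //.
by rewrite !mulr_ge0 ?exprn_ge0 ?geom_dominated_ge0.
Unshelve. all: by end_near. Qed.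

Lemma zesum_fin : zesum u \is a fin_num.
Proof.
have /andP[h1 h2] := zesum_bounds 0.
rewrite ge0_fin_numE; first by rewrite (le_lt_trans h2) // ltry.
by apply: le_trans h1; rewrite /zpart big_nil.
Qed.

Lemma zsumE : (zsum u)%:E = zesum u.
Proof. by rewrite fineK // zesum_fin. Qed.

Lemma zsum_bounds N : zpart u N <= zsum u <= zpart u N + 4 * C * 2^-1 ^+ N.
Proof. by have := zesum_bounds N; rewrite -zsumE !lee_fin. Qed.

Lemma zsum_ge0 : 0 <= zsum u.
Proof. by have /andP[] := zsum_bounds 0; rewrite /zpart big_nil. Qed.

Lemma cvg_half_pow (a : R) : (fun n => a * 2^-1 ^+ n) @ \oo --> (0 : R).
Proof.
rewrite -(mulr0 a); apply: cvgM; first exact: cvg_cst.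
by apply: cvg_expr; rewrite ger0_norm ?invf_lt1 // ltr1n.
Qed.

Lemma cvg_zpart : zpart u @ \oo --> zsum u.
Proof.
apply: (@squeeze_cvgr _ _ _ _ (fun N => zsum u - 4 * C * 2^-1 ^+ N) (fun _ => zsum u)).
- by near=> N; have /andP[h1 h2] := zsum_bounds N; rewrite h1 andbT lerBlDr.
- rewrite -[X in _ --> X]subr0; apply: cvgB; first exact: cvg_cst.
  exact: cvg_half_pow.
- exact: cvg_cst.
Unshelve. all: by end_near. Qed.

Lemma zsum_ge_term n : u n <= zsum u.
Proof.
rewrite -lee_fin zsumE /zesum; apply: esum_ge; exists [set n] => //.
by rewrite fsbig_set1.
Qed.

End Dominated.

Lemma geom_dominatedZ C u (c : R) : 0 <= c -> geom_dominated C u ->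
  geom_dominated (c * C) (fun n => c * u n).
Proof. by move=> c0 du n; have /andP[h1 h2] := du n; rewrite mulr_ge0 //= -mulrA ler_wpM2l. Qed.

Lemma ge0_esumZl (T : choiceType) (S : set T) (a : T -> R) (c : R) : 0 <= c ->
  (forall i, 0 <= a i) ->
  (\esum_(i in S) (c * a i)%:E = c%:E * \esum_(i in S) (a i)%:E)%E.
Proof.
have le (d : R) (b : T -> R) : 0 <= d -> (forall i, 0 <= b i) ->
  (\esum_(i in S) (d * b i)%:E <= d%:E * \esum_(i in S) (b i)%:E)%E.
  move=> d0 b0; apply: ge_ereal_sup => _ [A [fA AS] <-].
  under eq_fsbigr do rewrite EFinM.
  rewrite -ge0_mule_fsumr; last by move=> i; rewrite lee_fin.
  apply: lee_wpmul2l; first by rewrite lee_fin.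
  by apply: esum_ge; exists A.
move=> c0 a0; have [->|cn0] := eqVneq c 0.
  by rewrite mul0e; apply: esum1 => i _; rewrite mul0r.
have cp : 0 < c by rewrite lt_neqAle eq_sym cn0.
apply/eqP; rewrite eq_le le //= -lee_pdivlMl //.
have -> : (\esum_(i in S) (a i)%:E = \esum_(i in S) (c^-1 * (c * a i))%:E)%E.
  by apply: eq_esum => i _; rewrite mulKf.
apply: le; first by rewrite invr_ge0.
by move=> i; rewrite mulr_ge0.
Qed.

Lemma zsum_eq u v : u =1 v -> zsum u = zsum v.
Proof. by move=> /funext ->. Qed.

Lemma zsumZ C u (c : R) : 0 <= c -> geom_dominated C u ->
  zsum (fun n => c * u n) = c * zsum u.
Proof.
move=> c0 du; rewrite /zsum /zesum ge0_esumZl //; last by move=> n; have /andP[] := du n.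
by rewrite fineM ?(zesum_fin du).
Qed.

Lemma zsum_reindex u (s s' : int -> int) : cancel s s' -> cancel s' s ->
  zsum (u \o s) = zsum u.
Proof.
move=> K1 K2; rewrite /zsum /zesum; congr fine; apply/esym.
apply: (@reindex_esum _ _ _ [set: int] [set: int] s (fun n => (u n)%:E)).
split=> // [x y _ _|x _]; first exact: (can_inj K1).
by exists (s' x).
Qed.

(** The product as a double sum, which can then be rearranged. *)
Lemma zsumM C C' u v : geom_dominated C u -> geom_dominated C' v ->
  (zsum u * zsum v)%:E =
  (\esum_(k in [set: int * int]) (u k.1 * v k.2)%:E)%E.
Proof.
move=> du dv; have u0 n : 0 <= u n by have /andP[] := du n.
have v0 n : 0 <= v n by have /andP[] := dv n.
have -> : [set: int * int] = [set: int] `*`` (fun=> [set: int]).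
  by apply/seteqP; split.
rewrite -(@esum_esum _ _ _ setT (fun=> setT) (fun i j => (u i * v j)%:E)); last first.
  by move=> i j _ _; rewrite lee_fin mulr_ge0.
rewrite mulrC -(zsumZ (zsum_ge0 dv) du) (zsumE (geom_dominatedZ (zsum_ge0 dv) du)).
apply: eq_esum => i _; rewrite ge0_esumZl //.
by rewrite mulrC EFinM (zsumE dv).
Qed.

End IntegerSums.

(** * Theta series and their addition formulas *)

Section Theta.
Variable R : realType.
Implicit Types (g w v : R) (s n : int).

Definition theta_term g w s : R := g ^ (s * s) * w ^ s.
(** At w = 1 this is theta_3 of nome g^4. *)
Definition thetaE g w : R := zsum (fun n => theta_term g w (2 * n)).
(** At w = 1 this is theta_2 of nome g^4. *)
Definition thetaO g w : R := zsum (fun n => theta_term g w (2 * n + 1)).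

Lemma theta_term_pos g w s : 0 < g -> 0 < w -> 0 < theta_term g w s.
Proof. by move=> g0 w0; rewrite mulr_gt0 ?exprz_gt0. Qed.

Lemma sqrz_abs (s : int) : s * s = (`|s| * `|s|)%N :> int.
Proof. by case: s => n //=; rewrite NegzE mulrNN. Qed.

Lemma theta_term_nat g w s : theta_term g w s = g ^+ (`|s| * `|s|)%N * w ^ s.
Proof. by rewrite /theta_term sqrz_abs. Qed.

Lemma exprz_le_absz (W w : R) s : 0 < w -> W^-1 <= w <= W -> w ^ s <= W ^+ `|s|%N.
Proof.
move=> w0 /andP[Ww wW]; have W0 : 0 < W by exact: lt_le_trans wW.
case: s => n; first by rewrite -exprnP lerXn2r // nnegrE ltW.
rewrite NegzE -exprz_inv -exprnP abszN lerXn2r ?nnegrE ?invr_ge0 ?(ltW w0) ?(ltW W0) //.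
by rewrite -[W in _ <= W]invrK lef_pV2 // posrE invr_gt0.
Qed.

(** Write the left-hand side as (rho^n W)^n; from some index n0 on, rho^n W is at
    most 1/2. *)
Lemma gauss_decay (rho W : R) : 0 <= rho < 1 -> 1 <= W ->
  exists2 C, 0 <= C & forall n : nat, rho ^+ (n * n) * W ^+ n <= C * 2^-1 ^+ n.
Proof.
move=> /andP[r0 r1] W1; have W0 : 0 < W by exact: lt_le_trans W1.
have h2W : 0 < 2 * W by rewrite mulr_gt0.
have [n0 hn0] : exists n0 : nat, rho ^+ n0 * (2 * W) <= 1.
  have : rho ^+ n @[n --> \oo] --> (0 : R) by apply: cvg_expr; rewrite ger0_norm.
  move/cvgrPdist_le => /(_ (2 * W)^-1); rewrite invr_gt0 => /(_ h2W) [n0 _ /(_ n0 (leqnn _))].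
  by rewrite sub0r normrN ger0_norm ?exprn_ge0 // => h; exists n0; rewrite -ler_pdivlMr // div1r.
have C0 : 0 <= (2 * W) ^+ n0 by rewrite exprn_ge0 // ltW.
exists ((2 * W) ^+ n0) => // n.
rewrite -ler_pdivrMr ?exprn_gt0 ?invr_gt0 // exprVn invrK -mulrA -exprMn mulrC [W * 2]mulrC.
rewrite mulrC exprM -exprMn.
have x0 : 0 <= rho ^+ n * (2 * W) by rewrite mulr_ge0 ?exprn_ge0 // ltW.
have W2 : 1 <= 2 * W by lra.
have [le_n|lt_n] := leqP n0 n.
  apply: le_trans (_ : 1 <= _); last by rewrite exprn_ege1.
  rewrite exprn_ile1 //; apply: le_trans hn0.
  by rewrite ler_wpM2r ?(ltW h2W) // ler_wiXn2l // ltW.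
apply: le_trans (_ : (2 * W) ^+ n <= _); last by rewrite ler_weXn2l // ltnW.
by rewrite lerXn2r ?nnegrE ?(ltW h2W) // ler_piMl ?(ltW h2W) // exprn_ile1 // ltW.
Qed.

(** The constant is uniform in g and w, as needed for continuity and for the
    behaviour as g tends to 0. *)
Lemma theta_dominated (rho W : R) : 0 <= rho < 1 -> 1 <= W ->
  exists C, forall g w, 0 < g <= rho -> W^-1 <= w <= W ->
    [/\ geom_dominated C (theta_term g w),
        geom_dominated C (fun n => theta_term g w (2 * n)) &
        geom_dominated C (fun n => theta_term g w (2 * n + 1))].
Proof.
move=> r01 W1; have [C C0 hC] := gauss_decay r01 W1; exists C => g w /andP[g0 gr] wW.
have w0 : 0 < w.
  by case/andP: wW => h _; apply: lt_le_trans h; rewrite invr_gt0; exact: lt_le_trans W1.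
have main s : 0 <= theta_term g w s <= C * 2^-1 ^+ `|s|%N.
  rewrite ltW ?theta_term_pos //=; apply: le_trans (hC _).
  rewrite theta_term_nat ler_pM ?exprn_ge0 ?(ltW g0) ?(ltW (exprz_gt0 _ w0)) //.
    by rewrite lerXn2r ?nnegrE ?(ltW g0) //; case/andP: r01.
  exact: exprz_le_absz.
have sub s n : (`|n| <= `|s|)%N -> 0 <= theta_term g w s <= C * 2^-1 ^+ `|n|%N.
  move=> ns; have /andP[-> h] := main s; apply: le_trans h _.
  by rewrite ler_wpM2l // ler_wiXn2l ?invr_ge0 // invf_le1 ?ler1n.
by split=> // n; apply: sub; lia.
Qed.

Lemma theta_dominated1 g w : 0 < g < 1 -> 0 < w ->
  exists C, [/\ geom_dominated C (theta_term g w),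
        geom_dominated C (fun n => theta_term g w (2 * n)) &
        geom_dominated C (fun n => theta_term g w (2 * n + 1))].
Proof.
move=> /andP[g0 g1] w0.
have [W W1 wW] : exists2 W, 1 <= W & W^-1 <= w <= W.
  have v0 : 0 < w^-1 by rewrite invr_gt0.
  exists (1 + w + w^-1); first by lra.
  apply/andP; split; last by lra.
  by rewrite invf_ple ?posrE ?addr_gt0 //; lra.
have g01 : 0 <= g < 1 by rewrite (ltW g0).
have [C hC] := theta_dominated g01 W1.
by exists C; apply: hC; rewrite // g0 lexx.
Qed.

Lemma thetaE_gt0 g w : 0 < g < 1 -> 0 < w -> 0 < thetaE g w.
Proof.
move=> g01 w0; have [C [_ d _]] := theta_dominated1 g01 w0.
by apply: lt_le_trans (zsum_ge_term d 0); rewrite theta_term_pos //; case/andP: g01.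
Qed.

Lemma thetaO_gt0 g w : 0 < g < 1 -> 0 < w -> 0 < thetaO g w.
Proof.
move=> g01 w0; have [C [_ _ d]] := theta_dominated1 g01 w0.
by apply: lt_le_trans (zsum_ge_term d 0); rewrite theta_term_pos //; case/andP: g01.
Qed.

(** The identity 2 (m^2 + n^2) = (m + n)^2 + (m - n)^2 behind the addition
    formulas. *)
Lemma theta_termM g w v m n : 0 < g -> 0 < w -> 0 < v ->
  theta_term (g ^+ 2) (w * v) m * theta_term (g ^+ 2) (w / v) n =
  theta_term g w (m + n) * theta_term g v (m - n).
Proof.
move=> g0 w0 v0; rewrite /theta_term.
have [gn wn vn] : [/\ g != 0, w != 0 & v != 0] by rewrite !lt0r_neq0.
have e2 (k : int) : (g ^+ 2) ^ k = g ^ (2 * k) by rewrite exprnP exprz_exp.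
rewrite !e2 !exprzMl ?unitfE ?invr_eq0 // exprz_inv.
rewrite mulrACA [RHS]mulrACA -!expfzDr // [X in _ * X = _]mulrACA -!expfzDr //.
by congr (g ^ _ * _); ring.
Qed.

Definition int_pairs_even : set (int * int) := [set p | exists a, p.1 + p.2 = 2 * a].

(** The sum and the difference of two integers have the same parity, and every
    such pair arises once. *)
Lemma bij_pairs_even (i j : int) (f : int * int -> int * int) :
  (forall a b, f (a, b) = (a + b + i, a - b + j)) -> i + j = 0 ->
  set_bij [set: int * int] int_pairs_even f.
Proof.
move=> fE ij; split=> [[a b] _|[a b] [c d] _ _|[c d] /= [a e]].
- by rewrite fE; exists a => /=; lia.
- by rewrite !fE => -[h1 h2]; congr pair; lia.
- by move: e => /= e; exists (a, c - a - i) => //; rewrite fE; congr pair; lia.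
Qed.

Lemma bij_pairs_odd (i j : int) (f : int * int -> int * int) :
  (forall a b, f (a, b) = (a + b + i, a - b + j)) -> (i + j = 1 \/ i + j = -1) ->
  set_bij [set: int * int] (~` int_pairs_even) f.
Proof.
move=> fE ij; split=> [[a b] _|[a b] [c d] _ _|[c d] /= ncd].
- by rewrite fE => -[c /=]; lia.
- by rewrite !fE => -[h1 h2]; congr pair; lia.
- have [a e] : exists a, c + d = 2 * a + 1.
    have := divz_eq (c + d) 2; have := modz_ge0 (c + d) (isT : 2 != 0 :> int).
    have := ltz_pmod (c + d) (isT : 0 < 2 :> int).
    set q := divz _ _; set r := modz _ _ => r2 r0 e.
    have [r0'|r1] : r = 0 \/ r = 1 by lia.
    - by case: ncd; exists q => /=; lia.
    - by exists q; lia.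
  case: ij => ij.
  + by exists (a, c - a - i) => //; rewrite fE; congr pair; lia.
  + by exists (a + 1, c - (a + 1) - i) => //; rewrite fE; congr pair; lia.
Qed.

Section AdditionFormulas.
Variables (g w v : R).
Hypotheses (g01 : 0 < g < 1) (w0 : 0 < w) (v0 : 0 < v).

Let g2 : 0 < g ^+ 2 < 1.
Proof. by case/andP: g01 => g0 g1; rewrite exprn_gt0 //= expr_lt1 // ltW. Qed.
Let wv : 0 < w * v. Proof. exact: mulr_gt0. Qed.
Let wVv : 0 < w / v. Proof. exact: divr_gt0. Qed.
Let g0 : 0 < g. Proof. by case/andP: g01. Qed.

Let termM_ge0 (a b : int) : (0%:E <= (theta_term g w a * theta_term g v b)%:E)%E.
Proof. by rewrite lee_fin mulr_ge0 // ltW // theta_term_pos. Qed.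

(** Both products on the left run over index pairs of equal parity; their sums and
    differences run over all pairs of even integers. *)
Lemma thetaEM :
  thetaE (g ^+ 2) (w * v) * thetaE (g ^+ 2) (w / v) +
  thetaO (g ^+ 2) (w * v) * thetaO (g ^+ 2) (w / v) = thetaE g w * thetaE g v.
Proof.
have [C1 [_ d1 d1']] := theta_dominated1 g2 wv.
have [C2 [_ d2 d2']] := theta_dominated1 g2 wVv.
have [C3 [_ d3 _]] := theta_dominated1 g01 w0.
have [C4 [_ d4 _]] := theta_dominated1 g01 v0.
apply/eqP; rewrite -eqe EFinD /thetaE /thetaO (zsumM d1 d2) (zsumM d1' d2') (zsumM d3 d4).
apply/eqP; rewrite [RHS](@esumID _ _ int_pairs_even) //.
rewrite !setTI; congr (_ + _)%E.
- have bf := @bij_pairs_even 0 0 (fun p => (p.1 + p.2 + 0, p.1 - p.2 + 0))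
    (fun _ _ => erefl) (addr0 0).
  rewrite [RHS](@reindex_esum _ _ _ _ _ _ _ bf).
  apply: eq_esum => -[a b] _ /=; rewrite theta_termM //.
  by congr (EFin (theta_term _ _ _ * theta_term _ _ _)); ring.
- have bf := @bij_pairs_odd 1 0 (fun p => (p.1 + p.2 + 1, p.1 - p.2 + 0))
    (fun _ _ => erefl) (or_introl (addr0 1)).
  rewrite [RHS](@reindex_esum _ _ _ _ _ _ _ bf).
  apply: eq_esum => -[a b] _ /=; rewrite theta_termM //.
  by congr (EFin (theta_term _ _ _ * theta_term _ _ _)); ring.
Qed.

Lemma thetaOM :
  thetaO (g ^+ 2) (w * v) * thetaE (g ^+ 2) (w / v) +
  thetaE (g ^+ 2) (w * v) * thetaO (g ^+ 2) (w / v) = thetaO g w * thetaO g v.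
Proof.
have [C1 [_ d1 d1']] := theta_dominated1 g2 wv.
have [C2 [_ d2 d2']] := theta_dominated1 g2 wVv.
have [C3 [_ _ d3]] := theta_dominated1 g01 w0.
have [C4 [_ _ d4]] := theta_dominated1 g01 v0.
apply/eqP; rewrite -eqe EFinD /thetaE /thetaO (zsumM d1' d2) (zsumM d1 d2') (zsumM d3 d4).
apply/eqP; rewrite [RHS](@esumID _ _ int_pairs_even) //.
rewrite !setTI; congr (_ + _)%E.
- have bf := @bij_pairs_even 0 0 (fun p => (p.1 + p.2 + 0, p.1 - p.2 + 0))
    (fun _ _ => erefl) (addr0 0).
  rewrite [RHS](@reindex_esum _ _ _ _ _ _ _ bf).
  apply: eq_esum => -[a b] _ /=; rewrite theta_termM //.
  by congr (EFin (theta_term _ _ _ * theta_term _ _ _)); ring.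
- have bf := @bij_pairs_odd 0 (-1) (fun p => (p.1 + p.2 + 0, p.1 - p.2 - 1))
    (fun _ _ => erefl) (or_intror (add0r (-1))).
  rewrite [RHS](@reindex_esum _ _ _ _ _ _ _ bf).
  apply: eq_esum => -[a b] _ /=; rewrite theta_termM //.
  by congr (EFin (theta_term _ _ _ * theta_term _ _ _)); ring.
Qed.

End AdditionFormulas.

Section QuasiPeriod.
Variables (g w : R).
Hypotheses (g01 : 0 < g < 1) (w0 : 0 < w).

(** Completing the square: s^2 + 2 s = (s + 1)^2 - 1. *)
Lemma theta_term_shift s :
  theta_term g (g ^+ 2 * w) s = (g * w)^-1 * theta_term g w (s + 1).
Proof.
have g0 : 0 < g by case/andP: g01.
have [gn wn] : g != 0 /\ w != 0 by rewrite !lt0r_neq0.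
rewrite /theta_term exprzMl ?unitfE ?expf_neq0 // [g ^+ 2]exprnP exprz_exp.
rewrite [LHS]mulrA -expfzDr // (expfzDr _ 1 wn) expr1z.
have -> : (s + 1) * (s + 1) = (s * s + 2 * s) + 1 by ring.
by rewrite (expfzDr _ 1 gn) expr1z; field; rewrite gn wn.
Qed.

Lemma thetaE_shift : thetaE g (g ^+ 2 * w) = thetaO g w / (g * w).
Proof.
have [C [_ _ d]] := theta_dominated1 g01 w0.
rewrite [RHS]mulrC /thetaO -(zsumZ _ d).
  by apply: zsum_eq => n; rewrite theta_term_shift.
by rewrite invr_ge0 mulr_ge0 ?ltW //; case/andP: g01.
Qed.

Lemma thetaO_shift : thetaO g (g ^+ 2 * w) = thetaE g w / (g * w).
Proof.
have [C [_ d _]] := theta_dominated1 g01 w0.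
rewrite [RHS]mulrC /thetaE -(zsumZ _ d); last first.
  by rewrite invr_ge0 mulr_ge0 ?ltW //; case/andP: g01.
rewrite -[RHS](@zsum_reindex _ _ (fun n => n + 1) (fun n => n - 1)).
- apply: zsum_eq => n; rewrite theta_term_shift /=.
  by congr (_ * theta_term _ _ _); ring.
- by move=> n; ring.
- by move=> n; ring.
Qed.

End QuasiPeriod.

End Theta.

(** * The quotient of the theta series *)

Section Continuity.
Variable R : realType.

(** Uniform domination makes the partial sums converge uniformly near x0. *)
Lemma zsum_continuous (u : R -> int -> R) (C x0 : R) :
  (\forall x \near x0, geom_dominated C (u x)) ->
  (forall n, {for x0, continuous (u^~ n)}) ->
  {for x0, continuous (fun x => zsum (u x))}.
Proof.
move=> du cu; have d0 : geom_dominated C (u x0) := nbhs_singleton du.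
have cz N : zpart (u x) N @[x --> x0] --> zpart (u x0) N.
  elim: N => [|N IH].
    rewrite /zpart big_nil (_ : (fun x => _) = fun=> 0); first exact: cvg_cst.
    by apply/funext => x; rewrite big_nil.
  rewrite zpart_recr (_ : (fun x => _) = (fun x => zpart (u x) N + zblock (u x) N)); last first.
    by apply/funext => x; rewrite zpart_recr.
  by apply: cvgD => //; apply: cvgD; exact: cu.
apply/cvgrPdist_le => e e0.
have [N hN] : exists N, 4 * C * 2^-1 ^+ N <= e / 3.
  have e3 : 0 < e / 3 by rewrite divr_gt0.
  move/cvgrPdist_le: (cvg_half_pow (4 * C)) => /(_ _ e3) [N _ /(_ N (leqnn N))].
  rewrite sub0r normrN => h; exists N; apply: le_trans h; exact: ler_norm.
have e3 : 0 < e / 3 by rewrite divr_gt0.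
move/cvgrPdist_le: (cz N) => /(_ _ e3) czN.
near=> x.
have dx : geom_dominated C (u x) by near: x.
have /andP[a1 a2] := zsum_bounds d0 N; have /andP[b1 b2] := zsum_bounds dx N.
have : `|zpart (u x0) N - zpart (u x) N| <= e / 3 by near: x.
rewrite !ler_norml => /andP[c1 c2]; lra.
Unshelve. all: by end_near. Qed.

Variables (g0 w0 : R).
Hypotheses (g01 : 0 < g0 < 1) (w00 : 0 < w0).

Lemma theta_near_dominated : exists C,
  (\forall w \near w0, geom_dominated C (fun n => theta_term g0 w (2 * n)) /\
     geom_dominated C (fun n => theta_term g0 w (2 * n + 1))) /\
  (\forall g \near g0, geom_dominated C (fun n => theta_term g w0 (2 * n)) /\
     geom_dominated C (fun n => theta_term g w0 (2 * n + 1))).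
Proof.
have w0p := w00; case/andP: g01 => g0p g0l; have v0 : 0 < w0^-1 by rewrite invr_gt0.
(* Bounds valid in a neighbourhood of g0 and of w0. *)
pose rho := (1 + g0) / 2; pose W := 1 + 2 * w0 + 2 * w0^-1.
have [C hC] : exists C, forall g w, 0 < g <= rho -> W^-1 <= w <= W ->
    [/\ geom_dominated C (theta_term g w),
        geom_dominated C (fun n => theta_term g w (2 * n)) &
        geom_dominated C (fun n => theta_term g w (2 * n + 1))].
  apply: theta_dominated; first by rewrite /rho; apply/andP; split; lra.
  by rewrite /W; move: v0 w00; move: (w0^-1) => v; lra.
have hW w : w0 / 2 < w -> w < 2 * w0 -> W^-1 <= w <= W.
  move=> h1 h2; have wp : 0 < w by apply: lt_trans h1; rewrite divr_gt0.
  have Wp : 0 < W by rewrite /W; lra.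
  apply/andP; split; last by rewrite /W; lra.
  rewrite invf_ple ?posrE //.
  have : w^-1 <= (w0 / 2)^-1 by rewrite lef_pV2 ?posrE ?(ltW h1) // divr_gt0.
  rewrite invf_div /W; lra.
exists C; split.
- have wI : w0 \in `](w0 / 2), (2 * w0)[ by rewrite in_itv /=; apply/andP; split; lra.
  near=> w; have : w \in `](w0 / 2), (2 * w0)[ by near: w; exact: near_in_itvoo.
  rewrite in_itv /= => /andP[h1 h2].
  have [||_ ? ?] // := hC g0 w; last exact: hW.
  by rewrite g0p /rho; lra.
- have gI : g0 \in `]0, rho[ by rewrite in_itv /= g0p /rho; lra.
  near=> g; have : g \in `]0, rho[ by near: g; exact: near_in_itvoo.
  rewrite in_itv /= => /andP[h1 h2].
  have [||_ ? ?] // := hC g w0; first by rewrite h1 ltW.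
  by apply: hW; lra.
Unshelve. all: by end_near. Qed.

Lemma theta_term_cont_w s : {for w0, continuous (fun w => theta_term g0 w s)}.
Proof.
apply: cvgM; first exact: cvg_cst.
case: s => n; first exact: exprn_continuous.
rewrite (_ : (fun w : R => w ^ Negz n) = (fun w => (w ^+ n.+1)^-1)).
  by apply: cvgV; [rewrite expf_neq0 // lt0r_neq0|exact: exprn_continuous].
by apply/funext => w; rewrite NegzE -exprz_inv -exprnP exprVn.
Qed.

Lemma theta_term_cont_g s : {for g0, continuous (fun g => theta_term g w0 s)}.
Proof.
rewrite (_ : (fun g => theta_term g w0 s) = (fun g => g ^+ (`|s| * `|s|)%N * w0 ^ s)).
  by apply: cvgM; [exact: exprn_continuous|exact: cvg_cst].
by apply/funext => g; rewrite theta_term_nat.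
Qed.

Definition theta_ratio (g w : R) := thetaO g w / thetaE g w.

Lemma theta_ratio_cont_w : {for w0, continuous (theta_ratio g0)}.
Proof.
have [C [hw _]] := theta_near_dominated.
apply: cvgM.
- apply: (@zsum_continuous (fun w n => theta_term g0 w (2 * n + 1)) C).
    by apply: filterS hw => w [].
  by move=> n; exact: theta_term_cont_w.
- apply: cvgV; first by rewrite lt0r_neq0 // thetaE_gt0.
  apply: (@zsum_continuous (fun w n => theta_term g0 w (2 * n)) C).
    by apply: filterS hw => w [].
  by move=> n; exact: theta_term_cont_w.
Qed.

Lemma theta_ratio_cont_g : {for g0, continuous (theta_ratio^~ w0)}.
Proof.
have [C [_ hg]] := theta_near_dominated.
apply: cvgM.
- apply: (@zsum_continuous (fun g n => theta_term g w0 (2 * n + 1)) C).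
    by apply: filterS hg => w [].
  by move=> n; exact: theta_term_cont_g.
- apply: cvgV; first by rewrite lt0r_neq0 // thetaE_gt0.
  apply: (@zsum_continuous (fun g n => theta_term g w0 (2 * n)) C).
    by apply: filterS hg => w [].
  by move=> n; exact: theta_term_cont_g.
Qed.

End Continuity.

Section ThetaRatio.
Variable R : realType.
Implicit Types g w v x : R.

(** Its square is the elliptic modulus theta_2^2 / theta_3^2 of nome g^4. *)
Definition root_modulus g : R := theta_ratio g 1.

Section Fixed.
Variable g : R.
Hypothesis g01 : 0 < g < 1.

Let g0 : 0 < g. Proof. by case/andP: g01. Qed.

Lemma theta_ratio_gt0 w : 0 < w -> 0 < theta_ratio g w.
Proof. by move=> w0; apply: divr_gt0; [exact: thetaO_gt0|exact: thetaE_gt0]. Qed.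

Lemma theta_ratio_shift w : 0 < w -> theta_ratio g (g ^+ 2 * w) = (theta_ratio g w)^-1.
Proof.
move=> w0; rewrite /theta_ratio thetaE_shift // thetaO_shift //.
have := thetaE_gt0 g01 w0; have := thetaO_gt0 g01 w0 => o0 e0.
by field; rewrite !lt0r_neq0.
Qed.

(** By the addition formulas, thetaO(w) thetaE(1) - thetaE(w) thetaO(1) is a
    positive multiple of a perfect square. *)
Lemma theta_ratio_ge w : 0 < w -> root_modulus g <= theta_ratio g w.
Proof.
move=> w0; have gw : 0 < g ^+ 2 * w by rewrite mulr_gt0 ?exprn_gt0.
have l01 := @ltr01 R.
rewrite /root_modulus /theta_ratio ler_pdivrMr ?thetaE_gt0 // mulrAC ler_pdivlMr ?thetaE_gt0 //.
have := thetaEM g01 gw l01; have := thetaOM g01 gw l01.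
rewrite mulr1 divr1 thetaE_shift // thetaO_shift //.
set e := thetaE (g ^+ 2) _; set o := thetaO (g ^+ 2) _ => h1 h2.
have gw0 : 0 < (g * w)^-1 by rewrite invr_gt0 mulr_gt0.
rewrite -(ler_pM2r gw0) -subr_ge0.
rewrite (_ : _ - _ = (e - o) ^+ 2) ?sqr_ge0 //.
rewrite -[_ * _ / (g * w)]mulrAC -h2 [thetaO g 1 * _]mulrC -[_ * _ / (g * w)]mulrAC -h1; ring.
Qed.

(** Multiplying w by g^2 inverts the quotient. *)
Lemma theta_ratio_le w : 0 < w -> theta_ratio g w <= (root_modulus g)^-1.
Proof.
move=> w0; have gw : 0 < g ^+ 2 * w by rewrite mulr_gt0 ?exprn_gt0.
rewrite -[leLHS]invrK -theta_ratio_shift // lef_pV2 ?posrE ?theta_ratio_gt0 //.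
exact: theta_ratio_ge.
Qed.

Lemma root_modulus_gt0 : 0 < root_modulus g.
Proof. exact: theta_ratio_gt0. Qed.

(** The values at 1 and at g^2 are the two end points, so the intermediate value
    theorem applies on [g^2, 1]. *)
Lemma theta_ratio_onto y : root_modulus g <= y <= (root_modulus g)^-1 ->
  exists2 w, 0 < w & theta_ratio g w = y.
Proof.
move=> /andP[y1 y2]; have g2 : 0 < g ^+ 2 by rewrite exprn_gt0.
have g21 : g ^+ 2 <= 1 by case/andP: g01 => _ g1; rewrite exprn_ile1 // ltW.
have := @IVT R (theta_ratio g) (g ^+ 2) 1 y g21; case.
- apply: continuous_in_subspaceT => w; rewrite inE /= in_itv /= => /andP[wg _].
  by apply: theta_ratio_cont_w => //; exact: lt_le_trans wg.
- have -> : theta_ratio g (g ^+ 2) = (root_modulus g)^-1.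
    by rewrite -{1}[g ^+ 2]mulr1 theta_ratio_shift.
  by rewrite ge_min le_max y1 y2 /= ?orbT.
- by move=> w; rewrite in_itv /= => /andP[wg _] <-; exists w => //; exact: lt_le_trans wg.
Qed.

(** The addition formulas at w = v = 1.  In terms of the moduli m^2 this is the
    algebraic form of Landen's transformation. *)
Lemma root_modulus_double :
  root_modulus g ^+ 2 = 2 * root_modulus (g ^+ 2) / (1 + root_modulus (g ^+ 2) ^+ 2).
Proof.
have g2 : 0 < g ^+ 2 < 1 by case/andP: g01 => _ g1; rewrite exprn_gt0 //= expr_lt1 // ltW.
have l01 := @ltr01 R.
have := thetaEM g01 l01 l01; have := thetaOM g01 l01 l01; rewrite mulr1 divr1.
have := thetaE_gt0 g01 l01; have := thetaE_gt0 g2 l01.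
rewrite /root_modulus /theta_ratio.
set E := thetaE g 1; set O := thetaO g 1; set e := thetaE _ 1; set o := thetaO _ 1.
move=> e0 E0 h1 h2; rewrite expr_div_n !expr2 -h1 -h2.
field; rewrite lt0r_neq0 //= lt0r_neq0 // ltr_pwDl ?mulr_gt0 //.
by rewrite -expr2 sqr_ge0.
Qed.

(** Block by block: (2n+1)^2 >= (2n)^2 + 1, and the two indices 2n + 1 and
    - (2n + 1) give equal terms. *)
Lemma root_modulus_le : root_modulus g <= 2 * g.
Proof.
have l01 := @ltr01 R.
have [C [_ dE dO]] := theta_dominated1 g01 l01.
rewrite /root_modulus /theta_ratio ler_pdivrMr ?thetaE_gt0 //.
have cO := cvg_zpart dO; have cE : (fun N => 2 * g * zpart (fun n => theta_term g 1 (2 * n)) N) @ \oo --> 2 * g * thetaE g 1.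
  by apply: cvgM; [exact: cvg_cst|exact: cvg_zpart dE].
apply: (ler_cvg_to cO cE); near=> N.
rewrite /zpart mulr_sumr; apply: ler_sum => n _.
have t0 s : theta_term g 1 s = g ^+ (`|s| * `|s|)%N by rewrite theta_term_nat exp1rz mulr1.
rewrite /zblock !t0.
have -> : `|(2 * Posz n + 1)%R|%N = (2 * n).+1 by lia.
have -> : `|(2 * Negz n + 1)%R|%N = (2 * n).+1 by lia.
have -> : `|(2 * Posz n)%R|%N = (2 * n)%N by lia.
have h1 : g ^+ ((2 * n).+1 * (2 * n).+1) <= g * g ^+ (2 * n * (2 * n)).
  by rewrite -exprS ler_wiXn2l ?(ltW g0) //; [case/andP: g01 => _ /ltW|lia].
have h2 : 0 <= 2 * g * g ^+ (`|(2 * Negz n)%R|%N * `|(2 * Negz n)%R|%N).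
  by rewrite !mulr_ge0 ?exprn_ge0 // ltW.
rewrite mulrDr; apply: le_trans (lerD h1 h1) _.
by rewrite [leLHS](_ : _ = 2 * g * g ^+ (2 * n * (2 * n))) ?lerDl //; ring.
Unshelve. all: by end_near. Qed.

Lemma root_modulus_le1 : root_modulus g <= 1.
Proof.
have g2 : 0 < g ^+ 2 < 1 by case/andP: g01 => _ g1; rewrite exprn_gt0 //= expr_lt1 // ltW.
have m0 := root_modulus_gt0.
rewrite -(@expr_le1 _ 2) ?(ltW m0) // root_modulus_double.
rewrite ler_pdivrMr ?ltr_pwDl ?exprn_gt0 ?sqr_ge0 // mul1r -subr_ge0.
by rewrite (_ : _ - _ = (1 - root_modulus (g ^+ 2)) ^+ 2) ?sqr_ge0 //; ring.
Qed.

End Fixed.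

Lemma sqr_itv01 g : 0 < g < 1 -> 0 < g ^+ 2 < 1.
Proof. by move=> /andP[g0 g1]; rewrite exprn_gt0 //= expr_lt1 // ltW. Qed.

Lemma root_modulus_sqr_ge g : 0 < g < 1 -> root_modulus (g ^+ 2) <= root_modulus g ^+ 2.
Proof.
move=> g01; rewrite root_modulus_double //; have g2 := sqr_itv01 g01.
have m0 := root_modulus_gt0 g2; have m1 := root_modulus_le1 g2.
rewrite ler_pdivlMr ?ltr_pwDl ?exprn_gt0 ?sqr_ge0 // mulrC ler_pM2r //.
have : root_modulus (g ^+ 2) ^+ 2 <= 1 by rewrite exprn_ile1 // ltW.
lra.
Qed.

(** If m(g) = 1, then doubling gives m(g^(2^n)) = 1 for all n, against
    m(g) <= 2 g. *)
Lemma root_modulus_lt1 g : 0 < g < 1 -> root_modulus g < 1.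
Proof.
move=> g01; rewrite lt_neqAle root_modulus_le1 // andbT; apply/negP => /eqP m1.
have all1 n : root_modulus (g ^+ (2 ^ n)) = 1 /\ 0 < g ^+ (2 ^ n) < 1.
  elim: n => [|n [IH h]]; first by rewrite expr1.
  rewrite expnSr exprM; split; last exact: sqr_itv01.
  have := root_modulus_double h; rewrite IH expr1n.
  have m0 := root_modulus_gt0 (sqr_itv01 h).
  set x := root_modulus _ in m0 *; have d0 : 0 < 1 + x ^+ 2 by rewrite ltr_pwDl ?exprn_gt0 ?sqr_ge0.
  move/(congr1 ( *%R^~ (1 + x ^+ 2))); rewrite mul1r divfK ?lt0r_neq0 // => e.
  have : (1 - x) ^+ 2 = 0 by rewrite (_ : (1 - x) ^+ 2 = 1 + x ^+ 2 - 2 * x); [rewrite e subrr|ring].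
  by move/eqP; rewrite sqrf_eq0 subr_eq0 => /eqP.
have [n hn] : exists n, g ^+ (2 ^ n) < 1 / 2.
  have /andP[g0 g1] := g01.
  have : g ^+ n @[n --> \oo] --> (0 : R) by apply: cvg_expr; rewrite ger0_norm // ltW.
  move/cvgrPdist_lt => /(_ (1 / 2)); rewrite divr_gt0 // => /(_ isT) [N _ hN]; exists N.
  have := hN (2 ^ N)%N (ltnW (ltn_expl _ (isT : (1 < 2)%N))).
  by rewrite sub0r normrN ger0_norm // exprn_ge0 // ltW.
have [e h] := all1 n; have := root_modulus_le h; rewrite e; lra.
Qed.

(** The even part stays bounded for g <= 1/2 and the odd part contains the
    term g. *)
Lemma root_modulus_lower : exists2 c, 0 < c &
  forall g, 0 < g <= 1 / 2 -> c * g <= root_modulus g.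
Proof.
have r01 : 0 <= (1 / 2 : R) < 1 by apply/andP; split; lra.
have [C hC] := theta_dominated r01 (lexx 1).
have h g : 0 < g <= 1 / 2 -> thetaE g 1 <= 4 * C /\ g <= thetaO g 1.
  move=> gh; have /andP[g0 gl] := gh.
  have [//||_ dE' dO'] := hC g 1; first by rewrite invr1 !lexx.
  split.
    by have /andP[_] := zsum_bounds dE' 0; rewrite /zpart big_nil add0r expr0 mulr1.
  by have := zsum_ge_term dO' 0; rewrite /theta_term mulr0 add0r mul1r exp1rz mulr1 expr1z.
have C0 : 0 < 4 * C.
  have g1 : 0 < (1 / 2 : R) <= 1 / 2 by rewrite lexx andbT divr_gt0.
  have [h1 _] := h _ g1; apply: lt_le_trans h1; apply: thetaE_gt0 => //.
  by apply/andP; split; lra.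
exists (4 * C)^-1; first by rewrite invr_gt0.
move=> g gh; have [h1 h2] := h _ gh; have /andP[g0 gl] := gh.
have g01 : 0 < g < 1 by rewrite g0; lra.
have E0 := thetaE_gt0 g01 (@ltr01 R).
rewrite /root_modulus /theta_ratio mulrC ler_pM ?invr_ge0 ?(ltW g0) ?(ltW C0) //.
by rewrite lef_pV2.
Qed.

(** Continuity in g: small values occur because m(g) <= 2 g, and values close to
    1 because m(g)^2 >= m(g^2), so that taking square roots of the nome raises
    m towards 1. *)
Lemma root_modulus_onto x : 0 < x < 1 -> exists2 g, 0 < g < 1 & root_modulus g = x.
Proof.
move=> /andP[x0 x1].
have g12 : 0 < (1 / 2 : R) < 1 by apply/andP; split; lra.
have [b b01 hb] : exists2 b, 0 < b < 1 & x <= root_modulus b.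
  have [n] : exists n, x ^+ (2 ^ n) <= root_modulus (1 / 2).
    have m0 := root_modulus_gt0 g12.
    have : x ^+ n @[n --> \oo] --> (0 : R) by apply: cvg_expr; rewrite ger0_norm // ltW.
    move/cvgrPdist_le => /(_ _ m0) [N _ hN]; exists N.
    have := hN (2 ^ N)%N (ltnW (ltn_expl _ (isT : (1 < 2)%N))).
    by rewrite sub0r normrN ger0_norm // exprn_ge0 // ltW.
  elim: n x x0 x1 => [|n IH] x x0 x1; first by rewrite expr1 => ?; exists (1 / 2).
  rewrite expnS exprM => h.
  have [||b b01 hb] := IH (x ^+ 2) _ _ h; [by rewrite exprn_gt0|by rewrite expr_lt1 // ltW|].
  have /andP[b0 b1] := b01.
  have s01 : 0 < Num.sqrt b < 1.
    by rewrite sqrtr_gt0 b0 /= -sqrtr1 ltr_sqrt.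
  exists (Num.sqrt b) => //.
  rewrite -(@ler_pXn2r _ 2) ?nnegrE ?(ltW x0) ?(ltW (root_modulus_gt0 s01)) //.
  apply: le_trans hb _; have := root_modulus_sqr_ge s01.
  by rewrite sqr_sqrtr // ltW.
(* The minimum with b keeps the interval [a, b] oriented. *)
pose a := Num.min (x / 2) b.
have a0 : 0 < a by rewrite lt_min divr_gt0 //; case/andP: b01.
have ab : a <= b by rewrite ge_min lexx orbT.
have b1 : b < 1 by case/andP: b01.
have a01 : 0 < a < 1 by rewrite a0 (le_lt_trans ab).
have ha : root_modulus a <= x.
  apply: le_trans (root_modulus_le a01) _.
  have : a <= x / 2 by rewrite ge_min lexx.
  lra.
have := @IVT R root_modulus a b x ab; case.
- apply: continuous_in_subspaceT => g; rewrite inE /= in_itv /= => /andP[ag gb].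
  apply: theta_ratio_cont_g => //.
  by rewrite (lt_le_trans a0 ag) (le_lt_trans gb).
- by rewrite ge_min le_max ha hb orbT.
- move=> g; rewrite in_itv /= => /andP[ag gb] <-; exists g => //.
  by rewrite (lt_le_trans a0 ag) (le_lt_trans gb).
Qed.

End ThetaRatio.

(** * The ring function in terms of the nome *)

Section ModulusOfNome.
Variable R : realType.
Implicit Types g x m : R.
Local Notation gmu := (@grotzsch_mu R).

Lemma grotzsch_mu_double g : 0 < g < 1 ->
  gmu (root_modulus g ^+ 2) = gmu (root_modulus (g ^+ 2) ^+ 2) / 2.
Proof.
move=> g01; have g2 := sqr_itv01 g01.
have m0 := root_modulus_gt0 g2; have m1 := root_modulus_lt1 g2.
rewrite root_modulus_double // -grotzsch_mu_landen; last by apply: sqr_itv01; rewrite m0.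
by rewrite sqrtr_sqr ger0_norm // ltW.
Qed.

Lemma grotzsch_mu_iter g n : 0 < g < 1 ->
  gmu (root_modulus g ^+ 2) = gmu (root_modulus (g ^+ (2 ^ n)) ^+ 2) * 2^-1 ^+ n.
Proof.
elim: n g => [|n IH] g g01; first by rewrite !expr1 expr0 mulr1.
rewrite grotzsch_mu_double // (IH _ (sqr_itv01 g01)) -exprM -expnS.
by rewrite [2^-1 ^+ n.+1]exprSr mulrA.
Qed.

Lemma cvg_pow_pow2 g : 0 < g < 1 -> g ^+ (2 ^ n) @[n --> \oo] --> (0 : R).
Proof.
move=> /andP[g0 g1]; apply: (@squeeze_cvgr _ _ _ _ (fun=> 0) (fun n => g ^+ n)).
- near=> n; rewrite exprn_ge0 ?(ltW g0) //=.
  by rewrite ler_wiXn2l ?(ltW g0) ?(ltW g1) // ltnW // ltn_expl.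
- exact: cvg_cst.
- by apply: cvg_expr; rewrite ger0_norm // ltW.
Unshelve. all: by end_near. Qed.

(** Squaring the nome doubles mu, so mu(m(g)^2) is the limit of
    mu(m(g^(2^n))^2) / 2^n.  There the modulus is small and comparable to the
    square of g^(2^n), and mu(k) behaves like - ln k; additive constants
    disappear after division by 2^n. *)
Lemma grotzsch_mu_root_modulus g : 0 < g < 1 -> gmu (root_modulus g ^+ 2) = - 2 * ln g.
Proof.
move=> g01; have /andP[g0 g1] := g01.
have gn01 n : 0 < g ^+ (2 ^ n) < 1.
  by rewrite exprn_gt0 //= exprn_ilt1 ?(ltW g0) // -lt0n expn_gt0.
have [c c0 hc] := root_modulus_lower R.
have half n : 2^-1 ^+ n * 2 ^+ n = 1 :> R by rewrite -exprMn mulVf ?expr1n.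
have ln_gn n : ln (g ^+ (2 ^ n)) = 2 ^+ n * ln g.
  by rewrite lnXn // -[ln g *+ _]mulr_natl natrX.
have near_small : \forall n \near \oo, g ^+ (2 ^ n) <= 1 / 4.
  have e0 : 0 < (1 / 4 : R) by rewrite divr_gt0.
  move/cvgrPdist_le: (cvg_pow_pow2 g01) => /(_ _ e0); apply: filterS => n.
  by rewrite sub0r normrN ger0_norm // exprn_ge0 // ltW.
apply/eqP; rewrite eq_le; apply/andP; split.
- have cv : (- 2 * ln g + (5 - 2 * ln c) * 2^-1 ^+ n) @[n --> \oo] --> - 2 * ln g + 0.
    by apply: cvgD; [exact: cvg_cst|exact: cvg_half_pow].
  rewrite addr0 in cv.
  apply: (ler_cvg_to (cvg_cst (gmu (root_modulus g ^+ 2))) cv).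
  near=> n; have small : g ^+ (2 ^ n) <= 1 / 4 by near: n.
  rewrite (grotzsch_mu_iter n g01).
  have gn := gn01 n; have /andP[gn0 gn1] := gn.
  have m0 := root_modulus_gt0 gn; have m1 := root_modulus_lt1 gn.
  have m2 := root_modulus_le gn.
  have mh : root_modulus (g ^+ (2 ^ n)) <= 1 / 2 by lra.
  have mc : c * g ^+ (2 ^ n) <= root_modulus (g ^+ (2 ^ n)) by apply: hc; rewrite gn0; lra.
  set m := root_modulus _ in m0 m1 m2 mh mc *.
  have k01 : 0 < m ^+ 2 < 1 by apply: sqr_itv01; rewrite m0.
  have kh : (m ^+ 2) ^+ 2 <= 2^-1.
    have : m ^+ 2 <= 1 / 2 by nra.
    case/andP: k01 => k0 _; move: (m ^+ 2) k0 => k k0 k1; nra.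
  have := grotzsch_mu_le k01 kh; rewrite lnXn // [ln m *+ 2]mulr2n => h1.
  have : ln (c * g ^+ (2 ^ n)) <= ln m by rewrite ler_ln ?posrE // mulr_gt0.
  rewrite lnM ?posrE // ln_gn => h2.
  have h3 : gmu (m ^+ 2) <= 5 - 2 * ln c - 2 * (2 ^+ n * ln g) by lra.
  apply: le_trans (_ : (5 - 2 * ln c - 2 * (2 ^+ n * ln g)) * 2^-1 ^+ n <= _).
    by rewrite ler_wpM2r // exprn_ge0.
  rewrite le_eqVlt; apply/orP; left; apply/eqP.
  move: (half n); move: (2^-1 ^+ n) (2 ^+ n) => u v uv.
  have -> : - 2 * ln g = - 2 * ln g * (u * v) by rewrite uv mulr1.
  ring.
- have cv : ((1 - 4 * (g ^+ (2 ^ n)) * (g ^+ (2 ^ n))) *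
      (- 2 * ln g - 2 * ln 2 * 2^-1 ^+ n)) @[n --> \oo] --> (1 - 4 * 0 * 0) * (- 2 * ln g - 0).
    apply: cvgM; apply: cvgB; try exact: cvg_cst; last exact: cvg_half_pow.
    by apply: cvgM; [apply: cvgM; [exact: cvg_cst|exact: cvg_pow_pow2]|exact: cvg_pow_pow2].
  rewrite !mulr0 !subr0 mul1r in cv.
  apply: (ler_cvg_to cv (cvg_cst (gmu (root_modulus g ^+ 2)))).
  near=> n; have small : g ^+ (2 ^ n) <= 1 / 4 by near: n.
  rewrite (grotzsch_mu_iter n g01).
  have gn := gn01 n; have /andP[gn0 gn1] := gn.
  have m0 := root_modulus_gt0 gn; have m1 := root_modulus_lt1 gn.
  have m2 := root_modulus_le gn.
  have mh : root_modulus (g ^+ (2 ^ n)) <= 1 / 2 by lra.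
  set m := root_modulus _ in m0 m1 m2 mh *.
  have k01 : 0 < m ^+ 2 < 1 by apply: sqr_itv01; rewrite m0.
  have := grotzsch_mu_ge k01; rewrite lnXn // [ln m *+ 2]mulr2n => h1.
  have : ln m <= ln (2 * g ^+ (2 ^ n)) by rewrite ler_ln ?posrE // mulr_gt0.
  rewrite lnM ?posrE // ln_gn => h2.
  have h3 : (1 - 4 * (g ^+ (2 ^ n)) * (g ^+ (2 ^ n))) * (- 2 * (ln 2 + 2 ^+ n * ln g)) <= gmu (m ^+ 2).
    apply: le_trans h1.
    have lnm : 0 <= - (ln m + ln m) by have := ln_le0 (ltW m1); lra.
    apply: le_trans (_ : (1 - 4 * (g ^+ (2 ^ n)) * (g ^+ (2 ^ n))) * (- (ln m + ln m)) <= _).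
      apply: ler_wpM2l; last by lra.
      by move: (g ^+ _) gn0 small => y y0 y1; nra.
    apply: ler_wpM2r => //.
    have : m ^+ 2 <= 4 * g ^+ (2 ^ n) * g ^+ (2 ^ n).
      by move: (g ^+ _) gn0 small m2 => y y0 y1 y2; nra.
    have : 1 - m ^+ 2 <= Num.sqrt (1 - (m ^+ 2) ^+ 2).
      case/andP: k01; move: (m ^+ 2) => k k0 k1.
      have k2 : 0 <= 1 - k ^+ 2 by nra.
      rewrite -(@ler_pXn2r _ 2) ?nnegrE ?sqrtr_ge0 //; last by lra.
      by rewrite sqr_sqrtr //; nra.
    lra.
  apply: le_trans (_ : ((1 - 4 * (g ^+ (2 ^ n)) * (g ^+ (2 ^ n))) * (- 2 * (ln 2 + 2 ^+ n * ln g))) * 2^-1 ^+ n <= _); last first.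
    by rewrite ler_wpM2r // exprn_ge0.
  rewrite le_eqVlt; apply/orP; left; apply/eqP.
  move: (half n); move: (2^-1 ^+ n) (2 ^+ n) (g ^+ _) => u v y uv.
  have -> : - 2 * ln g = - 2 * ln g * (u * v) by rewrite uv mulr1.
  ring.
Unshelve. all: by end_near. Qed.

Lemma grotzsch_mu_le_log x : 0 < x < 1 -> gmu x <= ln 4 - ln x.
Proof.
move=> /andP[x0 x1].
have s01 : 0 < Num.sqrt x < 1 by rewrite sqrtr_gt0 x0 /= -sqrtr1 ltr_sqrt.
have [g g01 mg] := root_modulus_onto s01; have /andP[g0 g1] := g01.
have xE : x = root_modulus g ^+ 2 by rewrite mg sqr_sqrtr // ltW.
have m0 := root_modulus_gt0 g01.
have lnx : ln x = ln (root_modulus g) + ln (root_modulus g) by rewrite xE lnXn // mulr2n.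
have ln4 : ln 4 = ln 2 + ln 2 :> R.
  by rewrite (_ : (4 : R) = 2 ^+ 2) ?lnXn ?[in LHS]mulr2n //; ring.
have : ln (root_modulus g) <= ln (2 * g).
  by rewrite ler_ln ?posrE ?root_modulus_le // mulr_gt0.
rewrite [ln (2 * g)]lnM ?posrE // => h.
by rewrite {1}xE grotzsch_mu_root_modulus // lnx ln4; lra.
Qed.

(** With e = (1 - m) / (1 + m), Landen's transformation sends e^2 to
    (1 - m^2) / (1 + m^2), the dual of m^2; hence mu(e^2) = pi^2 / mu(m^2). *)
Lemma sqr_dual_le m : 0 < m < 1 ->
  ((1 - m) / (1 + m)) ^+ 2 <= 4 * expR (- (pi ^+ 2 / gmu (m ^+ 2))).
Proof.
move=> m01; have e01 := dual_modulus01 m01; have l01 := sqr_itv01 m01.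
have k01 := sqr_itv01 e01; set e := (1 - m) / (1 + m) in e01 k01 *.
have /andP[e0 e1] := e01; have /andP[k0 k1] := k01; have /andP[m0 m1] := m01.
have muE : gmu (e ^+ 2) = pi ^+ 2 / gmu (m ^+ 2).
  have := grotzsch_mu_landen k01; rewrite sqrtr_sqr ger0_norm ?(ltW e0) //.
  have -> : 2 * e / (1 + e ^+ 2) = (1 - m ^+ 2) / (1 + m ^+ 2).
    rewrite /e; field; apply/and3P; split; rewrite lt0r_neq0 //; nra.
  rewrite grotzsch_mu_dual // => h.
  have mu0 := grotzsch_mu_gt0 l01.
  have -> : pi ^+ 2 / gmu (m ^+ 2) = 2 * (pi ^+ 2 / (2 * gmu (m ^+ 2))).
    by move: (pi ^+ 2) => p; field; rewrite lt0r_neq0.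
  by rewrite h mulrC divfK.
have -> : 4 * expR (- (pi ^+ 2 / gmu (m ^+ 2))) = expR (ln 4 - gmu (e ^+ 2)).
  by rewrite -muE expRD lnK // posrE.
rewrite -[leLHS]lnK ?posrE // ler_expR.
have := grotzsch_mu_le_log k01; lra.
Qed.

End ModulusOfNome.

(** * The triple product *)

Section TripleProduct.
Variable R : realType.

Section QBinomial.
Variable p : R.
Hypothesis p01 : 0 < p < 1.

Definition qfact n : R := \prod_(0 <= i < n) (1 - p ^+ i.+1).

Lemma qfact_recr n : qfact n.+1 = qfact n * (1 - p ^+ n.+1).
Proof. by rewrite /qfact big_nat_recr. Qed.

Lemma qfact_factor_gt0 i : 0 < 1 - p ^+ i.+1.
Proof. by case/andP: p01 => p0 p1; rewrite subr_gt0 exprn_ilt1 // ltW. Qed.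

Lemma qfact_gt0 n : 0 < qfact n.
Proof.
by rewrite /qfact big_mkord prodr_gt0 // => i _; exact: qfact_factor_gt0.
Qed.

Definition qbinom M j : R := qfact M / (qfact j * qfact (M - j)).

Lemma qbinom0 M : qbinom M 0 = 1.
Proof.
rewrite /qbinom subn0 {2}/qfact big_nil mul1r divff //.
by rewrite lt0r_neq0 // qfact_gt0.
Qed.

Lemma qbinomn M : qbinom M M = 1.
Proof.
rewrite /qbinom subnn {3}/qfact big_nil mulr1 divff //.
by rewrite lt0r_neq0 // qfact_gt0.
Qed.

Lemma qbinomS M j : (j < M)%N ->
  qbinom M.+1 j.+1 = qbinom M j.+1 + p ^+ (M - j) * qbinom M j.
Proof.
move=> jM; have -> : M = (j + (M - j).-1.+1)%N by lia.
set d := (M - j).-1.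
have e1 : ((j + d.+1).+1 - j.+1 = d.+1)%N by lia.
have e2 : (j + d.+1 - j.+1 = d)%N by lia.
have e3 : (j + d.+1 - j = d.+1)%N by lia.
rewrite /qbinom e1 e2 e3 (qfact_recr (j + d.+1)) (qfact_recr j) (qfact_recr d).
have Dj := lt0r_neq0 (qfact_gt0 j); have Dd := lt0r_neq0 (qfact_gt0 d).
have Fj := lt0r_neq0 (qfact_factor_gt0 j); have Fd := lt0r_neq0 (qfact_factor_gt0 d).
have -> : p ^+ (j + d.+1).+1 = p ^+ d.+1 * p ^+ j.+1 by rewrite -exprD; congr (p ^+ _); lia.
move: (p ^+ d.+1) (p ^+ j.+1) (qfact _) Fj Fd Dj Dd => x y z Fj Fd Dj Dd.
by field; rewrite Dj Dd Fj Fd.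
Qed.

Lemma qbinom_theorem M (y : R) :
  \prod_(0 <= i < M) (1 + y * p ^+ i) =
  \sum_(0 <= j < M.+1) qbinom M j * p ^+ 'C(j, 2) * y ^+ j.
Proof.
elim: M => [|M IH]; first by rewrite big_nil big_nat1 qbinom0 !expr0 !mulr1.
pose c M' j := qbinom M' j * p ^+ 'C(j, 2) * y ^+ j.
rewrite big_nat_recr //= {}IH -/(c M) -/(c M.+1).
have c0 M' : c M' 0%N = 1 by rewrite /c qbinom0 !expr0 !mulr1.
have S1 : \sum_(0 <= j < M.+1) c M j = 1 + \sum_(0 <= j < M) c M j.+1.
  by rewrite big_nat_recl // c0.
have S2 : \sum_(0 <= j < M.+1) c M j = \sum_(0 <= j < M) c M j + c M M.
  by rewrite big_nat_recr.
have S3 : \sum_(0 <= j < M.+2) c M.+1 j = 1 + (\sum_(0 <= j < M) c M.+1 j.+1 + c M.+1 M.+1).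
  by rewrite big_nat_recl // c0 big_nat_recr.
rewrite -/(\sum_(0 <= j < M.+1) c M j) -/(\sum_(0 <= j < M.+2) c M.+1 j).
rewrite S3 mulrDr mulr1 {1}S1 S2 -addrA; congr (_ + _).
rewrite mulrDl addrA; congr (_ + _); last first.
  by rewrite /c !qbinomn binS bin1 exprD exprS; ring.
rewrite mulr_suml -big_split /=; apply: eq_big_nat => j /andP[_ jM].
rewrite /c qbinomS // binS bin1.
have -> : p ^+ M = p ^+ (M - j) * p ^+ j by rewrite -exprD subnK // ltnW.
by rewrite exprD exprS; ring.
Qed.

End QBinomial.

Section Finite.
Variable q : R.
Hypothesis q01 : 0 < q < 1.
Let p := q ^+ 2.
Let p01 : 0 < p < 1. Proof. exact: sqr_itv01. Qed.

Definition triple_prod N (x : R) : R :=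
  \prod_(0 <= n < N) ((1 + q ^+ n.*2.+1 * x) * (1 + q ^+ n.*2.+1 / x)).

Definition central N : R := qbinom p N.*2 N.
(** The coefficient of index n divided by the central one.  Unlike the Gaussian
    binomials themselves it tends to 1, so that no infinite product of the
    q-factorials has to be evaluated. *)
Definition rel_coef N n : R := qfact p N ^+ 2 / (qfact p (N + n) * qfact p (N - n)).

Lemma central_gt0 N : 0 < central N.
Proof. by rewrite /central /qbinom divr_gt0 ?mulr_gt0 ?qfact_gt0. Qed.

Lemma qbinom_central N n : (n <= N)%N ->
  qbinom p N.*2 (N + n) = central N * rel_coef N n /\
  qbinom p N.*2 (N - n) = central N * rel_coef N n.
Proof.
move=> nN; rewrite /central /rel_coef /qbinom.
have -> : (N.*2 - (N + n) = N - n)%N by lia.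
have -> : (N.*2 - (N - n) = N + n)%N by lia.
have -> : (N.*2 - N = N)%N by lia.
have n0 i := lt0r_neq0 (qfact_gt0 p01 i).
by split; field; rewrite !n0.
Qed.

(** The q-binomial theorem of order 2 N with ratio q^2, centered at the index
    N. *)
Lemma triple_prod_sum N (x : R) : x != 0 ->
  triple_prod N x = central N * (1 + \sum_(0 <= n < N)
    rel_coef N n.+1 * (theta_term q x (Posz n.+1) + theta_term q x (Negz n))).
Proof.
move=> x0; have qn : q != 0 by rewrite lt0r_neq0 //; case/andP: q01.
(* The first N factors of the q-binomial product have negative powers
   of q; pulling out x q^-(2n+1) from each turns them into the factors
   in 1/x. *)
pose y : R := x * q ^ (1 - N.*2%:Z).
have yp i : y * p ^+ i = x * q ^ (1 - N.*2%:Z + i.*2%:Z).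
  rewrite /y /p -exprM -mulrA exprnP -expfzDr //.
  by congr (_ * q ^ _); lia.
have fac : \prod_(0 <= i < N.*2) (1 + y * p ^+ i) =
    triple_prod N x * (x ^+ N * q ^ (- (N * N)%N%:Z)).
  rewrite (@big_cat_nat _ _ _ N) //=; last by lia.
  rewrite big_nat_rev /= add0n.
  have shift (F : nat -> R) : \prod_(N <= i < N.*2) F i = \prod_(0 <= i < N) F (i + N)%N.
    by rewrite -{1}[N]add0n big_addn (_ : (N.*2 - N = N)%N) //; lia.
  rewrite shift.
  rewrite /triple_prod big_split /= -[RHS]mulrA [RHS]mulrC; congr (_ * _); last first.
    apply: eq_big_nat => i _; rewrite yp mulrC; congr (1 + _ * _).
    by rewrite exprnP; congr (q ^ _); lia.
  have -> : x ^+ N * q ^ (- (N * N)%N%:Z) = \prod_(0 <= n < N) (x * q ^ (- n.*2.+1%:Z)).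
    rewrite big_split /= prodr_const_nat subn0; congr (_ * _).
    elim: (N) => [|M IH]; first by rewrite big_nil mul0n oppr0 expr0z.
    by rewrite big_nat_recr //= -IH -expfzDr //; congr (q ^ _); lia.
  rewrite -big_split /=; apply: eq_big_nat => i /andP[_ iN].
  rewrite yp mulrDl mul1r addrC; congr (_ + _).
    by congr (x * q ^ _); lia.
  rewrite mulrA divfK // exprnP -expfzDr //.
  by rewrite (_ : _ + _ = 0) ?expr0z //; lia.
have xqn : x ^+ N * q ^ (- (N * N)%N%:Z) != 0.
  by rewrite mulf_neq0 ?expf_neq0 ?expfz_neq0.
apply: (mulIf xqn); rewrite -fac qbinom_theorem //.
have term j s : j%:Z - N%:Z = s -> p ^+ 'C(j, 2) * y ^+ j =
    theta_term q x s * (x ^+ N * q ^ (- (N * N)%N%:Z)).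
  move=> js; have e1 : p ^+ 'C(j, 2) = q ^ (j%:Z * j%:Z - j%:Z).
    rewrite /p -exprM exprnP; congr (q ^ _).
    rewrite mul2n bin2 halfK -[RHS]subr0.
    have -> : odd (j * j.-1) = false by rewrite oddM; case: (j) => //= i; rewrite andNb.
    by rewrite subn0; case: (j) => //= i; lia.
  have e2 : y ^+ j = x ^ j%:Z * q ^ ((1 - N.*2%:Z) * j%:Z).
    by rewrite /y exprMn !exprnP exprz_exp.
  rewrite e1 e2 /theta_term exprnP.
  have -> : q ^ (s * s) * x ^ s * (x ^ N%:Z * q ^ (- (N * N)%N%:Z)) =
    x ^ (s + N%:Z) * q ^ (s * s - (N * N)%N%:Z).
    by rewrite !expfzDr //; ring.
  rewrite mulrCA -expfzDr //; congr (x ^ _ * q ^ _); first by lia.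
  have -> : s = j%:Z - N%:Z by rewrite js.
  by rewrite PoszM -muln2 PoszM; ring.
move: (x ^+ N * _) term {fac xqn} => X term.
rewrite (@big_cat_nat _ _ _ N) //=; last by lia.
rewrite [X in _ + X](_ : _ = central N * X + \sum_(0 <= n < N)
   central N * rel_coef N n.+1 * theta_term q x (Posz n.+1) * X); last first.
  rewrite big_ltn; last by lia.
  rewrite -(mulrA (qbinom _ _ _)) (term _ 0) ?subrr // {1}/theta_term mulr0 !expr0z mulr1 mul1r; congr (_ + _).
  rewrite -{1}[N.+1]add0n big_addn (_ : (N.*2.+1 - N.+1 = N)%N); last by lia.
  apply: eq_big_nat => n /andP[_ nN].
  have [<- _] := qbinom_central nN.
  rewrite addnS addnC -addnS -(mulrA (qbinom _ _ _) (p ^+ _)) -(mulrA (qbinom _ _ _) (theta_term _ _ _)).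
  by congr (_ * _); apply: term; lia.
rewrite [X in X + _](_ : _ = \sum_(0 <= n < N)
   central N * rel_coef N n.+1 * theta_term q x (Negz n) * X); last first.
  rewrite big_nat_rev /= add0n; apply: eq_big_nat => n /andP[_ nN].
  have [_ <-] := qbinom_central nN.
  rewrite -(mulrA (qbinom _ _ _) (p ^+ _)) -(mulrA (qbinom _ _ _) (theta_term _ _ _)).
  by congr (_ * _); apply: term; rewrite NegzE; lia.
rewrite mulrDr mulr1 mulrDl addrCA; congr (_ + _).
rewrite mulr_sumr mulr_suml -big_split /=; apply: eq_big_nat => n _; ring.
Qed.

Lemma rel_coefE N n : (n <= N)%N -> rel_coef N n =
  \prod_(0 <= i < n) ((1 - p ^+ (N - n + i).+1) / (1 - p ^+ (N + i).+1)).
Proof.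
have nz i := lt0r_neq0 (qfact_gt0 p01 i); have fz i := lt0r_neq0 (qfact_factor_gt0 p01 i).
have num n' M : (n' <= M)%N -> qfact p M = qfact p (M - n') * \prod_(0 <= i < n') (1 - p ^+ (M - n' + i).+1).
  move=> nM; rewrite /qfact (@big_cat_nat _ _ _ (M - n')) //=; last by lia.
  congr (_ * _); rewrite -{1}[(M - n')%N]add0n big_addn (_ : (M - (M - n') = n')%N); last by lia.
  by apply: eq_big_nat => i _; rewrite addnC.
move=> nN; rewrite /rel_coef prodf_div {1}expr2.
have e1 := num n N nN; have := num n (N + n)%N (leq_addl _ _); rewrite addnK => e2.
have z : \prod_(0 <= i < n) (1 - p ^+ (N + i).+1) != 0.
  by rewrite prodf_seq_neq0; apply/allP => i _; rewrite fz.
by rewrite e2 {1}e1; field; rewrite !nz z.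
Qed.

(** Each of the n factors of rel_coefE lies between 1 - p^(N - n) and 1; the lower
    bound is Bernoulli's inequality. *)
Lemma rel_coef_bounds N n : (n <= N)%N -> 1 - n%:R * p ^+ (N - n) <= rel_coef N n <= 1.
Proof.
move=> nN; rewrite rel_coefE // big_mkord.
have /andP[p0 p1] := p01.
have h (i : 'I_n) : 1 - p ^+ (N - n) <= (1 - p ^+ (N - n + i).+1) / (1 - p ^+ (N + i).+1) <= 1.
  have d0 := qfact_factor_gt0 p01 (N + i).
  have a0 : 0 < p ^+ (N + i).+1 by rewrite exprn_gt0.
  have ab : p ^+ (N + i).+1 <= p ^+ (N - n + i).+1 by rewrite ler_wiXn2l ?ltW //; lia.
  have bc : p ^+ (N - n + i).+1 <= p ^+ (N - n) by rewrite ler_wiXn2l ?ltW //; lia.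
  have c1 : p ^+ (N - n) <= 1 by rewrite exprn_ile1 // ltW.
  rewrite ler_pdivlMr // ler_pdivrMr // mul1r; apply/andP; split; last by lra.
  by move: (p ^+ _) (p ^+ _) (p ^+ _) a0 ab bc c1 d0 => u v x *; nra.
have c1 : p ^+ (N - n) <= 1 by rewrite exprn_ile1 // ltW.
have c0 : 0 <= p ^+ (N - n) by rewrite exprn_ge0 // ltW.
apply/andP; split; last first.
  apply: (@le_trans _ _ (\prod_(i < n) (1 : R))); last by rewrite big1.
  apply: ler_prod => i _; have /andP[h1 h2] := h i; rewrite h2 andbT.
  by apply: le_trans h1; rewrite subr_ge0.
apply: (@le_trans _ _ (\prod_(i < n) (1 - p ^+ (N - n)))); last first.
  by apply: ler_prod => i _; have /andP[h1 h2] := h i; rewrite h1 andbT subr_ge0.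
rewrite prodr_const card_ord; move: (p ^+ _) c0 c1 => c c0 c1.
elim: (n) => [|m IH]; first by rewrite mul0r subr0 expr0.
rewrite exprS; apply: le_trans (_ : (1 - c) * (1 - m%:R * c) <= _).
  rewrite -natr1; have : 0 <= m%:R * c * c by rewrite !mulr_ge0.
  lra.
by rewrite ler_wpM2l // subr_ge0.
Qed.

End Finite.
End TripleProduct.

Section Limits.
Variable R : realType.

Lemma nat_geom_bounded (u : R) : 0 < u < 1 ->
  forall n, n%:R * u ^+ n <= (u^-1 - 1)^-1.
Proof.
move=> /andP[u0 u1] n; have h0 : 0 < u^-1 - 1 by rewrite subr_gt0 invf_gt1.
rewrite -[leRHS]mul1r ler_pdivlMr // mulrAC.
have : 1 + n%:R * (u^-1 - 1) <= u ^- n.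
  elim: n => [|n IH]; first by rewrite mul0r addr0 expr0 invr1.
  rewrite exprS invfM; apply: le_trans (_ : u^-1 * (1 + n%:R * (u^-1 - 1)) <= _).
    rewrite -natr1; have : 0 <= n%:R * (u^-1 - 1) * (u^-1 - 1) by rewrite !mulr_ge0 // ltW.
    move: (u^-1) h0 => v; move: (n%:R) => N; nra.
  by rewrite ler_wpM2l // invr_ge0 ltW.
have un0 : 0 < u ^+ n by rewrite exprn_gt0.
rewrite -[u ^- n]div1r ler_pdivlMr // => h; apply: le_trans h.
by rewrite ler_wpM2r ?(ltW un0) // lerDr.
Qed.

(** With rho = u^4 the n-th term is (n u^n)^2 (u^2)^n, and n u^n is bounded. *)
Lemma cvg_sqr_geom (rho : R) : 0 < rho < 1 ->
  (fun n => n%:R ^+ 2 * rho ^+ n) @ \oo --> (0 : R).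
Proof.
move=> /andP[r0 r1]; pose v := Num.sqrt rho; pose u := Num.sqrt v.
have v01 : 0 < v < 1 by rewrite sqrtr_gt0 r0 /= -sqrtr1 ltr_sqrt.
have u01 : 0 < u < 1.
  by case/andP: v01 => v0 v1; rewrite sqrtr_gt0 v0 /= -sqrtr1 ltr_sqrt.
have [/andP[u0 u1] /andP[v0 v1]] := (u01, v01).
have rE : rho = (u ^+ 2) ^+ 2 by rewrite sqr_sqrtr ?sqr_sqrtr ?ltW.
pose K := (u^-1 - 1)^-1.
have K0 : 0 <= K by apply: le_trans (nat_geom_bounded u01 0); rewrite mul0r.
have u2 := sqr_itv01 u01; have /andP[u20 u21] := u2.
have cv : (fun n => K ^+ 2 * (u ^+ 2) ^+ n) @ \oo --> (0 : R).
  rewrite -(mulr0 (K ^+ 2)); apply: cvgM; first exact: cvg_cst.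
  by apply: cvg_expr; rewrite ger0_norm // ltW.
apply: (@squeeze_cvgr _ _ _ _ (fun=> 0) _ _ _ _ _ cv); last exact: cvg_cst.
near=> n; rewrite mulr_ge0 ?exprn_ge0 ?(ltW r0) //=.
have -> : n%:R ^+ 2 * rho ^+ n = (n%:R * u ^+ n) ^+ 2 * (u ^+ 2) ^+ n.
  rewrite [(_ * _) ^+ 2]exprMn -(mulrA (n%:R ^+ 2)); congr (_ * _).
  by rewrite rE -!exprM -exprD; congr (u ^+ _); lia.
apply: ler_wpM2r; first by rewrite exprn_ge0 // ltW.
apply: lerXn2r; rewrite ?nnegrE ?nat_geom_bounded // mulr_ge0 // exprn_ge0 // ltW.
Unshelve. all: by end_near. Qed.

Section Parity.
Variables (q w : R).
Hypotheses (q01 : 0 < q < 1) (w0 : 0 < w).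

Definition even_int : set int := range (fun n : int => 2 * n).
Definition odd_int : set int := range (fun n : int => 2 * n + 1).

Definition restrict_int (A : set int) (u : int -> R) s : R := if s \in A then u s else 0.

Lemma even_or_odd_int s : (s \in even_int) = (s \notin odd_int).
Proof.
apply/idP/idP.
  rewrite !inE => -[n _ <-]; apply/negP; rewrite inE => -[m _]; lia.
move=> no; rewrite inE.
have := divz_eq s 2; have := modz_ge0 s (isT : 2 != 0 :> int).
have := ltz_pmod s (isT : 0 < 2 :> int).
set d := divz _ _; set r := modz _ _ => r2 r0 e.
have [r0'|r1] : r = 0 \/ r = 1 by lia.
  by exists d => //; lia.
by case/negP: no; rewrite inE; exists d => //; lia.
Qed.

Lemma geom_dominated_restrict C u A : geom_dominated C u ->
  geom_dominated C (restrict_int A u).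
Proof.
move=> du n; have /andP[h1 h2] := du n; rewrite /restrict_int; case: ifP => _.
  exact: du.
by rewrite lexx /=; exact: le_trans h2.
Qed.

Lemma zsum_restrict u (e : int -> int) : injective e ->
  zsum (restrict_int (range e) u) = zsum (fun n => u (e n)).
Proof.
move=> inj; rewrite /zsum /zesum; congr fine.
rewrite (_ : (fun n => (restrict_int (range e) u n)%:E) =
   (fun n => if n \in range e then (u n)%:E else 0%E)); last first.
  by apply/funext => n; rewrite /restrict_int; case: ifP.
rewrite -esum_mkcond; apply: (@reindex_esum _ _ _ [set: int] _ e (fun n => (u n)%:E)).
by split=> [x _|x y _ _ /inj|x [y _ <-]] //; exists y.
Qed.

Lemma theta_term_opp s : theta_term q (- w) s =
  restrict_int even_int (theta_term q w) s - restrict_int odd_int (theta_term q w) s.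
Proof.
have se := even_or_odd_int s.
rewrite /restrict_int; case: (boolP (s \in odd_int)) se => /= so ->.
  rewrite sub0r /theta_term; move: so; rewrite inE => -[n _ <-].
  have wn : w != 0 by rewrite lt0r_neq0.
  by rewrite !expfzDr ?oppr_eq0 // !expr1z -!exprz_exp -!exprnP sqrrN; ring.
have : s \in even_int by rewrite even_or_odd_int.
rewrite subr0 /theta_term inE => -[n _ <-]; congr (_ * _).
by rewrite -!exprz_exp -!exprnP sqrrN.
Qed.

Lemma theta_term_split s : theta_term q w s =
  restrict_int even_int (theta_term q w) s + restrict_int odd_int (theta_term q w) s.
Proof.
rewrite /restrict_int even_or_odd_int; case: (s \in odd_int) => /=.
  by rewrite add0r.
by rewrite addr0.
Qed.

Lemma cvg_zpart_theta (e : bool) :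
  (fun N => zpart (theta_term q ((-1) ^+ e * w)) N) @ \oo -->
  thetaE q w + (-1) ^+ e * thetaO q w.
Proof.
have [C [d _ _]] := theta_dominated1 q01 w0.
have cE := cvg_zpart (geom_dominated_restrict even_int d).
have cO := cvg_zpart (geom_dominated_restrict odd_int d).
rewrite zsum_restrict in cE; last by move=> x y; lia.
rewrite zsum_restrict in cO; last by move=> x y; lia.
rewrite (_ : (fun N => _) = (fun N => zpart (restrict_int even_int (theta_term q w)) N +
  (-1) ^+ e * zpart (restrict_int odd_int (theta_term q w)) N)).
  by apply: cvgD => //; apply: cvgM => //; exact: cvg_cst.
apply/funext => N; rewrite /zpart mulr_sumr -big_split /=; apply: eq_big_nat => n _.
rewrite /zblock; case: e; rewrite ?expr1 ?expr0 ?mulN1r ?mul1r.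
  by rewrite !theta_term_opp; ring.
by rewrite [in LHS](theta_term_split n) [theta_term q w (Negz n) in LHS]theta_term_split; ring.
Qed.

Lemma theta_term_sign (e : bool) s :
  `|theta_term q ((-1) ^+ e * w) s| = theta_term q w s.
Proof.
have t0 : 0 < theta_term q w s by rewrite theta_term_pos //; case/andP: q01.
case: e; last by rewrite expr0 mul1r ger0_norm // ltW.
rewrite expr1 mulN1r theta_term_opp; rewrite /restrict_int even_or_odd_int.
case: (s \in odd_int) => /=; first by rewrite sub0r normrN ger0_norm // ltW.
by rewrite subr0 ger0_norm // ltW.
Qed.

(** The triple product identity up to a normalization that is the same for w and
    for - w, and which therefore cancels in quotients. *)
Lemma cvg_triple_prod (e : bool) :
  (fun N => triple_prod q N ((-1) ^+ e * w) / central q N) @ \oo -->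
  thetaE q w + (-1) ^+ e * thetaO q w.
Proof.
have [C [d _ _]] := theta_dominated1 q01 w0.
set x := (-1) ^+ e * w.
have x0 : x != 0 by rewrite mulf_neq0 ?expf_neq0 ?oppr_eq0 ?oner_eq0 // lt0r_neq0.
have C0 := geom_dominated_ge0 d.
have p01 := sqr_itv01 q01; set p := q ^+ 2 in p01; have /andP[p0 p1] := p01.
(* The error of the coefficient decays like p^(N - n) and the term like
   2^-n; with this rho the product is at most rho^N for every n, and
   the whole error is of order N^2 rho^N. *)
pose rho := Num.max p 2^-1.
have rho01 : 0 < rho < 1 by rewrite lt_max p0 gt_max p1 invf_lt1 // ltr1n.
have /andP[rho0 rho1] := rho01.
pose t := theta_term q x.
have tb s : `|t s| <= C * 2^-1 ^+ `|s|%N.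
  by rewrite /t theta_term_sign; have /andP[] := d s.
have cv1 : (fun N => zpart t N + t (Posz N)) @ \oo --> thetaE q w + (-1) ^+ e * thetaO q w + 0.
  apply: cvgD; first exact: cvg_zpart_theta.
  apply/norm_cvg0P.
  apply: (@squeeze_cvgr _ _ _ _ (fun=> 0) _ _ _ _ _ (cvg_half_pow C)); last exact: cvg_cst.
  by near=> N; rewrite normr_ge0 /=; exact: (tb (Posz N)).
rewrite addr0 in cv1.
have cv2 : (fun N => triple_prod q N x / central q N - (zpart t N + t (Posz N))) @ \oo --> (0 : R).
  apply/norm_cvg0P.
  have cvb : (fun N => 2 * C * (N%:R ^+ 2 * rho ^+ N)) @ \oo --> (0 : R).
    rewrite -(mulr0 (2 * C)); apply: cvgM; [exact: cvg_cst|exact: cvg_sqr_geom].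
  apply: (@squeeze_cvgr _ _ _ _ (fun=> 0) _ _ _ _ _ cvb); last exact: cvg_cst.
  near=> N; rewrite normr_ge0 /= (triple_prod_sum q01) // mulrAC divff ?mul1r; last first.
    by rewrite lt0r_neq0 // central_gt0.
  have -> : zpart t N + t (Posz N) = 1 + \sum_(0 <= n < N) (t (Posz n.+1) + t (Negz n)).
    have t0 : t 0 = 1 by rewrite /t /theta_term mulr0 !expr0z mulr1.
    have tel : \sum_(0 <= n < N) t (Posz n) + t (Posz N) = 1 + \sum_(0 <= n < N) t (Posz n.+1).
      transitivity (\sum_(0 <= n < N.+1) t (Posz n)); first by rewrite big_nat_recr.
      by rewrite big_nat_recl // t0.
    by rewrite /zpart /zblock !big_split /= addrAC tel addrA.
  rewrite opprD addrACA subrr add0r -sumrB.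
  apply: le_trans (ler_norm_sum _ _ _) _.
  apply: (@le_trans _ _ (\sum_(0 <= n < N) (2 * C * (N%:R * rho ^+ N)))); last first.
    by rewrite sumr_const_nat subn0 -[_ *+ N]mulr_natl le_eqVlt; apply/orP; left; apply/eqP; ring.
  rewrite !big_nat; apply: ler_sum => n /andP[_ nN].
  rewrite -/t -{2}[t _ + t _]mul1r -mulrBl normrM.
  have /andP[b1 b2] := rel_coef_bounds q01 nN.
  have tt : `|t (Posz n.+1) + t (Negz n)| <= 2 * C * 2^-1 ^+ n.+1.
    apply: le_trans (ler_normD _ _) _.
    by have := tb (Posz n.+1); have := tb (Negz n); rewrite /=; lra.
  have rr : `|rel_coef q N n.+1 - 1| <= N%:R * rho ^+ (N - n.+1).
    rewrite distrC ger0_norm ?subr_ge0 // lerBlDl -lerBlDr.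
    apply: le_trans b1; rewrite lerD2l lerN2; apply: ler_pM.
    - by [].
    - by rewrite exprn_ge0 // ltW.
    - by rewrite ler_nat.
    - by apply: lerXn2r; rewrite ?nnegrE ?(ltW p0) ?(ltW rho0) // le_max lexx.
  have hh : 2^-1 ^+ n.+1 <= rho ^+ n.+1.
    by apply: lerXn2r; rewrite ?nnegrE ?(ltW rho0) ?invr_ge0 // le_max lexx orbT.
  apply: le_trans (_ : (N%:R * rho ^+ (N - n.+1)) * (2 * C * rho ^+ n.+1) <= _).
    by apply: ler_pM => //; apply: le_trans tt _; rewrite ler_wpM2l // mulr_ge0.
  have -> : rho ^+ N = rho ^+ (N - n.+1) * rho ^+ n.+1 by rewrite -exprD subnK.
  by rewrite le_eqVlt; apply/orP; left; apply/eqP; ring.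
have cv3 := cvgD cv2 cv1; rewrite add0r in cv3.
rewrite (_ : (fun N => _) = (fun N => (triple_prod q N x / central q N -
  (zpart t N + t (Posz N))) + (zpart t N + t (Posz N)))); first exact: cv3.
by apply/funext => N; rewrite subrK.
Unshelve. all: by end_near. Qed.

End Parity.
End Limits.

(** * The transformation of order k *)

Section ThetaQuotient.
Variable R : realType.

(** The theta series of nome q at - w divided by its value at w. *)
Definition theta_quot (q w : R) : R :=
  (thetaE q w - thetaO q w) / (thetaE q w + thetaO q w).

Lemma cvg_triple_prod_quot (q w : R) : 0 < q < 1 -> 0 < w ->
  (fun N => triple_prod q N (- w) / triple_prod q N w) @ \oo --> theta_quot q w.
Proof.
move=> q01 w0; have := @cvg_triple_prod R q w q01 w0 true; have := @cvg_triple_prod R q w q01 w0 false.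
rewrite !expr0 !mul1r !expr1 !mulN1r => cv1 cv2.
have nz : thetaE q w + thetaO q w != 0.
  by apply: lt0r_neq0; apply: addr_gt0; [exact: thetaE_gt0|exact: thetaO_gt0].
have cv := cvgM cv2 (cvgV nz cv1).
rewrite (_ : (fun N => _) = (fun N => (triple_prod q N (- w) / central q N) *
   (triple_prod q N w / central q N)^-1)); first exact: cv.
apply/funext => N; have c0 := lt0r_neq0 (central_gt0 q01 N).
by move: (central q N) c0 => c c0; rewrite invf_div mulrA divfK.
Qed.

(** The power of p of exponent 2 i - k + 1: for i < k these exponents are
    symmetric about 0. *)
Definition shift_node (p : R) k i : R := p ^+ i.*2 / p ^+ k.-1.

Lemma shift_node_gt0 p k i : 0 < p -> 0 < shift_node p k i.
Proof. by move=> p0; rewrite divr_gt0 ?exprn_gt0. Qed.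

Lemma shift_node_rev p k i : 0 < p -> (i < k)%N ->
  shift_node p k (k - i.+1) = (shift_node p k i)^-1.
Proof.
move=> p0 ik; have pn := lt0r_neq0 p0.
rewrite /shift_node invf_div; apply/eqP; rewrite eqr_div ?expf_neq0 // -!exprD.
by apply/eqP; congr (p ^+ _); lia.
Qed.

(** The exponents k (2 n + 1) + (2 i - k + 1), for i < k, run through the odd
    numbers exactly once. *)
Lemma triple_prod_mul (p x : R) k N : 0 < p -> x != 0 -> (0 < k)%N ->
  triple_prod p (N * k) x =
  \prod_(0 <= i < k) triple_prod (p ^+ k) N (shift_node p k i * x).
Proof.
move=> p0 x0 k0; have pn := lt0r_neq0 p0.
rewrite /triple_prod big_nat_mul exchange_big /=; apply: eq_big_nat => n _.
have shift (F : nat -> R) : \prod_(n * k <= j < n.+1 * k) F j = \prod_(0 <= i < k) F (n * k + i)%N.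
  rewrite -{1}[(n * k)%N]add0n big_addn (_ : (n.+1 * k - n * k = k)%N); last by lia.
  by apply: eq_big_nat => i _; rewrite addnC.
rewrite shift !big_split /=; congr (_ * _).
  apply: eq_big_nat => i /andP[_ ik]; congr (1 + _).
  rewrite /shift_node mulrA; congr (_ * x); apply/eqP.
  rewrite mulrA eq_sym -[X in _ == X]divr1 eqr_div ?expf_neq0 ?oner_eq0 // mulr1.
  by rewrite -!exprM -!exprD; apply/eqP; congr (p ^+ _); nia.
rewrite [RHS]big_nat_rev /= add0n; apply: eq_big_nat => i /andP[_ ik]; congr (1 + _).
rewrite shift_node_rev // invfM invrK /shift_node.
rewrite mulrA; congr (_ / x); apply/eqP.
rewrite mulrA eq_sym -[X in _ == X]divr1 eqr_div ?expf_neq0 ?oner_eq0 // mulr1.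
by rewrite -!exprM -!exprD; apply/eqP; congr (p ^+ _); nia.
Qed.

Lemma cvg_prod_nat k (f : nat -> nat -> R) (l : nat -> R) :
  (forall i, (i < k)%N -> f i @ \oo --> l i) ->
  (fun N => \prod_(0 <= i < k) f i N) @ \oo --> \prod_(0 <= i < k) l i.
Proof.
elim: k => [|k IH] h.
  rewrite big_nil (_ : (fun N => _) = (fun=> 1)); first exact: cvg_cst.
  by apply/funext => N; rewrite big_nil.
rewrite big_nat_recr //= (_ : (fun N => _) = (fun N => (\prod_(0 <= i < k) f i N) * f k N)).
  by apply: cvgM; [apply: IH => i ik; apply: h; exact: ltnW|exact: h].
by apply/funext => N; rewrite big_nat_recr.
Qed.

Lemma theta_quot_prod (p w : R) k : 0 < p < 1 -> 0 < w -> (0 < k)%N ->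
  theta_quot p w = \prod_(0 <= i < k) theta_quot (p ^+ k) (shift_node p k i * w).
Proof.
move=> p01 w0 k0; have /andP[p0 p1] := p01.
have pk01 : 0 < p ^+ k < 1 by rewrite exprn_gt0 //= exprn_ilt1 ?(ltW p0) // -lt0n.
have sub : (fun N => (N * k)%N) @ \oo --> \oo.
  by apply/cvgnyPge => A; near=> N; rewrite (@leq_trans N) ?leq_pmulr //; near: N; exact: nbhs_infty_ge.
have cv1 : (fun N => triple_prod p (N * k) (- w) / triple_prod p (N * k) w) @ \oo --> theta_quot p w.
  exact: (cvg_comp _ _ sub (cvg_triple_prod_quot p01 w0)).
have cv2 : (fun N => \prod_(0 <= i < k) (triple_prod (p ^+ k) N (- (shift_node p k i * w)) /
   triple_prod (p ^+ k) N (shift_node p k i * w))) @ \oo -->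
   \prod_(0 <= i < k) theta_quot (p ^+ k) (shift_node p k i * w).
  apply: cvg_prod_nat => i _; apply: cvg_triple_prod_quot => //.
  by rewrite mulr_gt0 ?shift_node_gt0.
apply: (cvg_unique _ cv1); first exact: Rhausdorff.
rewrite (_ : (fun N => _) = (fun N => \prod_(0 <= i < k) (triple_prod (p ^+ k) N (- (shift_node p k i * w)) /
   triple_prod (p ^+ k) N (shift_node p k i * w)))); first exact: cv2.
apply/funext => N; rewrite !triple_prod_mul ?oppr_eq0 ?lt0r_neq0 //.
by rewrite prodf_div; congr (_ / _); apply: eq_big_nat => i _; rewrite mulrN.
Unshelve. all: by end_near. Qed.

(** The addition formulas: numerator and denominator on the left are the difference
    and the sum of the two products in thetaEM and thetaOM. *)
Lemma theta_quotM (g w v : R) : 0 < g < 1 -> 0 < w -> 0 < v ->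
  theta_quot (g ^+ 2) (v * w) * theta_quot (g ^+ 2) (v^-1 * w) =
  (1 - theta_ratio g w * theta_ratio g v) / (1 + theta_ratio g w * theta_ratio g v).
Proof.
move=> g01 w0 v0; rewrite /theta_quot /theta_ratio [v * w]mulrC [v^-1 * w]mulrC.
have e1 := thetaEM g01 w0 v0; have e2 := thetaOM g01 w0 v0.
have g2 := sqr_itv01 g01.
have wv : 0 < w * v by rewrite mulr_gt0.
have wVv : 0 < w / v by rewrite divr_gt0.
have p1 := thetaE_gt0 g01 w0; have p2 := thetaE_gt0 g01 v0.
have p3 := thetaO_gt0 g01 w0; have p4 := thetaO_gt0 g01 v0.
have p5 := thetaE_gt0 g2 wv; have p6 := thetaE_gt0 g2 wVv.
have p7 := thetaO_gt0 g2 wv; have p8 := thetaO_gt0 g2 wVv.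
move: (thetaE g w) (thetaE g v) (thetaO g w) (thetaO g v) (thetaE _ _) (thetaE _ _)
  (thetaO _ _) (thetaO _ _) e1 e2 p1 p2 p3 p4 p5 p6 p7 p8
  => a b c d e f e' f' e1 e2 p1 p2 p3 p4 p5 p6 p7 p8.
have ab : 0 < a * b by rewrite mulr_gt0.
have cd : 0 < c * d by rewrite mulr_gt0.
have -> : (1 - c / a * (d / b)) / (1 + c / a * (d / b)) = (a * b - c * d) / (a * b + c * d).
  by field; rewrite !lt0r_neq0 ?addr_gt0.
rewrite -e1 -e2; field; rewrite !lt0r_neq0 ?addr_gt0 ?mulr_gt0 //.
Qed.

Lemma theta_quot_sqr (h w : R) : 0 < h < 1 -> 0 < w ->
  theta_quot (h ^+ 2) w ^+ 2 =
  (1 - theta_ratio h w * root_modulus h) / (1 + theta_ratio h w * root_modulus h).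
Proof.
by move=> h01 w0; rewrite -theta_quotM // invr1 !mul1r expr2.
Qed.

(** Squaring theta_quot_prod pairs every node with its inverse, and theta_quotM
    turns each pair into a function of degree one of theta_ratio: passing from
    the nome parameter h^k to h is a rational map of degree k. *)
Lemma theta_ratio_transform (h w : R) k : 0 < h < 1 -> 0 < w -> (0 < k)%N ->
  \prod_(0 <= i < k)
    ((1 - theta_ratio (h ^+ k) w * theta_ratio (h ^+ k) (shift_node (h ^+ 2) k i)) /
     (1 + theta_ratio (h ^+ k) w * theta_ratio (h ^+ k) (shift_node (h ^+ 2) k i))) =
  (1 - theta_ratio h w * root_modulus h) / (1 + theta_ratio h w * root_modulus h).
Proof.
move=> h01 w0 k0; have h2 := sqr_itv01 h01; have /andP[h20 _] := h2.
have hk : 0 < h ^+ k < 1.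
  by case/andP: h01 => h0 h1; rewrite exprn_gt0 //= exprn_ilt1 ?(ltW h0) // -lt0n.
rewrite -theta_quot_sqr // expr2 (theta_quot_prod h2 w0 k0).
rewrite [X in _ = _ * X]big_nat_rev /= add0n -big_split /=.
apply: eq_big_nat => i /andP[_ ik]; rewrite shift_node_rev //.
by rewrite -exprM mulnC exprM theta_quotM // shift_node_gt0.
Qed.

Lemma transform_bounds (h : R) k : 0 < h < 1 -> (0 < k)%N ->
  exists c : nat -> R, (forall i, 0 < c i) /\
  forall y, root_modulus (h ^+ k) <= y <= (root_modulus (h ^+ k))^-1 ->
    0 <= \prod_(0 <= i < k) ((1 - y * c i) / (1 + y * c i)) <=
    (1 - root_modulus h ^+ 2) / (1 + root_modulus h ^+ 2).
Proof.
move=> h01 k0; have hk : 0 < h ^+ k < 1.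
  by case/andP: h01 => h0 h1; rewrite exprn_gt0 //= exprn_ilt1 ?(ltW h0) // -lt0n.
exists (fun i => theta_ratio (h ^+ k) (shift_node (h ^+ 2) k i)); split=> [i|y yI].
  by apply: theta_ratio_gt0 => //; apply: shift_node_gt0; rewrite exprn_gt0 //; case/andP: h01.
have [w w0 <-] := theta_ratio_onto hk yI; rewrite theta_ratio_transform //.
have m0 := root_modulus_gt0 h01.
have := theta_ratio_ge h01 w0; have := theta_ratio_le h01 w0.
move: (theta_ratio h w) (root_modulus h) m0 => f m m0 fm mf.
have f0 : 0 < f by exact: lt_le_trans mf.
have fm1 : f * m <= 1 by move: fm; rewrite -[m^-1]mul1r ler_pdivlMr.
have fm0 : 0 < f * m by rewrite mulr_gt0.
have mm : m ^+ 2 <= f * m by rewrite expr2 ler_pM2r.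
have m20 : 0 <= m ^+ 2 by rewrite sqr_ge0.
apply/andP; split; first by rewrite divr_ge0; lra.
rewrite ler_pdivrMr; last by lra.
rewrite mulrAC ler_pdivlMr; last by lra.
by move: (f * m) (m ^+ 2) fm1 fm0 mm m20 => u v *; nra.
Qed.

End ThetaQuotient.

(** * Rational functions on two intervals *)

Section Rational.
Variable R : realType.

(** The bound on the product in terms of y, rewritten homogeneously in u and v for
    u / v = (1 - m y) / (1 + m y).  Exchanging u and v amounts to y -> - y and
    inverts the product. *)
Lemma node_bounds (m dk : R) (c : nat -> R) k (u v : R) : 0 < m < 1 ->
  (forall i, 0 < c i) ->
  (forall y, m <= y <= m^-1 ->
    0 <= \prod_(0 <= i < k) ((1 - y * c i) / (1 + y * c i)) <= dk) ->
  v != 0 -> 0 <= u / v <= (1 - m ^+ 2) / (1 + m ^+ 2) ->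
  \prod_(0 <= i < k) (m * (v + u) + c i * (v - u)) != 0 /\
  0 <= \prod_(0 <= i < k) (m * (v + u) - c i * (v - u)) /
       \prod_(0 <= i < k) (m * (v + u) + c i * (v - u)) <= dk.
Proof.
move=> /andP[m0 m1] c0 hc v0; set z := u / v => /andP[z0 zd].
have uE : u = z * v by rewrite /z divfK.
have m20 : 0 < m ^+ 2 by rewrite exprn_gt0.
have zd' : z * (1 + m ^+ 2) <= 1 - m ^+ 2 by move: zd; rewrite ler_pdivlMr; lra.
have z1 : z < 1 by nra.
have dz : 0 < m * (1 + z) by rewrite mulr_gt0; lra.
pose y := (1 - z) / (m * (1 + z)).
have ym : m <= y <= m^-1.
  rewrite /y ler_pdivlMr // ler_pdivrMr // mulKf ?lt0r_neq0 // mulrA -expr2.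
  by apply/andP; split; nra.
have fac i : m * (v + u) + c i * (v - u) = v * (m * (1 + z)) * (1 + y * c i).
  by rewrite uE /y; field; apply/andP; split; rewrite lt0r_neq0 //; lra.
have y0 : 0 < y by case/andP: ym => h _; exact: lt_le_trans h.
have nz i : m * (v + u) + c i * (v - u) != 0.
  rewrite fac; apply: mulf_neq0; last by apply: lt0r_neq0; have := mulr_gt0 y0 (c0 i); lra.
  by apply: mulf_neq0 => //; exact: lt0r_neq0.
split; first by rewrite prodf_seq_neq0; apply/allP => i _; rewrite nz.
rewrite -prodf_div (_ : \prod_(0 <= i < k) _ =
  \prod_(0 <= i < k) ((1 - y * c i) / (1 + y * c i))); first exact: hc.
apply: eq_big_nat => i _; rewrite fac uE /y; field.
have ci := c0 i; rewrite v0 !lt0r_neq0 //=; try lra.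
by rewrite addr_gt0 // mulr_gt0; lra.
Qed.

(** Composing with the Moebius map z -> (z - e) / (1 - e z) turns the range
    [0, 2 e / (1 + e^2)] into [- e, e]. *)
Lemma recenter_bound (e r : R) : 0 < e < 1 -> 0 <= r <= 2 * e / (1 + e ^+ 2) ->
  0 < 1 - e * r /\ `|(r - e) / (1 - e * r)| <= e.
Proof.
move=> /andP[e0 e1] /andP[r0]; have e20 : 0 < 1 + e ^+ 2 by rewrite ltr_pwDl // sqr_ge0.
rewrite ler_pdivlMr // => h.
have d0 : 0 < 1 - e * r.
  have : r <= 1 by nra.
  by nra.
split=> //; rewrite normrM normfV (gtr0_norm d0) ler_pdivrMr // ler_norml.
have e1' : 0 <= r * (1 - e ^+ 2) by rewrite mulr_ge0 // subr_ge0 exprn_ile1 // ltW.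
by apply/andP; split; nra.
Qed.

Lemma size_prod_linear k (L : nat -> {poly R}) :
  (forall i, (size (L i) <= 2)%N) -> (size (\prod_(0 <= i < k) L i)%R <= k.+1)%N.
Proof.
move=> h; elim: k => [|k IH]; first by rewrite big_nil size_poly1.
rewrite big_nat_recr //=; apply: leq_trans (size_polyMleq _ _) _.
by rewrite -subn1 leq_subLR (leq_trans (leq_add IH (h k))) // addn2.
Qed.

Local Open Scope complex_scope.

(** The rational function is (A - e B) / (B - e A), where A / B is the product of
    the transformation of order k evaluated at the Moebius coordinate U / V.
    Exchanging U and V exchanges A and B, so the estimate on the nodes y is the
    one on the nodes x for the inverse function. *)
Lemma sigma_cauchy_transform m n k (s : 'I_m -> R[i]) (t : 'I_n -> R[i])
    (x : 'I_m -> R) (y : 'I_n -> R) (U V : {poly R}) (h : R) (j : nat) :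
  0 < h < 1 -> (0 < k)%N -> (size U <= 2)%N -> (size V <= 2)%N ->
  let r := root_modulus (h ^+ k) in
  let del := (1 - r ^+ 2) / (1 + r ^+ 2) in
  (forall i, V.[x i] != 0 /\ 0 <= U.[x i] / V.[x i] <= del) ->
  (forall i, U.[y i] != 0 /\ 0 <= V.[y i] / U.[y i] <= del) ->
  (forall i l, x i != y l) ->
  (1 <= j)%N -> (1 <= j + k <= n)%N ->
  sigma (j + k) (cauchy_mx s t x y) <=
  ((1 - root_modulus h) / (1 + root_modulus h)) ^+ 2 * sigma j (cauchy_mx s t x y).
Proof.
move=> h01 k0 sU sV r del hx hy xy j1 jkn.
have hk : 0 < h ^+ k < 1.
  by case/andP: h01 => h0 h1; rewrite exprn_gt0 //= exprn_ilt1 ?(ltW h0) // -lt0n.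
have r01 : 0 < r < 1 by rewrite root_modulus_gt0 // root_modulus_lt1.
have mh01 : 0 < root_modulus h < 1 by rewrite root_modulus_gt0 // root_modulus_lt1.
have [c [c0 hc]] := transform_bounds h01 k0.
set e := (1 - root_modulus h) / (1 + root_modulus h).
have e01 : 0 < e < 1 := dual_modulus01 mh01.
have dE : (1 - root_modulus h ^+ 2) / (1 + root_modulus h ^+ 2) = 2 * e / (1 + e ^+ 2).
  rewrite /e; move: (root_modulus h) mh01 => u /andP[u0 u1]; field.
  by apply/and3P; split; rewrite lt0r_neq0 //; nra.
rewrite dE in hc.
pose A : {poly R} := \prod_(0 <= i < k) (r *: (V + U) - c i *: (V - U)).
pose B : {poly R} := \prod_(0 <= i < k) (r *: (V + U) + c i *: (V - U)).
have sDB (w : R) : (size (r *: (V + U) + w *: (V - U))%R <= 2)%N.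
  rewrite (leq_trans (size_polyD _ _)) // geq_max !(leq_trans (size_scale_leq _ _)) //.
    by rewrite (leq_trans (size_polyD _ _)) // geq_max sV size_polyN.
  by rewrite (leq_trans (size_polyD _ _)) // geq_max sV.
have sA : (size A <= k.+1)%N by apply: size_prod_linear => i; rewrite -scaleNr.
have sB : (size B <= k.+1)%N by apply: size_prod_linear.
have Ax z : A.[z] = \prod_(0 <= i < k) (r * (V.[z] + U.[z]) - c i * (V.[z] - U.[z])).
  by rewrite horner_prod; apply: eq_big_nat => i _; rewrite !hornerE.
have Bx z : B.[z] = \prod_(0 <= i < k) (r * (V.[z] + U.[z]) + c i * (V.[z] - U.[z])).
  by rewrite horner_prod; apply: eq_big_nat => i _; rewrite !hornerE.
have Ay z : A.[z] = \prod_(0 <= i < k) (r * (U.[z] + V.[z]) + c i * (U.[z] - V.[z])).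
  by rewrite Ax; apply: eq_big_nat => i _; ring.
have By z : B.[z] = \prod_(0 <= i < k) (r * (U.[z] + V.[z]) - c i * (U.[z] - V.[z])).
  by rewrite Bx; apply: eq_big_nat => i _; ring.
have key (a b : R) : b != 0 -> 0 <= a / b <= 2 * e / (1 + e ^+ 2) ->
    b - e * a != 0 /\ `|(a - e * b) / (b - e * a)| <= e.
  move=> b0 /(recenter_bound e01) [d0 le_e].
  have bE : b - e * a = b * (1 - e * (a / b)) by rewrite mulrBr mulr1 mulrCA [b * _]mulrC divfK.
  have aE : a - e * b = b * (a / b - e) by rewrite mulrBr [b * (a / b)]mulrC divfK // [b * e]mulrC.
  rewrite bE aE mulf_neq0 ?(lt0r_neq0 d0) //; split=> //.
  by rewrite invfM mulrACA divff // mul1r.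
have kx i : (B - e *: A).[x i] != 0 /\ `|(A - e *: B).[x i] / (B - e *: A).[x i]| <= e.
  have [V0 hz] := hx i; have [] := node_bounds r01 c0 hc V0 hz.
  by rewrite -Ax -Bx !(hornerD, hornerN, hornerZ); exact: key.
have ky i : (A - e *: B).[y i] != 0 /\ `|(B - e *: A).[y i] / (A - e *: B).[y i]| <= e.
  have [U0 hz] := hy i; have [] := node_bounds r01 c0 hc U0 hz.
  by rewrite -Ay -By !(hornerD, hornerN, hornerZ); exact: key.
have e0 : 0 <= e by case/andP: e01 => /ltW.
have spq (p1 p2 : {poly R}) : (size p1 <= k.+1)%N -> (size p2 <= k.+1)%N ->
    (size (p1 - e *: p2)%R <= k.+1)%N.
  move=> s1 s2; rewrite (leq_trans (size_polyD _ _)) // geq_max s1 size_polyN.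
  exact: leq_trans (size_scale_leq _ _) s2.
rewrite expr2; apply: (@sigma_cauchy_rational R m n k s t x y (A - e *: B) (B - e *: A)) => //.
- exact: spq.
- exact: spq.
- by move=> i; have [] := kx i.
- by move=> i; have [] := ky i.
- by move=> i; have [] := kx i.
- by move=> i; have [] := ky i.
Qed.

End Rational.

(** * The cross-ratio *)

Section CrossRatio.
Variable R : realType.
Local Notation gmu := (@grotzsch_mu R).

Lemma cross_ratio_disjoint (a b c d : R) : a < b -> c < d -> b < c \/ d < a ->
  [/\ 0 < (c - a) * (d - b), 0 < (c - b) * (d - a) &
      abs_cross_ratio a b c d = ((c - a) * (d - b)) / ((c - b) * (d - a))].
Proof.
move=> ab cd disj.
have N0 : 0 < (c - a) * (d - b).
  by case: disj => h; [rewrite mulr_gt0 // | rewrite nmulr_rgt0]; lra.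
have M0 : 0 < (c - b) * (d - a).
  by case: disj => h; [rewrite mulr_gt0 // | rewrite nmulr_rgt0]; lra.
by split=> //; rewrite /abs_cross_ratio -!normrM !gtr0_norm.
Qed.

(** With del^2 = 1 - 1 / gamma and m^2 = (1 - del) / (1 + del), the number
    1 / sqrt gamma = sqrt (1 - del^2) is the Landen transform of m^2. *)
Lemma cross_ratio_parameter (a b c d : R) : a < b -> c < d -> b < c \/ d < a ->
  exists2 m, 0 < m < 1 &
    1 / Num.sqrt (abs_cross_ratio a b c d) = 2 * m / (1 + m ^+ 2) /\
    ((1 - m ^+ 2) / (1 + m ^+ 2)) ^+ 2 * ((c - a) * (d - b)) = (b - a) * (d - c).
Proof.
move=> ab cd disj; have [N0 M0 ->] := cross_ratio_disjoint ab cd disj.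
set N := (c - a) * (d - b) in N0 *; set M := (c - b) * (d - a) in M0 *.
have NM : N - M = (b - a) * (d - c) by rewrite /N /M; ring.
have NM0 : 0 < N - M by rewrite NM mulr_gt0 ?subr_gt0.
pose del := Num.sqrt ((N - M) / N).
have del2 : del ^+ 2 = (N - M) / N by rewrite sqr_sqrtr // divr_ge0 // ltW.
have del01 : 0 < del < 1.
  rewrite sqrtr_gt0 divr_gt0 //= -(@expr_lt1 _ 2) ?sqrtr_ge0 // del2.
  by rewrite ltr_pdivrMr // mul1r ltrBlDr ltrDl.
have q01 := dual_modulus01 del01; set w := (1 - del) / (1 + del) in q01.
have /andP[w0 w1] := q01; have /andP[d0 d1] := del01.
have m01 : 0 < Num.sqrt w < 1 by rewrite sqrtr_gt0 w0 /= -sqrtr1 ltr_sqrt.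
exists (Num.sqrt w) => //; rewrite sqr_sqrtr ?(ltW w0) //.
have dE : (1 - w) / (1 + w) = del.
  by rewrite /w; field; apply/andP; split; rewrite lt0r_neq0 //; lra.
split; last by rewrite dE del2 divfK ?lt0r_neq0.
have s0 : 0 < 2 * Num.sqrt w / (1 + w) by rewrite divr_gt0 ?mulr_gt0 ?sqrtr_gt0 //; lra.
have g0 : 0 < Num.sqrt (N / M) by rewrite sqrtr_gt0 divr_gt0.
apply/eqP; rewrite -(@eqrXn2 _ 2) ?(ltW s0) ?divr_ge0 ?(ltW g0) //.
rewrite !expr_div_n expr1n sqr_sqrtr ?divr_ge0 ?(ltW N0) ?(ltW M0) //.
rewrite exprMn sqr_sqrtr ?(ltW w0) // div1r invf_div.
have -> : 2 ^+ 2 * w / (1 + w) ^+ 2 = 1 - ((1 - w) / (1 + w)) ^+ 2 by field; lra.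
rewrite dE del2; apply/eqP; field; exact: lt0r_neq0.
Qed.

Lemma ratio_bounds (u v del : R) : (0 < v /\ 0 <= u <= del * v) \/
    (v < 0 /\ del * v <= u <= 0) -> v != 0 /\ 0 <= u / v <= del.
Proof.
case=> -[v0 /andP[h1 h2]].
  split; first exact: lt0r_neq0.
  by rewrite divr_ge0 ?(ltW v0) //= ler_pdivrMr.
split; first exact: ltr0_neq0.
by rewrite mulr_le0 ?invr_le0 ?(ltW v0) //= ler_ndivrMr.
Qed.

(** The Moebius map u / v takes a, b to 0, del and c, d to 1 / del, infinity; the
    value of del is forced by the cross-ratio. *)
Lemma moebius_bounds (a b c d del : R) : a < b -> c < d -> b < c \/ d < a ->
  0 < del -> del ^+ 2 * ((c - a) * (d - b)) = (b - a) * (d - c) ->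
  let u x := del * (d - b) * (x - a) in
  let v x := (b - a) * (d - x) in
  (forall x, a <= x <= b -> v x != 0 /\ 0 <= u x / v x <= del) /\
  (forall y, c <= y <= d -> u y != 0 /\ 0 <= v y / u y <= del).
Proof.
move=> ab cd disj del0 del2 u v; split=> [x /andP[ax xb]|y /andP[cy yd]]; apply: ratio_bounds.
- have e : (b - a) * (d - x) - (d - b) * (x - a) = (b - x) * (d - a) by ring.
  rewrite /u /v -mulrA; case: disj => h; [left|right]; split.
  + by rewrite mulr_gt0; lra.
  + rewrite mulr_ge0 ?mulr_ge0 ?(ltW del0) //=; try lra.
    rewrite ler_pM2l // -subr_ge0 e mulr_ge0 //; lra.
  + by rewrite pmulr_rlt0; lra.
  + rewrite ler_pM2l // pmulr_rle0 //; apply/andP; split.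
      by rewrite -subr_le0 e mulr_ge0_le0 //; lra.
    by rewrite mulr_le0_ge0 //; lra.
- left; have e : (d - c) * (y - a) - (d - y) * (c - a) = (d - a) * (y - c) by ring.
  have dU : del * u y * (c - a) = (b - a) * (d - c) * (y - a) by rewrite /u -del2; ring.
  have vU : v y * (c - a) = (b - a) * ((d - y) * (c - a)) by rewrite /v; ring.
  case: disj => h.
  + have ca : 0 < c - a by lra.
    split; first by rewrite /u !mulr_gt0 //; lra.
    rewrite /v mulr_ge0 /=; try lra.
    rewrite -(ler_pM2r ca) dU vU -mulrA ler_pM2l; last by lra.
    by rewrite -subr_ge0 e mulr_ge0 //; lra.
  + have ca : c - a < 0 by lra.
    split; first by rewrite /u -mulrA mulr_gt0 // nmulr_rgt0; lra.
    rewrite /v mulr_ge0 /=; try lra.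
    rewrite -(ler_nM2r ca) dU vU -mulrA ler_pM2l; last by lra.
    by rewrite -subr_le0 e mulr_le0_ge0 //; lra.
Qed.

Lemma grotzsch_mu_cross_ratio m : 0 < m < 1 ->
  gmu (m ^+ 2) = 2 * gmu (2 * m / (1 + m ^+ 2)).
Proof.
move=> m01; have l01 := sqr_itv01 m01; have := grotzsch_mu_landen l01.
rewrite sqrtr_sqr ger0_norm; last by case/andP: m01 => /ltW.
by move=> ->; rewrite mulrC divfK.
Qed.

End CrossRatio.

Local Close Scope classical_set_scope.

Theorem corollary4p2 (R : realType) (m n : nat) (hn : (1 <= n)%N)
    (hnm : (n <= m)%N) (a b c d : R) (hab : a < b) (hcd : c < d)
    (hdisj : b < c \/ d < a)
    (x : 'I_m -> R) (y : 'I_n -> R)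
    (x_incr : forall i j : 'I_m, (i < j)%N -> x i < x j)
    (y_incr : forall i j : 'I_n, (i < j)%N -> y i < y j)
    (x_ab : forall i : 'I_m, a <= x i <= b)
    (y_cd : forall i : 'I_n, c <= y i <= d)
    (s : 'I_m -> R[i]) (t : 'I_n -> R[i]) :
  let C := cauchy_mx s t x y in
  let gamma := abs_cross_ratio a b c d in
  [/\ forall j k : nat, (1 <= j)%N -> (1 <= j + k <= n)%N ->
        sigma (j + k) C <=
        4 * (expR (pi ^+ 2 / (4 * grotzsch_mu (1 / Num.sqrt gamma))))
              ^- (2 * k) * sigma j C,
      0 < a -> c = - b -> d = - a ->
        2 * grotzsch_mu (1 / Num.sqrt gamma) = grotzsch_mu (a / b)
    & forall j k : nat, (1 <= j)%N -> (1 <= j + k <= n)%N ->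
        sigma (j + k) C <=
        4 * (expR (pi ^+ 2 / (2 * ln (16 * gamma)))) ^- (2 * k) * sigma j C].
Proof.
move=> C gamma.
have [r r01 [gammaE delE]] := cross_ratio_parameter hab hcd hdisj.
have r201 := sqr_itv01 r01; have /andP[r0 r1] := r01.
have mu_gamma : grotzsch_mu (r ^+ 2) = 2 * grotzsch_mu (1 / Num.sqrt gamma).
  by rewrite gammaE grotzsch_mu_cross_ratio.
have mu0 : 0 < grotzsch_mu (1 / Num.sqrt gamma).
  by have := grotzsch_mu_gt0 r201; rewrite mu_gamma pmulr_rgt0.
have xy i l : x i != y l.
  have := x_ab i; have := y_cd l => /andP[? ?] /andP[? ?].
  by apply/eqP => e; case: hdisj => ?; lra.
have main j k : (1 <= j)%N -> (1 <= j + k <= n)%N ->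
    sigma (j + k) C <= 4 * (expR (pi ^+ 2 / (4 * grotzsch_mu (1 / Num.sqrt gamma))))
              ^- (2 * k) * sigma j C.
  move=> j1 jkn; have [->|k0] := posnP k.
    rewrite addn0 muln0 expr0 invr1 mulr1; have := sigma_ge0 C j; lra.
  have [g g01 mg] := root_modulus_onto r01; have /andP[g0 g1] := g01.
  have kR : (0 : R) < k%:R by rewrite ltr0n.
  pose h := expR (ln g / k%:R).
  have hk : h ^+ k = g.
    by rewrite /h -expRM_natl mulrC divfK ?lt0r_neq0 // lnK.
  have h01 : 0 < h < 1.
    by rewrite expR_gt0 /= expR_lt1 pmulr_llt0 ?invr_gt0 // ln_lt0.
  pose del := (1 - r ^+ 2) / (1 + r ^+ 2).
  have del0 : 0 < del by case/andP: (dual_modulus01 r201).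
  have [hE hF] := moebius_bounds hab hcd hdisj del0 delE.
  pose U : {poly R} := (del * (d - b)) *: ('X - a%:P).
  pose V : {poly R} := (b - a) *: (d%:P - 'X).
  have sU : (size U <= 2)%N by rewrite (leq_trans (size_scale_leq _ _)) // size_XsubC.
  have sV : (size V <= 2)%N.
    by rewrite (leq_trans (size_scale_leq _ _)) // -opprB size_polyN size_XsubC.
  have Uz z : U.[z] = del * (d - b) * (z - a) by rewrite !hornerE.
  have Vz z : V.[z] = (b - a) * (d - z) by rewrite !hornerE.
  apply: le_trans (@sigma_cauchy_transform R m n k s t x y U V h j h01 k0 sU sV _ _ xy j1 jkn) _.
  - by move=> i; rewrite hk mg Uz Vz; exact: hE.
  - by move=> i; rewrite hk mg Uz Vz; exact: hF.
  apply: ler_wpM2r; first exact: sigma_ge0.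
  have mh01 : 0 < root_modulus h < 1 by rewrite root_modulus_gt0 // root_modulus_lt1.
  apply: le_trans (sqr_dual_le mh01) _; rewrite ler_pM2l //.
  have muh : grotzsch_mu (r ^+ 2) = k%:R * grotzsch_mu (root_modulus h ^+ 2).
    rewrite -mg !grotzsch_mu_root_modulus // /h expRK; field; exact: lt0r_neq0.
  have muh0 := grotzsch_mu_gt0 (sqr_itv01 mh01).
  rewrite -expRM_natl -expRN ler_expR.
  have -> : 4 * grotzsch_mu (1 / Num.sqrt gamma) = 2 * (k%:R * grotzsch_mu (root_modulus h ^+ 2)).
    by rewrite -muh mu_gamma; ring.
  rewrite natrM; move: (pi ^+ 2) (grotzsch_mu _) muh0 => p mu mu1.
  rewrite le_eqVlt; apply/orP; left; apply/eqP; field.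
  by rewrite !lt0r_neq0.
split=> //.
- move=> a0 cb da; have b0 : 0 < b by exact: lt_trans hab.
  have k01 : 0 < a / b < 1 by rewrite divr_gt0 //= ltr_pdivrMr // mul1r.
  have /andP[k0 k1] := k01.
  have -> : 1 / Num.sqrt gamma = 2 * Num.sqrt (a / b) / (1 + a / b).
    have [N0 M0 gE] := cross_ratio_disjoint hab hcd hdisj.
    have g0 : 0 < gamma by rewrite /gamma gE divr_gt0.
    apply/eqP; rewrite -(@eqrXn2 _ 2) ?divr_ge0 ?mulr_ge0 ?sqrtr_ge0 //; last by lra.
    rewrite !expr_div_n exprMn expr1n !sqr_sqrtr ?(ltW g0) ?(ltW k0) // /gamma gE cb da.
    apply/eqP; field.
    by apply/and5P; split; (apply: lt0r_neq0; lra) || (apply: ltr0_neq0; lra).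
  by rewrite grotzsch_mu_landen // mulrC divfK.
- move=> j k j1 jkn; apply: le_trans (main j k j1 jkn) _.
  have [N0 M0 gE] := cross_ratio_disjoint hab hcd hdisj.
  have g0 : 0 < gamma by rewrite /gamma gE divr_gt0.
  have k01 : 0 < 1 / Num.sqrt gamma < 1.
    rewrite gammaE divr_gt0 ?mulr_gt0 //=; last by rewrite ltr_pwDl ?sqr_ge0.
    rewrite ltr_pdivrMr; last by rewrite ltr_pwDl ?sqr_ge0.
    rewrite mul1r -subr_gt0 (_ : _ - _ = (1 - r) ^+ 2); last by ring.
    by rewrite exprn_gt0 // subr_gt0.
  have le_log : 4 * grotzsch_mu (1 / Num.sqrt gamma) <= 2 * ln (16 * gamma).
    have := grotzsch_mu_le_log k01; rewrite div1r lnV ?posrE ?sqrtr_gt0 //.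
    have -> : ln (16 * gamma) = 2 * ln 4 + 2 * ln (Num.sqrt gamma).
      rewrite lnM ?posrE // (_ : 16 = 4 ^+ 2); last by ring.
      rewrite lnXn // -{1}[gamma]sqr_sqrtr ?(ltW g0) // lnXn ?sqrtr_gt0 //.
      by rewrite !mulr_natl.
    lra.
  apply: ler_wpM2r; first exact: sigma_ge0.
  rewrite ler_pM2l // lef_pV2 ?posrE ?exprn_gt0 ?expR_gt0 //.
  apply: lerXn2r; rewrite ?nnegrE ?expR_ge0 // ler_expR.
  have mu4 : 0 < 4 * grotzsch_mu (1 / Num.sqrt gamma) by rewrite mulr_gt0.
  have log2 := lt_le_trans mu4 le_log.
  by rewrite ler_pM2l ?exprn_gt0 ?pi_gt0 // lef_pV2.
Qed.
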